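(* Let $s\in(0,1)$, $N>2s$, $p\in\left(1,\frac{N+2s}{N-2s}\right)$, and let $\Omega\subset\mathbb{R}^N$ be a smooth bounded domain. Let $Q:\mathbb{R}^N\setminus\Omega\to\mathbb{R}$ be continuous, and suppose there is a constant $\tilde Q>0$ such that $Q(x)\ge\tilde Q$ for all $x\in\mathbb{R}^N\setminus\Omega$ and $\lim_{|x|\to+\infty}Q(x)=\tilde Q$. Then the problem $$(-\Delta)^su+u=Q(x)|u|^{p-1}u\ \text{ in }\mathbb{R}^N\setminus\Omega,\qquad \mathcal{N}_su=0\ \text{ in }\Omega$$ has a ground state solution.
   Context: The operators are $(-\Delta)^su(x)=\mathrm{P.V.}\int_{\mathbb{R}^N}\frac{u(x)-u(y)}{|x-y|^{N+2s}}dy$ and $\mathcal{N}_su(x)=\int_{\mathbb{R}^N\setminus\Omega}\frac{u(x)-u(y)}{|x-y|^{N+2s}}dy$ for $x\in\Omega$ (normalizing constant taken equal to $1$). Put $\tilde\Omega=\mathbb{R}^N\setminus\Omega$, $\Omega^2=\Omega\times\Omega$, and let $H^s_{\tilde\Omega}$ be the Hilbert space of measurable functions $u:\mathbb{R}^N\to\mathbb{R}$ with $$\|u\|_{H^s_{\tilde\Omega}}^2=\frac12\iint_{\mathbb{R}^{2N}\setminus\Omega^2}\frac{|u(x)-u(y)|^2}{|x-y|^{N+2s}}dy\,dx+\int_{\mathbb{R}^N\setminus\Omega}|u|^2dx<\infty .$$ The energy functional $I:H^s_{\tilde\Omega}\to\mathbb{R}$ is $$I(u)=\frac12\|u\|_{H^s_{\tilde\Omega}}^2-\frac1{p+1}\int_{\mathbb{R}^N\setminus\Omega}Q(x)|u|^{p+1}dx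 .$$ A (weak) solution is a $u\in H^s_{\tilde\Omega}$ with $I'(u)=0$, i.e. for all $v\in H^s_{\tilde\Omega}$, $$\frac12\iint_{\mathbb{R}^{2N}\setminus\Omega^2}\frac{[u(x)-u(y)][v(x)-v(y)]}{|x-y|^{N+2s}}dy\,dx+\int_{\mathbb{R}^N\setminus\Omega}uv\,dx=\int_{\mathbb{R}^N\setminus\Omega}Q|u|^{p-1}uv\,dx.$$ Let $\mathcal{N}=\{u\in H^s_{\tilde\Omega}\setminus\{0\}: I'(u)u=0\}$ and $c_1=\inf_{u\in H^s_{\tilde\Omega}\setminus\{0\}}\sup_{t\ge0}I(tu)=\inf_{u\in\mathcal{N}}I(u)$. A ground state solution is a $u\in H^s_{\tilde\Omega}$ with $I(u)=c_1$ and $I'(u)=0$. *)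

(* Defs.v *)
From HB Require Import structures.
From mathcomp Require Import all_boot all_order all_algebra.
From mathcomp Require Import all_classical all_reals all_analysis.

Set Implicit Arguments.
Unset Strict Implicit.
Unset Printing Implicit Defensive.

Import Order.TTheory GRing.Theory Num.Theory.
Import numFieldNormedType.Exports.

Local Open Scope classical_set_scope.
Local Open Scope ring_scope.

(* R^n is 'rV[R]_n with the product topology of the library (whose norm is the
   sup norm) and the sigma-algebra generated by the coordinates, i.e. the Borel
   one; the Euclidean norm is enorm below. *)

Section measurable_rV.
Context d (T : measurableType d) (n : nat).

Let coord (i : 'I_n) (x : 'rV[T]_n) : T := x ord0 i.

Let rV_set0 : g_sigma_preimage coord set0.
Proof. exact: sigma_algebra0. Qed.

Let rV_setC A : g_sigma_preimage coord A -> g_sigma_preimage coord (~` A).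
Proof. exact: sigma_algebraC. Qed.

Let rV_bigcup (F : _^nat) : (forall i, g_sigma_preimage coord (F i)) ->
  g_sigma_preimage coord (\bigcup_i (F i)).
Proof. exact: sigma_algebra_bigcup. Qed.

HB.instance Definition _ := @isMeasurable.Build (measure_tuple_display d)
  'rV[T]_n (g_sigma_preimage coord) rV_set0 rV_setC rV_bigcup.

End measurable_rV.

Lemma measurable_rV_coord d (T : measurableType d) n (i : 'I_n) :
  measurable_fun [set: 'rV[T]_n] (fun x : 'rV[T]_n => x ord0 i).
Proof.
move=> _ Y mY; rewrite setTI; apply: sub_sigma_algebra => /=.
rewrite -bigcup_seq/=; exists i => /=; first by rewrite mem_index_enum.
by exists Y => //; rewrite setTI.
Qed.

Lemma measurable_fun_rV d1 d2 (T1 : measurableType d1) (T2 : measurableType d2)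
    n (f : T1 -> 'rV[T2]_n) :
  (forall i, measurable_fun [set: T1] (fun x => f x ord0 i)) ->
  measurable_fun [set: T1] f.
Proof.
move=> mf; pose G := \big[setU/set0]_(i < n)
  preimage_set_system setT (fun x : 'rV[T2]_n => x ord0 i) measurable.
apply: (@measurability _ _ _ _ _ _ G) => // _ [B + <-].
rewrite /G -bigcup_seq/= => -[i _ [A mA <-]].
by rewrite !setTI; have := mf i measurableT _ mA; rewrite setTI.
Qed.

Section lebesgue_rV.
Context {R : realType}.

Definition rV_cons n (z : measurableTypeR R * 'rV[R]_n) : 'rV[R]_n.+1 :=
  row_mx (const_mx z.1 : 'rV[R]_1) z.2.

Lemma measurable_rV_cons n : measurable_fun setT (@rV_cons n).
Proof.
apply: measurable_fun_rV => i; rewrite /rV_cons.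
under eq_fun do rewrite mxE.
case: splitP => j _.
  by under eq_fun do rewrite mxE; exact: measurable_fst.
apply: (@measurableT_comp _ _ _ _ _ _ (fun x : 'rV[R]_n => x ord0 j)) => //.
exact: measurable_rV_coord.
Qed.

Section step.
Context n (mu : {sigma_finite_measure set 'rV[R]_n -> \bar R}).

Let prod : {measure set (measurableTypeR R * 'rV[R]_n) -> \bar R} :=
  (@lebesgue_measure R \x mu)%E.

Definition lebesgue_rV_step : set 'rV[R]_n.+1 -> \bar R :=
  pushforward (@lebesgue_measure R \x mu)%E (@rV_cons n).

HB.instance Definition _ := Measure.copy lebesgue_rV_step
  (measure_function_pushforward__canonical__measure_function_Measure
    prod (@measurable_rV_cons n)).

Let sigma_finite_step : sigma_finite setT lebesgue_rV_step.
Proof.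
have /sigma_finiteP[F [TF ndF Foo]] := sigma_finiteT (@lebesgue_measure R).
have /sigma_finiteP[G [TG ndG Goo]] := sigma_finiteT mu.
pose g (x : 'rV[R]_n.+1)
  : measurableTypeR R * 'rV[R]_n := (x ord0 ord0, @rsubmx _ 1 1 n x).
have mg : measurable_fun setT g.
  apply/measurable_fun_pairP; split; first exact: measurable_rV_coord.
  apply: measurable_fun_rV => i; rewrite /g/=.
  by under eq_fun do rewrite mxE; exact: measurable_rV_coord.
have gK z : g (rV_cons z) = z.
  case: z => a x; rewrite /g/rV_cons; congr pair; last exact: row_mxKr.
  by rewrite mxE; case: splitP => j // _; rewrite mxE.
exists (fun k => g @^-1` (F k `*` G k)).
  rewrite -preimage_bigcup -[LHS](preimage_setT g); congr (_ @^-1` _).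
  rewrite -setXTT TF TG predeqE => -[x y]; split.
    move=> [/= [i _ Fix] [k _ Gky]]; exists (maxn i k) => //; split.
    - by move: x Fix; exact/subsetPset/ndF/leq_maxl.
    - by move: y Gky; exact/subsetPset/ndG/leq_maxr.
  by move=> [i _ []/= ? ?]; split; exists i.
move=> k; have [mF Fk] := Foo k; have [mG Gk] := Goo k.
have mFG : measurable (F k `*` G k) by exact: measurableX.
split; first by rewrite -[X in measurable X]setTI; exact: mg.
rewrite /lebesgue_rV_step /pushforward.
rewrite (_ : _ @^-1` _ = F k `*` G k); last first.
  rewrite -comp_preimage (_ : g \o _ = id) ?preimage_id//.
  by apply/funext => z; exact: gK.
by rewrite product_measure1E// lte_mul_pinfty// ge0_fin_numE.
Qed.

HB.instance Definition _ := Measure_isSigmaFinite.Build _ _ _ lebesgue_rV_step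
  sigma_finite_step.

End step.

Fixpoint lebesgue_rV n : {sigma_finite_measure set 'rV[R]_n -> \bar R} :=
  if n is n'.+1 then lebesgue_rV_step (lebesgue_rV n')
  else dirac (0 : 'rV[R]_0).

Lemma lebesgue_rV_box n (A : 'I_n -> set R) :
  (forall i, measurable (A i)) ->
  lebesgue_rV n [set x | forall i, A i (x ord0 i)] =
  (\prod_(i < n) lebesgue_measure (A i))%E.
Proof.
elim: n A => [|n IH] A mA.
  by rewrite big_ord0 /= diracE mem_set// => -[].
pose B := [set x : 'rV[R]_n | forall i, A (lift ord0 i) (x ord0 i)].
have mB : measurable B.
  rewrite (_ : B = \bigcap_(i in [set: 'I_n])
      ((fun x : 'rV[R]_n => x ord0 i) @^-1` A (lift ord0 i))).
    apply: fin_bigcap_measurable => // i _.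
    by rewrite -[X in measurable X]setTI; exact: measurable_rV_coord.
  by apply/seteqP; split=> x Bx i; [move=> _|]; apply: Bx.
have -> : lebesgue_rV n.+1 [set x | forall i, A i (x ord0 i)] =
    (@lebesgue_measure R \x lebesgue_rV n)%E (A ord0 `*` B).
  rewrite /= /lebesgue_rV_step /pushforward; congr product_measure1.
  apply/seteqP; split=> -[a x]; rewrite /rV_cons/=.
    move=> H; split=> [|i]/=.
      by have := H ord0; rewrite mxE; case: splitP => j //; rewrite mxE.
    have := H (lift ord0 i); rewrite mxE.
    case: splitP => j; rewrite /= /bump/= add1n; last by case=> /val_inj ->.
    by move=> ij; have := ltn_ord j; rewrite -ij.
  move=> [/= Aa Bx] i; rewrite mxE; case: splitP => j ij.
    by rewrite mxE (_ : i = ord0)//; move: ij; rewrite ord1 => ij; apply/val_inj.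
  by rewrite (_ : i = lift ord0 j)//; apply/val_inj.
rewrite big_ord_recl -IH; last by move=> i; exact: mA.
have := @product_measure1E _ _ (measurableTypeR R) _ _ lebesgue_measure (lebesgue_rV n) (A ord0) B (mA ord0) mB.
by move=> ->.
Qed.

End lebesgue_rV.

Section smooth_domain.
Context {R : realType}.

(* C^k through iterated directional derivatives (equivalent to iterated partial
   derivatives on R^n). *)
Fixpoint Ck n (k : nat) (f : 'rV[R]_n -> R) : Prop :=
  if k is k'.+1 then
    continuous f /\
    forall v : 'rV[R]_n, (forall x, derivable f x v) /\ Ck k' ('D_v f)
  else continuous f.

Definition smooth n (f : 'rV[R]_n -> R) : Prop := forall k, Ck k f.

(* Near each boundary point, up to the choice of a coordinate i and of a side b,
   Om is the set of points above the graph of a smooth function g of the other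
   coordinates. *)
Definition smooth_boundary n (Om : set 'rV[R]_n) : Prop :=
  forall x0, (closure Om `\` interior Om) x0 ->
  exists (i : 'I_n) (b : bool) (g : 'rV[R]_n.-1 -> R),
    smooth g /\
    \forall x \near x0, Om x <-> 0 < (-1) ^+ b * (x ord0 i - g (col' i x)).

Definition smooth_bounded_domain n (Om : set 'rV[R]_n) : Prop :=
  [/\ Om !=set0, open Om, connected Om, bounded_set Om & smooth_boundary Om].

End smooth_domain.

Section exterior_problem.
Context {R : realType}.

Definition enorm n (x : 'rV[R]_n) : R := Num.sqrt (\sum_i x ord0 i ^+ 2).

Variables (N : nat) (s p : R) (Om : set 'rV[R]_N) (Q : 'rV[R]_N -> R).

Local Notation mu := (lebesgue_rV N).
Local Notation mu2 := (lebesgue_rV N \x lebesgue_rV N)%E.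

(* On the (negligible) diagonal, kernel is 0 ^-1 = 0. *)
Definition kernel (z : 'rV[R]_N * 'rV[R]_N) : R :=
  (enorm (z.1 - z.2) `^ (N%:R + 2 * s))^-1.

Definition Hs_norm2 (u : 'rV[R]_N -> R) : \bar R :=
  ((2^-1)%:E *
   (\int[mu2]_(z in ~` (Om `*` Om)) (`|u z.1 - u z.2| ^+ 2 * kernel z)%:E) +
   \int[mu]_(x in ~` Om) (`|u x| ^+ 2)%:E)%E.

Definition Hs (u : 'rV[R]_N -> R) : Prop :=
  measurable_fun setT u /\ (Hs_norm2 u < +oo)%E.

(* Elements of the Hilbert space are classes modulo equality almost everywhere
   on R^N. *)
Definition Hs_neq0 (u : 'rV[R]_N -> R) : Prop :=
  Hs u /\ ~ {ae mu, forall x, u x = 0}.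

Definition energy (u : 'rV[R]_N -> R) : R :=
  2^-1 * fine (Hs_norm2 u) -
  (p + 1)^-1 * \int[mu]_(x in ~` Om) (Q x * `|u x| `^ (p + 1)).

(* The derivative I'(u)v of the energy I at u in the direction v. *)
Definition denergy (u v : 'rV[R]_N -> R) : R :=
  2^-1 * (\int[mu2]_(z in ~` (Om `*` Om))
            ((u z.1 - u z.2) * (v z.1 - v z.2) * kernel z)) +
  \int[mu]_(x in ~` Om) (u x * v x) -
  \int[mu]_(x in ~` Om) (Q x * `|u x| `^ (p - 1) * u x * v x).

Definition weak_solution (u : 'rV[R]_N -> R) : Prop :=
  Hs u /\ forall v, Hs v -> denergy u v = 0.

Definition nehari (u : 'rV[R]_N -> R) : Prop := Hs_neq0 u /\ denergy u u = 0.

(* The supremum is +oo when u vanishes a.e. outside Om but not inside. *)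
Definition minimax_level : \bar R :=
  ereal_inf [set ereal_sup [set (energy (fun x => t * u x))%:E
                           | t in [set t | 0 <= t]]
            | u in Hs_neq0].

Definition nehari_level : \bar R := ereal_inf [set (energy u)%:E | u in nehari].

(* The level c_1 is both the minimax level and the infimum over the Nehari
   set, so a ground state attains both. *)
Definition ground_state (u : 'rV[R]_N -> R) : Prop :=
  [/\ weak_solution u, (energy u)%:E = minimax_level &
      (energy u)%:E = nehari_level].

End exterior_problem.

(* Main.v *)
Require Import Defs.
From mathcomp Require Import all_boot all_order all_algebra.
From mathcomp Require Import all_classical all_reals all_analysis.
From mathcomp Require Import measurable_realfun ring lra.

Set Implicit Arguments.
Unset Strict Implicit.
Unset Printing Implicit Defensive.

Import Order.TTheory GRing.Theory Num.Theory.
Import numFieldNormedType.Exports.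

Local Open Scope classical_set_scope.
Local Open Scope ring_scope.

Section powers.
Context {R : realType}.
Implicit Types (a b c d t x y q r : R).

Lemma powR_mono q x y : 0 <= q -> 0 <= x -> x <= y -> x `^ q <= y `^ q.
Proof.
move=> q0 x0 xy; apply: ge0_ler_powR => //; rewrite nnegrE //.
exact: le_trans xy.
Qed.

Lemma powR_subM1 q y : 1 < q -> 0 <= y -> y `^ q = y `^ (q - 1) * y.
Proof. by move=> q1 y0; rewrite mulrC mulr_powRB1//; lra. Qed.

Lemma powR_tangent q x y : 1 < q -> 0 <= x -> 0 <= y ->
  y `^ q + q * y `^ (q - 1) * (x - y) <= x `^ q.
Proof.
move=> q1 x0 y0.
have q10 : 0 < q - 1 by lra.
have qp : 0 < q by lra.
have := @conjugate_powR R x (y `^ (q - 1)) q (q / (q - 1)) x0 (powR_ge0 _ _) qp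
  (divr_gt0 qp q10).
have -> : q^-1 + (q / (q - 1))^-1 = 1.
  by rewrite invf_div; field; rewrite ?gt_eqF ?qp ?q10 ?p2 //; lra.
move=> /(_ erefl); rewrite -powRrM.
have -> : (q - 1) * (q / (q - 1)) = q by field; lra.
rewrite (_ : y `^ q / (q / (q - 1)) = y `^ q * (q - 1) / q); last first.
  by rewrite invf_div mulrA.
rewrite -mulrDl ler_pdivlMr// => H.
have := powR_subM1 q1 y0; nra.
Qed.

Lemma powR_sub_le q x y : 1 < q -> 0 <= x -> 0 <= y ->
  `|x `^ q - y `^ q| <= q * (Num.max x y) `^ (q - 1) * `|x - y|.
Proof.
move=> q1; wlog xy : x y / x <= y.
  move=> H x0 y0; have [xy|/ltW yx] := leP x y.
    by have := H x y xy x0 y0; rewrite (max_idPr xy).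
  by have := H y x yx y0 x0; rewrite distrC (distrC y) (max_idPr yx).
move=> x0 y0.
have m : x `^ q <= y `^ q by apply: powR_mono => //; lra.
rewrite ler0_norm ?subr_le0// ler0_norm ?subr_le0// (max_idPr xy).
have := powR_tangent q1 x0 y0; lra.
Qed.

Lemma mul_powR_split q d t x : 1 < q -> 0 < d -> 0 <= t -> 0 <= x ->
  t * x `^ (q - 1) <= d * x `^ q + d `^ (1 - q) * t `^ q.
Proof.
move=> q1 d0 t0 x0; have [tx|/ltW tx] := leP t (d * x).
  rewrite (powR_subM1 q1 x0).
  have := powR_ge0 x (q - 1); have := powR_ge0 d (1 - q); have := powR_ge0 t q.
  by nra.
have xt : x <= d^-1 * t by rewrite mulrC ler_pdivlMr // mulrC.
have : x `^ (q - 1) <= (d^-1 * t) `^ (q - 1) by apply: powR_mono => //; lra.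
rewrite powRM ?invr_ge0 ?(ltW d0)//.
have -> : d^-1 `^ (q - 1) = d `^ (1 - q).
  by rewrite -(powR_inv1 (ltW d0)) -powRrM; congr (_ `^ _); lra.
rewrite (powR_subM1 q1 t0) => H.
have := powR_ge0 x q; have := powR_ge0 d (1 - q).
by nra.
Qed.

Lemma powR_sum_le q x y : 0 <= q -> 0 <= x -> 0 <= y ->
  (x + y) `^ q <= 2 `^ q * (x `^ q + y `^ q).
Proof.
move=> q0 x0 y0; rewrite mulrDr -!powRM //.
have [xy|/ltW yx] := leP x y.
  apply: (@le_trans _ _ ((2 * y) `^ q)); first by apply: powR_mono; lra.
  by rewrite lerDr powR_ge0.
apply: (@le_trans _ _ ((2 * x) `^ q)); first by apply: powR_mono; lra.
by rewrite lerDl powR_ge0.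
Qed.

Lemma brezis_lieb_pointwise q d : 1 < q -> 0 < d -> exists2 C, 0 <= C &
  forall a c, `| `|a + c| `^ q - `|a| `^ q | <= d * `|a| `^ q + C * `|c| `^ q.
Proof.
move=> q1 d0; set e := d / (q * 2 `^ q).
have qp : 0 < q by lra.
have p2 : 0 < 2 `^ q by apply: powR_gt0.
have e0 : 0 < e by rewrite divr_gt0 ?mulr_gt0.
exists (d + q * e `^ (1 - q)) => [|a c].
  by rewrite addr_ge0 ?mulr_ge0 ?powR_ge0 ?(ltW d0)// ltW.
have a0 := normr_ge0 a; have c0 := normr_ge0 c.
apply: (le_trans (powR_sub_le q1 (normr_ge0 _) (normr_ge0 _))).
have nac := ler_normD a c.
have dac : `| `|a + c| - `|a| | <= `|c|.
  by rewrite (le_trans (ler_dist_dist _ _))// addrAC subrr add0r.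
apply: (@le_trans _ _ (q * (`|c| * (`|a| + `|c|) `^ (q - 1)))).
  rewrite -mulrA ler_pM2l// mulrC ler_pM ?powR_ge0 ?normr_ge0//.
  apply: powR_mono; [lra|by rewrite le_max normr_ge0|].
  by rewrite ge_max nac lerDl c0.
have s0 : 0 <= `|a| + `|c| by lra.
apply: (le_trans (ler_wpM2l (ltW qp) (mul_powR_split q1 e0 c0 s0))).
have := powR_sum_le (ltW qp) a0 c0 => /(ler_wpM2l (ltW e0)) H.
rewrite mulrDr.
have E : q * (e * (2 `^ q * (`|a| `^ q + `|c| `^ q))) = d * (`|a| `^ q + `|c| `^ q).
  by rewrite /e; field; rewrite ?gt_eqF ?qp ?q10 ?p2 //; lra.
have := ler_wpM2l (ltW qp) H; rewrite E => H2.
by rewrite (mulrDl d) mulrA; lra.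
Qed.

Lemma ge1_powR_le r x : 1 <= r -> 0 <= x <= 1 -> x `^ r <= x.
Proof.
move=> r1 /andP[x0 x1]; have [->|xn] := eqVneq x 0.
  by rewrite powR0//; lra.
by apply: ge1r_powR => //; rewrite lt0r xn x0.
Qed.

Lemma le1_powR_ge r x : r <= 1 -> 0 <= x <= 1 -> x <= x `^ r.
Proof.
move=> r1 /andP[x0 x1]; have [->|xn] := eqVneq x 0.
  exact: powR_ge0.
by apply: ger1_powR => //; rewrite lt0r xn x0.
Qed.

(* concavity of powers below one: y^t dominates a harmonic interpolation *)
Lemma powR_ge_harmonic t y : 0 < t < 1 -> 0 < y ->
  y / (y + t * (1 - y)) <= y `^ t.
Proof.
move=> /andP[t0 t1] y0.
have t10 : 1 < t^-1 by rewrite invf_gt1.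
have D0 : 0 < y + t * (1 - y) by nra.
have z0 : 0 <= y^-1 `^ t by exact: powR_ge0.
have := powR_tangent t10 z0 ler01.
rewrite powR1 -powRrM mulfV ?gt_eqF// powRr1 ?invr_ge0 ?(ltW y0)//.
have -> : y^-1 `^ t = (y `^ t)^-1.
  by rewrite -(powR_inv1 (ltW y0)) -powRrM mulN1r powRN.
rewrite mulr1 => H.
have p0 : 0 < y `^ t by apply: powR_gt0.
rewrite ler_pdivrMr//.
have H2 : t * y^-1 >= t + (y `^ t)^-1 - 1.
  have : t * (1 + t^-1 * ((y `^ t)^-1 - 1)) <= t * y^-1 by rewrite ler_pM2l.
  by rewrite mulrDr mulr1 mulrA mulfV ?gt_eqF// mul1r; lra.
have : (t + (y `^ t)^-1 - 1) * (y * y `^ t) <= t * y^-1 * (y * y `^ t).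
  by rewrite ler_pM2r// mulr_gt0.
have -> : t / y * (y * y `^ t) = t * y `^ t by field; lra.
have -> : (t + (y `^ t)^-1 - 1) * (y * y `^ t) = t * y * y `^ t + y - y * y `^ t.
  by field; lra.
by lra.
Qed.

End powers.

Lemma measurable_mulr_set d (T : measurableType d) (R : realType) (f g : T -> R) :
  measurable_fun setT f -> measurable_fun setT g ->
  measurable_fun setT (fun x => f x * g x).
Proof. by move=> mf mg; exact: measurable_funM. Qed.

Lemma measurable_powR_fun d (T : measurableType d) (R : realType) (f : T -> R) q :
  measurable_fun setT f -> measurable_fun setT (fun x => f x `^ q).
Proof. move=> mf; exact: (measurableT_comp (@measurable_powR R q) mf). Qed.

Lemma measurable_norm_fun d (T : measurableType d) (R : realType) (f : T -> R) :
  measurable_fun setT f -> measurable_fun setT (fun x => `|f x|).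
Proof. move=> mf; exact: (measurableT_comp (@normr_measurable R setT) mf). Qed.

Lemma measurable_sgr (R : realType) : measurable_fun [set: R] (fun x : R => Num.sg x).
Proof.
rewrite (_ : (fun x => _) = (fun x : R =>
  \1_([set y | 0 < y] : set R) x - \1_([set y | y < 0] : set R) x)).
  apply: measurable_funB; apply: measurable_indic.
  - by rewrite (_ : [set y | 0 < y] = `]0, +oo[%classic)//; apply/seteqP;
      split=> x /=; rewrite in_itv/= andbT.
  - by rewrite (_ : [set y | y < 0] = `]-oo, 0[%classic)//; apply/seteqP;
      split=> x /=; rewrite in_itv/=.
apply/funext => x; rewrite !indicE.
have [x0|x0|->] := ltgtP x 0.
- rewrite ltr0_sg// memNset ?mem_set//= ?sub0r//.
  by apply/negP; rewrite -leNgt ltW.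
- rewrite gtr0_sg// mem_set//= memNset/= ?subr0//.
  by apply/negP; rewrite -leNgt ltW.
- by rewrite sgr0 !memNset/= ?subr0// ltxx.
Qed.

Lemma measurable_invr_fun d (T : measurableType d) (R : realType) (f : T -> R) :
  measurable_fun setT f -> measurable_fun setT (fun x => (f x)^-1).
Proof.
move=> mf; have m1 := measurableT_comp (@measurable_sgr R) mf.
have m2 := measurable_powR_fun (- 1) (measurable_norm_fun mf).
rewrite (_ : (fun x => _) = (fun x => Num.sg (f x) * `|f x| `^ (-1))).
  exact: measurable_mulr_set m1 m2.
apply/funext => y; rewrite powR_inv1 ?normr_ge0//.
have [->|x0] := eqVneq (f y) 0; first by rewrite sgr0 mul0r invr0.
have n0 : `|f y| != 0 by rewrite normr_eq0.
apply: (mulfI x0); rewrite mulfV// mulrA {1}(numEsg (f y)).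
rewrite -[_ * _ * Num.sg (f y)]mulrAC -expr2 sqr_sg x0 mul1r.
by rewrite mulfV.
Qed.

(* discharges measurability of real functions built from measurable pieces *)
Ltac mfun := repeat match goal with
  | |- forall _, _ => intro
  | H : measurable_fun _ ?f |- measurable_fun _ ?f => exact H
  | H : forall n, measurable_fun _ (?f n) |- measurable_fun _ (?f _) => exact: H
  | |- measurable_fun _ (fun=> _) => exact: measurable_cst
  | |- measurable_fun _ (fun x => x) => exact: measurable_id
  | |- measurable_fun _ (cst _) => exact: measurable_cst
  | |- measurable_fun _ (fun x => (_)%:E) => apply/measurable_EFinP
  | |- measurable_fun _ (EFin \o _) => apply/measurable_EFinP
  | |- measurable_fun _ (fun x => _ + _) => apply: measurable_funD
  | |- measurable_fun _ (fun x => - _) => apply: measurable_funN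
  | |- measurable_fun _ (fun x => _ ^+ _) => apply: measurable_funX
  | |- measurable_fun _ (fun x => _ `^ _) => apply: measurable_powR_fun
  | |- measurable_fun _ (fun x => `| _ |) => apply: measurable_norm_fun
  | |- measurable_fun _ (fun x => (_)^-1) => apply: measurable_invr_fun
  | |- measurable_fun _ (fun x => Num.max _ _) => apply: measurable_maxr
  | |- measurable_fun _ (fun x => Num.min _ _) => apply: measurable_minr
  | |- measurable_fun _ (fun x => \1_ _ x) => apply: measurable_indic
  | |- measurable_fun _ \1_ _ => apply: measurable_indic
  | |- measurable_fun _ (fun x => _ * _) => apply: measurable_mulr_set
  | H : measurable_fun setT ?f |- measurable_fun _ (fun z => ?f z.1) =>
      exact: (measurableT_comp H measurable_fst)
  | H : measurable_fun setT ?f |- measurable_fun _ (fun z => ?f z.2) =>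
      exact: (measurableT_comp H measurable_snd)
  end.

Section indic.
Context (T : Type) (R : realType).

Lemma indic_ge0 (A : set T) x : 0 <= (\1_A x : R).
Proof. by rewrite indicE. Qed.

Lemma indic_le1 (A : set T) x : (\1_A x : R) <= 1.
Proof. by rewrite indicE; case: (_ \in _). Qed.

Lemma indic_in (A : set T) x : A x -> (\1_A x : R) = 1.
Proof. by move=> Ax; rewrite indicE mem_set. Qed.

Lemma indic_out (A : set T) x : ~ A x -> (\1_A x : R) = 0.
Proof. by move=> Ax; rewrite indicE memNset. Qed.

Lemma indic_fun_le (A : set T) (f g : T -> R) x :
  (A x -> f x <= g x) -> \1_A x * f x <= \1_A x * g x.
Proof.
have [Ax H|nA _] := pselect (A x).
  by rewrite ler_wpM2l ?indic_ge0//; apply: H.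
by rewrite indic_out// !mul0r.
Qed.

End indic.

(* discharges nonnegativity of expressions built from nonnegative pieces *)
Ltac nn := repeat match goal with
  | |- forall _, _ => intro
  | |- is_true (0 <= _ + _) => apply: addr_ge0
  | |- is_true (0 <= _ ^+ 2) => apply: sqr_ge0
  | |- is_true (0 <= _ * _) => apply: mulr_ge0
  | |- is_true (0 <= _ `^ _) => apply: powR_ge0
  | |- is_true (0 <= `|_|) => apply: normr_ge0
  | |- is_true (0 <= \1_ _ _) => apply: indic_ge0
  | |- is_true (0 <= _^-1) => rewrite invr_ge0
  | |- is_true (0 <= _ ^+ _) => apply: exprn_ge0
  | |- is_true (0 <= _) => first [done | exact: ltW]
  end.

Ltac side := first [solve [mfun; done] | solve [nn]].

Section lint.
Context d (T : measurableType d) (R : realType) (mu : {measure set T -> \bar R}).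
Implicit Types (f g h : T -> R).

Definition lint f : \bar R := (\int[mu]_x (f x)%:E)%E.

Lemma lint_ge0 f : (forall x, 0 <= f x) -> (0 <= lint f)%E.
Proof. by move=> f0; apply: integral_ge0 => x _; rewrite lee_fin. Qed.

Lemma lint0 : lint (fun=> 0) = 0%E.
Proof. by rewrite /lint integral0. Qed.

Lemma lint_le f g : measurable_fun setT f -> measurable_fun setT g ->
  (forall x, 0 <= f x) -> (forall x, f x <= g x) -> (lint f <= lint g)%E.
Proof.
move=> mf mg f0 fg; apply: ge0_le_integral => //; [|mfun|mfun|].
- by move=> x _; rewrite lee_fin.
- by move=> x _; rewrite lee_fin.
Qed.

Lemma lint_ae_le f g : measurable_fun setT f -> measurable_fun setT g ->
  (forall x, 0 <= f x) -> (forall x, 0 <= g x) ->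
  {ae mu, forall x, f x <= g x} -> (lint f <= lint g)%E.
Proof.
move=> mf mg f0 g0 fg; apply: ae_ge0_le_integral => //; [|mfun| |mfun|].
- by move=> x _; rewrite lee_fin.
- by move=> x _; rewrite lee_fin.
- by apply: filterS fg => x fgx _; rewrite lee_fin.
Qed.

Lemma lint_ae_eq f g : measurable_fun setT f -> measurable_fun setT g ->
  {ae mu, forall x, f x = g x} -> lint f = lint g.
Proof.
move=> mf mg fg; apply: ae_eq_integral => //; [mfun|mfun|].
by apply: filterS fg => x -> _.
Qed.

Lemma lintD f g : measurable_fun setT f -> measurable_fun setT g ->
  (forall x, 0 <= f x) -> (forall x, 0 <= g x) ->
  lint (fun x => f x + g x) = (lint f + lint g)%E.
Proof.
move=> mf mg f0 g0; rewrite /lint -ge0_integralD//; [|mfun| |mfun].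
- by move=> x _; rewrite lee_fin.
- by move=> x _; rewrite lee_fin.
Qed.

Lemma lintZ k f : measurable_fun setT f -> (forall x, 0 <= f x) -> 0 <= k ->
  lint (fun x => k * f x) = (k%:E * lint f)%E.
Proof.
move=> mf f0 k0; rewrite /lint -ge0_integralZl_EFin//; last mfun.
by move=> x _; rewrite lee_fin.
Qed.

Lemma lint_indic (A : set T) : measurable A -> lint \1_A = mu A.
Proof. by move=> mA; rewrite /lint integral_indic// setIT. Qed.

Lemma lint_mkcond (A : set T) f :
  (\int[mu]_(x in A) (f x)%:E)%E = lint (fun x => \1_A x * f x).
Proof.
rewrite integral_mkcond; apply: eq_integral => x _.
by rewrite patchE indicE; case: ifP => _; rewrite ?mul1r ?mul0r.
Qed.

Lemma lint_eq0 f : measurable_fun setT f -> (forall x, 0 <= f x) ->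
  lint f = 0%E <-> {ae mu, forall x, f x = 0}.
Proof.
move=> mf f0; have := @ae_eq_integral_abs _ _ _ mu _ measurableT (EFin \o f).
have -> : (\int[mu]_x `|(EFin \o f) x|)%E = lint f.
  by apply: eq_integral => x _ /=; rewrite ger0_norm.
move=> H; split => [/H|fae].
  move=> H1; have /H1 : measurable_fun setT (EFin \o f) by mfun.
  by apply: filterS => x /(_ I)/= [].
apply/H; first by mfun.
by apply: filterS fae => x + _ /=; move=> ->.
Qed.

Lemma lint_fatou_cst (f_ : nat -> T -> R) f c :
  (forall n, measurable_fun setT (f_ n)) -> measurable_fun setT f ->
  (forall n x, 0 <= f_ n x) ->
  {ae mu, forall x, f_ n x @[n --> \oo] --> f x} ->
  (forall n, (lint (f_ n) <= c%:E)%E) -> (lint f <= c%:E)%E.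
Proof.
move=> mf_ mf f_0 f_f fc.
have H := @fatou _ _ _ mu setT measurableT (fun n => EFin \o f_ n).
have -> : lint f = (\int[mu]_x limn_einf (fun n => (f_ n x)%:E))%E.
  apply: ae_eq_integral => //; first by mfun.
    rewrite (_ : (fun x => _) =
      (fun x => - limn_esup (fun n => - (f_ n x)%:E))%E); last first.
      apply/funext => x; rewrite -limn_einfN; congr limn_einf.
      by apply/funext => n /=; rewrite opprK.
    apply: measurableT_comp => //; apply: measurable_fun_limn_esup => n.
    by apply: measurableT_comp => //; mfun.
  apply: filterS f_f => x fx _.
  have : (f_ n x)%:E @[n --> \oo] --> (f x)%:E by apply: cvg_EFin => //; near=> n.
  by move=> /cvg_limn_einf_sup[->].
apply: le_trans (H _ _) _; [by move=> n; mfun| by move=> n x _; rewrite lee_fin|].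
rewrite limn_einf_lim; apply: lime_le; first exact: is_cvg_einfs.
apply: nearW => n; apply: le_trans (fc n).
by apply: ereal_inf_lbound; exists n => /=.
Unshelve. all: by end_near. Qed.

Lemma lint_fatou (f_ : nat -> T -> R) f (c_ : nat -> R) c :
  (forall n, measurable_fun setT (f_ n)) -> measurable_fun setT f ->
  (forall n x, 0 <= f_ n x) ->
  {ae mu, forall x, f_ n x @[n --> \oo] --> f x} ->
  (forall n, (lint (f_ n) <= (c_ n)%:E)%E) -> c_ n @[n --> \oo] --> c ->
  (lint f <= c%:E)%E.
Proof.
move=> mf_ mf f_0 f_f fc cc; apply/lee_addgt0Pr => e e0.
have [N _ HN] : \forall n \near \oo, c_ n <= c + e.
  by apply: (cvgr_le c cc); lra.
rewrite -EFinD; apply: (@lint_fatou_cst (fun n => f_ (n + N)%N)) => //.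
- by apply: filterS f_f => x; move=> fx; rewrite (cvg_shiftn N (fun n => f_ n x) _).
- by move=> n; apply: le_trans (fc _) _; rewrite lee_fin HN//= leq_addl.
Qed.

Lemma lint_dct0 (f_ : nat -> T -> R) g :
  (forall n, measurable_fun setT (f_ n)) -> measurable_fun setT g ->
  (forall n x, 0 <= f_ n x) -> (forall n x, f_ n x <= g x) ->
  (lint g < +oo)%E ->
  {ae mu, forall x, f_ n x @[n --> \oo] --> 0} ->
  forall e, 0 < e -> \forall n \near \oo, (lint (f_ n) <= e%:E)%E.
Proof.
move=> mf mg f0 fg gi f_0 e e0.
have [|||||] := @dominated_convergence _ _ _ mu setT measurableT
  (fun n => EFin \o f_ n) (cst 0%E) (EFin \o g).
- by move=> n; mfun.
- exact: measurable_cst.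
- by apply: filterS f_0 => x fx _ /=; apply: cvg_EFin => //; near=> n.
- apply/integrableP; split; first by mfun.
  rewrite (_ : (fun x => _) = (fun x => (g x)%:E))//.
  by apply/funext => x /=; rewrite ger0_norm// (le_trans (f0 0%N x)).
- by apply: aeW => /= x n _; rewrite ger0_norm// lee_fin.
rewrite /= integral0 => _ _ C.
have /fine_cvgP[F C2] : (fun n => lint (f_ n)) n @[n --> \oo] --> 0%:E by exact: C.
have C3 : \forall n \near \oo, fine (lint (f_ n)) <= e by apply: (cvgr_le _ C2).
near=> n.
rewrite -[lint _]fineK; last by near: n.
by rewrite lee_fin; near: n.
Unshelve. all: by end_near. Qed.

End lint.

Lemma cvg_powR_norm (R : realType) q (u : nat -> R) (l : R) : 1 < q ->
  u n @[n --> \oo] --> l -> `|u n| `^ q @[n --> \oo] --> `|l| `^ q.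
Proof.
move=> q1 ul; have ul2 := ul.
set K := q * (`|l| + 1) `^ (q - 1).
have K0 : 0 <= K by rewrite mulr_ge0 ?powR_ge0//; lra.
apply/cvgrPdist_le => e e0.
have d0 : 0 < Num.min 1 (e / (K + 1)).
  by rewrite lt_min ltr01 divr_gt0//; lra.
move/cvgrPdist_le : ul => /(_ _ d0); apply: filterS => n.
rewrite le_min => /andP[u1 ue].
apply: (le_trans (powR_sub_le q1 (normr_ge0 _) (normr_ge0 _))).
have D : `| `|l| - `|u n| | <= `|l - u n| by exact: ler_dist_dist.
have Mx : Num.max `|l| `|u n| <= `|l| + 1.
  rewrite ge_max lerDl ler01/=.
  by have := ler_normD l (u n - l); rewrite addrC subrK (distrC (u n)); lra.
have : Num.max `|l| `|u n| `^ (q - 1) <= (`|l| + 1) `^ (q - 1).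
  by apply: powR_mono => //; rewrite ?le_max ?normr_ge0 ?subr_ge0// ltW.
have q0 : 0 <= q by lra.
move=> /(ler_wpM2l q0) H.
apply: (@le_trans _ _ (K * (e / (K + 1)))).
  by apply: ler_pM => //; [rewrite mulr_ge0 ?powR_ge0|exact: le_trans ue].
rewrite mulrA ler_pdivrMr; last lra.
by nra.
Qed.

Section limits.
Context d (T : measurableType d) (R : realType) (mu : {measure set T -> \bar R}).
Implicit Types (f g h : T -> R).

Let L := lint mu.

Lemma brezis_lieb (q M c : R) (rho_ f_ : nat -> T -> R) (rho f : T -> R) :
  1 < q -> 0 <= M ->
  (forall n, measurable_fun setT (rho_ n)) -> measurable_fun setT rho ->
  (forall n, measurable_fun setT (f_ n)) -> measurable_fun setT f ->
  (forall n x, 0 <= rho_ n x) -> (forall x, 0 <= rho x) ->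
  (forall n x, rho_ n x <= M * rho x) ->
  {ae mu, forall x, rho_ n x @[n --> \oo] --> rho x} ->
  {ae mu, forall x, rho x = 0 \/ f_ n x @[n --> \oo] --> f x} ->
  (forall n, (L (fun x => rho_ n x * `|f_ n x| `^ q)%R <= c%:E)%E) ->
  (L (fun x => rho x * `|f x| `^ q)%R <= c%:E)%E /\
  forall e, 0 < e -> \forall n \near \oo,
   (L (fun x => rho x * `|f x| `^ q)%R + L (fun x => rho_ n x * `|f_ n x - f x| `^ q)%R
     <= L (fun x => rho_ n x * `|f_ n x| `^ q)%R + e%:E)%E /\
   (L (fun x => rho_ n x * `|f_ n x| `^ q)%R <=
     L (fun x => rho x * `|f x| `^ q)%R +
     L (fun x => (rho_ n x * `|f_ n x - f x| `^ q)%R)%R + e%:E)%E.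
Proof.
move=> q1 M0 mr_ mr mf_ mf r_0 r0 rM rr ff fc.
have q0 : 0 <= q by lra.
have Fc : (L (fun x => rho x * `|f x| `^ q)%R <= c%:E)%E.
  apply: (@lint_fatou_cst _ _ _ _ (fun n x => rho_ n x * `|f_ n x| `^ q)) => //.
  - by mfun.
  - by mfun.
  - by move=> n x; rewrite mulr_ge0// powR_ge0.
  - apply: filterS2 rr ff => x rx [rx0|fx].
      rewrite rx0 mul0r (_ : (fun n => _) = fun=> 0); first exact: cvg_cst.
      apply/funext => n; suff -> : rho_ n x = 0 by rewrite mul0r.
      by apply/eqP; rewrite eq_le r_0 andbT (le_trans (rM n x))// rx0 mulr0.
    by apply: cvgM => //; exact: cvg_powR_norm.
split=> // e e0.
have c0 : 0 <= c.
  rewrite -lee_fin; apply: le_trans Fc; apply: lint_ge0 => x.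
  by rewrite mulr_ge0// powR_ge0.
set K := 2 `^ q * (c + M * c).
have K0 : 0 <= K by rewrite mulr_ge0 ?powR_ge0// addr_ge0// mulr_ge0.
pose dl := e / 3 / (K + 1).
have dl0 : 0 < dl by rewrite !divr_gt0//; lra.
have [C C0 HC] := brezis_lieb_pointwise q1 dl0.
pose V n x := `| `|f_ n x| `^ q - `|f_ n x - f x| `^ q - `|f x| `^ q |.
pose W n x := rho_ n x * Num.max 0 (V n x - dl * `|f_ n x - f x| `^ q).
pose E n x := `|rho_ n x - rho x| * `|f x| `^ q.
have HV n x : V n x <= dl * `|f_ n x - f x| `^ q + (C + 1) * `|f x| `^ q.
  have := HC (f_ n x - f x) (f x); rewrite subrK => H.
  apply: (le_trans (ler_normB _ _)).
  rewrite [X in _ + X <= _]ger0_norm ?powR_ge0//.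
  by rewrite mulrDl mul1r addrA lerD2r.
have Bb n : (L (fun x => rho_ n x * `|f_ n x - f x| `^ q)%R <= K%:E)%E.
  apply: (@le_trans _ _ (L (fun x => 2 `^ q * (rho_ n x * `|f_ n x| `^ q +
     M * (rho x * `|f x| `^ q)))%R)).
    apply: lint_le; [by mfun|by mfun| by move=> x; rewrite mulr_ge0// powR_ge0|].
    move=> x; apply: (@le_trans _ _ (rho_ n x * (2 `^ q * (`|f_ n x| `^ q + `|f x| `^ q)))).
      apply: ler_wpM2l => //; apply: le_trans (powR_sum_le q0 (normr_ge0 _) (normr_ge0 _)).
      by apply: powR_mono => //; exact: ler_normB.
    rewrite mulrCA ler_wpM2l ?powR_ge0// mulrDr lerD2l mulrA ler_wpM2r ?powR_ge0//.
  have p0 n' x : 0 <= rho_ n' x * `|f_ n' x| `^ q by rewrite mulr_ge0// powR_ge0.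
  have p1 x : 0 <= rho x * `|f x| `^ q by rewrite mulr_ge0// powR_ge0.
  rewrite /L lintZ ?powR_ge0//; [|by mfun|by move=> x; rewrite addr_ge0 ?mulr_ge0].
  rewrite EFinM lee_wpmul2l ?lee_fin ?powR_ge0//.
  rewrite lintD//; [|by mfun|by mfun|by move=> x; rewrite mulr_ge0].
  rewrite EFinD leeD// lintZ//; last by mfun.
  by rewrite EFinM lee_wpmul2l// lee_fin.
have Fi k : 0 <= k -> (L (fun x => (k * (rho x * `|f x| `^ q))%R)%R < +oo)%E.
  move=> k0; rewrite /L lintZ//; [|by mfun|by move=> x; rewrite mulr_ge0// powR_ge0].
  apply: (@le_lt_trans _ _ (k%:E * c%:E)%E); last by rewrite -EFinM ltry.
  by rewrite lee_wpmul2l// lee_fin.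
have e30 : 0 < e / 3 by lra.
have EW : \forall n \near \oo, (L (W n) <= (e / 3)%:E)%E.
  apply: (@lint_dct0 _ _ _ _ W (fun x => (M * (C + 1)) * (rho x * `|f x| `^ q))) => //.
  - by rewrite /W /V; mfun.
  - by mfun.
  - by move=> n x; rewrite mulr_ge0// le_max lexx.
  - move=> n x; rewrite /W; apply: (@le_trans _ _ (rho_ n x * ((C + 1) * `|f x| `^ q))).
      rewrite ler_wpM2l// ge_max mulr_ge0 ?powR_ge0//=; last by lra.
      by rewrite lerBlDl.
    have -> : M * (C + 1) * (rho x * `|f x| `^ q) =
        M * rho x * ((C + 1) * `|f x| `^ q) by ring.
    by rewrite ler_wpM2r// mulr_ge0 ?powR_ge0//; lra.
  - by apply: Fi; rewrite mulr_ge0//; lra.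
  apply: filterS2 rr ff => x rx [rx0|fx].
    rewrite (_ : (fun n => _) = fun=> 0); first exact: cvg_cst.
    apply/funext => n; suff -> : W n x = 0 by [].
    rewrite /W; suff -> : rho_ n x = 0 by rewrite mul0r.
    by apply/eqP; rewrite eq_le r_0 andbT (le_trans (rM n x))// rx0 mulr0.
  rewrite -(mulr0 (rho x)); apply: cvgM => //.
  have c1 : `|f_ n x - f x| `^ q @[n --> \oo] --> (0 : R).
    have : f_ n x - f x @[n --> \oo] --> f x - f x by apply: cvgB => //; exact: cvg_cst.
    rewrite subrr => /(cvg_powR_norm q1).
    by rewrite normr0 powR0//; lra.
  have c2 : V n x @[n --> \oo] --> (0 : R).
    have : `|f_ n x| `^ q - `|f_ n x - f x| `^ q - `|f x| `^ q @[n --> \oo]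
        --> `|f x| `^ q - 0 - `|f x| `^ q.
      by apply: cvgB; [apply: cvgB => //; exact: cvg_powR_norm|exact: cvg_cst].
    by rewrite subr0 subrr => /cvg_norm; rewrite normr0.
  apply: (@squeeze_cvgr _ _ _ _ (fun=> 0) (fun n => V n x)) => //; last exact: cvg_cst.
  near=> n; rewrite le_max lexx/= ge_max normr_ge0/= gerBl.
  by rewrite mulr_ge0 ?powR_ge0// ltW.
have EE : \forall n \near \oo, (L (E n) <= (e / 3)%:E)%E.
  apply: (@lint_dct0 _ _ _ _ E (fun x => (M + 1) * (rho x * `|f x| `^ q))) => //.
  - by rewrite /E; mfun.
  - by mfun.
  - by move=> n x; rewrite mulr_ge0// powR_ge0.
  - move=> n x; rewrite mulrA ler_wpM2r ?powR_ge0//.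
    by rewrite (le_trans (ler_normB _ _))// !ger0_norm// mulrDl mul1r lerD2r.
  - by apply: Fi; lra.
  apply: filterS rr => x rx.
  rewrite -(mul0r (`|f x| `^ q)); apply: cvgM; last exact: cvg_cst.
  have : rho_ n x - rho x @[n --> \oo] --> rho x - rho x.
    by apply: cvgB => //; exact: cvg_cst.
  by rewrite subrr => /cvg_norm; rewrite normr0.
near=> n.
have HW : (L (W n) <= (e / 3)%:E)%E by near: n.
have HE : (L (E n) <= (e / 3)%:E)%E by near: n.
have W0 x : 0 <= W n x by rewrite mulr_ge0// le_max lexx.
have E0 x : 0 <= E n x by rewrite mulr_ge0// powR_ge0.
have mW : measurable_fun setT (W n) by rewrite /W /V; mfun.
have mE : measurable_fun setT (E n) by rewrite /E; mfun.
pose Bn x := rho_ n x * `|f_ n x - f x| `^ q.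
pose An x := rho_ n x * `|f_ n x| `^ q.
pose F x := rho x * `|f x| `^ q.
have A0 x : 0 <= An x by rewrite mulr_ge0// powR_ge0.
have B0 x : 0 <= Bn x by rewrite mulr_ge0// powR_ge0.
have F0 x : 0 <= F x by rewrite mulr_ge0// powR_ge0.
have mA : measurable_fun setT An by rewrite /An; mfun.
have mB : measurable_fun setT Bn by rewrite /Bn; mfun.
have mF : measurable_fun setT F by rewrite /F; mfun.
have key x : `|An x - Bn x - F x| <= W n x + dl * Bn x + E n x.
  have -> : An x - Bn x - F x = rho_ n x * (`|f_ n x| `^ q - `|f_ n x - f x| `^ q
    - `|f x| `^ q) + (rho_ n x - rho x) * `|f x| `^ q by rewrite /An /Bn /F; ring.
  apply: le_trans (ler_normD _ _) _; rewrite !normrM (ger0_norm (powR_ge0 _ _)).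
  rewrite lerD2r (ger0_norm (r_0 n x)) -/(V n x) /W /Bn mulrCA -mulrDr ler_wpM2l//.
  by rewrite -lerBlDr le_max lexx orbT.
have rest : (L (fun x => W n x + dl * Bn x + E n x)%R <= e%:E)%E.
  rewrite /L !lintD//; [|by mfun|by move=> x; rewrite mulr_ge0// ltW|by mfun|
    by move=> x; rewrite addr_ge0// mulr_ge0// ltW].
  rewrite lintZ//; last exact: ltW.
  apply: (@le_trans _ _ ((e / 3)%:E + dl%:E * K%:E + (e / 3)%:E)%E).
    by apply: leeD => //; apply: leeD => //; apply: lee_wpmul2l; [rewrite lee_fin ltW|exact: Bb].
  rewrite -EFinM -!EFinD lee_fin.
  have : dl * K <= e / 3.
    by rewrite /dl mulrAC ler_pdivrMr; [nra|lra].
  by lra.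
have s0 x : 0 <= W n x + dl * Bn x + E n x.
  by rewrite !addr_ge0// mulr_ge0// ltW.
have ms : measurable_fun setT (fun x => W n x + dl * Bn x + E n x) by mfun.
split.
  rewrite -/An -/Bn -/F; apply: (@le_trans _ _ (L An + L (fun x => W n x + dl * Bn x + E n x)%R)%E).
    rewrite /L -!lintD//; apply: lint_le; [by mfun|by mfun|by move=> x; rewrite addr_ge0|].
    by move=> x; have := key x; rewrite ler_norml => /andP[? ?] /=; lra.
  by rewrite leeD2l.
apply: (@le_trans _ _ (L F + L Bn + L (fun x => W n x + dl * Bn x + E n x)%R)%E).
  rewrite /L -!lintD//; [|by mfun|by move=> x; rewrite addr_ge0].
  apply: lint_le; [by mfun|by mfun|by []|].
  move=> x; have /ler_normlP[h1 h2] := key x; move=> /=. rewrite -/(An x). move: h1 h2; clear; lra.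
by rewrite leeD2l.
Unshelve. all: by end_near. Qed.

End limits.

Section weak_limits.
Context d (T : measurableType d) (R : realType) (mu : {measure set T -> \bar R}).
Implicit Types (f g h : T -> R).

Lemma lint_sqrD_le f g a b : measurable_fun setT f -> measurable_fun setT g ->
  (lint mu (fun x => f x ^+ 2)%R <= a%:E)%E ->
  (lint mu (fun x => g x ^+ 2)%R <= b%:E)%E ->
  (lint mu (fun x => (f x - g x) ^+ 2)%R <= (2 * (a + b))%:E)%E.
Proof.
move=> mf mg fa gb.
apply: (@le_trans _ _ (lint mu (fun x => 2 * (f x ^+ 2 + g x ^+ 2))%R)).
  apply: lint_le; [by mfun|by mfun|by move=> x; exact: sqr_ge0|].
  by move=> x; have := sqr_ge0 (f x + g x); lra.
rewrite lintZ//; [|by mfun|by move=> x; rewrite addr_ge0 ?sqr_ge0].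
rewrite lintD//; [|by mfun|by mfun|by move=> x; rewrite sqr_ge0|by move=> x; rewrite sqr_ge0].
rewrite EFinM (EFinD a b); apply: lee_wpmul2l; first by rewrite lee_fin.
exact: leeD.
Qed.

Lemma ae_cvg_weak (f_ : nat -> T -> R) f h c :
  (forall n, measurable_fun setT (f_ n)) -> measurable_fun setT f ->
  measurable_fun setT h -> (forall x, 0 <= h x) ->
  {ae mu, forall x, f_ n x @[n --> \oo] --> f x} ->
  (forall n, (lint mu (fun x => f_ n x ^+ 2)%R <= c%:E)%E) ->
  (lint mu (fun x => h x ^+ 2)%R < +oo)%E ->
  forall e, 0 < e -> \forall n \near \oo,
    (lint mu (fun x => `|f_ n x - f x| * h x)%R <= e%:E)%E.
Proof.
move=> mf_ mf mh h0 ff fc hi e e0.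
have Fc : (lint mu (fun x => f x ^+ 2)%R <= c%:E)%E.
  apply: (@lint_fatou_cst _ _ _ _ (fun n x => f_ n x ^+ 2)) => //.
  - by mfun.
  - by mfun.
  - by move=> n x; exact: sqr_ge0.
  - by apply: filterS ff => x fx; rewrite expr2; under eq_fun do rewrite expr2; exact: cvgM.
have c0 : 0 <= c.
  rewrite -lee_fin; apply: le_trans Fc; apply: lint_ge0 => x; exact: sqr_ge0.
pose M := (4 * c + 1) * 2 / e.
have M0 : 0 < M by rewrite divr_gt0// mulr_gt0//; lra.
pose W n x := Num.min (`|f_ n x - f x| * h x) (M * h x ^+ 2).
have W0 n x : 0 <= W n x.
  rewrite /W le_min; apply/andP; split; first by rewrite mulr_ge0.
  by apply: mulr_ge0; [exact: ltW|exact: sqr_ge0].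
have EW : \forall n \near \oo, (lint mu (W n) <= (e / 2)%:E)%E.
  apply: (@lint_dct0 _ _ _ _ W (fun x => M * h x ^+ 2)).
  - by rewrite /W; mfun.
  - by mfun.
  - by [].
  - by move=> n x; rewrite /W ge_min lexx orbT.
  - rewrite lintZ//; [|by mfun|by move=> x; rewrite sqr_ge0|exact: ltW].
    move: hi; have := lint_ge0 mu (fun x => sqr_ge0 (h x)).
    by case: (lint _ _) => //= r _ _; rewrite -EFinM ltry.
  - apply: filterS ff => x fx.
    apply: (@squeeze_cvgr _ _ _ _ (fun=> 0) (fun n => `|f_ n x - f x| * h x)).
    + by near=> n; rewrite W0/= /W ge_min lexx.
    + exact: cvg_cst.
    + rewrite -(mul0r (h x)); apply: cvgM; last exact: cvg_cst.
      have : f_ n x - f x @[n --> \oo] --> f x - f x.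
        by apply: cvgB => //; exact: cvg_cst.
      by rewrite subrr => /cvg_norm; rewrite normr0.
  - by lra.
apply: filterS EW => n HW.
apply: (@le_trans _ _ (lint mu (fun x => W n x + M^-1 * (f_ n x - f x) ^+ 2)%R)).
  apply: lint_le; [by mfun|by rewrite /W; mfun|by move=> x; rewrite mulr_ge0|].
  move=> x; rewrite /W; set t := `|_ - _|.
  have -> : (f_ n x - f x) ^+ 2 = t ^+ 2 by rewrite /t -normrX ger0_norm ?sqr_ge0.
  have t0 : 0 <= t by exact: normr_ge0.
  have [tM|Mt] := leP t (M * h x).
    rewrite (min_idPl _) ?lerDl ?mulr_ge0 ?sqr_ge0 ?invr_ge0 ?(ltW M0)//.
    by rewrite expr2 mulrA ler_wpM2r.
  have ht : h x <= M^-1 * t by rewrite mulrC ler_pdivlMr// mulrC ltW.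
  have : t * h x <= M^-1 * t ^+ 2.
    by rewrite expr2 mulrCA; apply: ler_wpM2l.
  have := W0 n x; rewrite /W -/t.
  by lra.
rewrite lintD//; [|by rewrite /W; mfun|by mfun|]; last first.
  by move=> x; rewrite mulr_ge0 ?sqr_ge0 ?invr_ge0 ?(ltW M0).
rewrite lintZ//; [|by mfun|by move=> x; rewrite sqr_ge0|by rewrite invr_ge0 ltW].
apply: (@le_trans _ _ ((e / 2)%:E + (M^-1)%:E * (2 * (c + c))%:E)%E).
  apply: leeD => //; apply: lee_wpmul2l; first by rewrite lee_fin invr_ge0 ltW.
  exact: lint_sqrD_le.
rewrite -EFinM -EFinD lee_fin.
have : M^-1 * (2 * (c + c)) <= e / 2.
  rewrite mulrC ler_pdivrMr// /M.
  have -> : e / 2 * ((4 * c + 1) * 2 / e) = 4 * c + 1.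
    by field; rewrite gt_eqF.
  by lra.
by lra.
Unshelve. all: by end_near. Qed.

End weak_limits.

Section space.
Context {R : realType}.

Lemma coord_le_norm n (x : 'rV[R]_n) i : `|x ord0 i| <= `|x|.
Proof.
rewrite [`|x|]/Num.norm/= mx_normrE.
by apply: (le_bigmax _ (fun ij : 'I_1 * 'I_n => `|x ij.1 ij.2|) (ord0, i)).
Qed.

Lemma rV_norm_le n (x : 'rV[R]_n) r : 0 <= r -> (forall i, `|x ord0 i| <= r) -> `|x| <= r.
Proof.
move=> r0 H; rewrite [`|x|]/Num.norm/= mx_normrE.
by apply: bigmax_le => //= -[i j] _ /=; rewrite ord1.
Qed.

Lemma rV_norm_lt n (x : 'rV[R]_n) r : 0 < r -> (forall i, `|x ord0 i| < r) -> `|x| < r.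
Proof.
move=> r0 H; rewrite [`|x|]/Num.norm/= mx_normrE.
by apply: bigmax_lt => //= -[i j] _ /=; rewrite ord1.
Qed.

Lemma enorm_ge0 n (x : 'rV[R]_n) : 0 <= enorm x.
Proof. exact: sqrtr_ge0. Qed.

Lemma norm_le_enorm n (x : 'rV[R]_n) : `|x| <= enorm x.
Proof.
apply: rV_norm_le => [|i]; first exact: enorm_ge0.
rewrite -sqrtr_sqr /enorm ler_sqrt; last first.
  by apply: sumr_ge0 => j _; exact: sqr_ge0.
by rewrite (bigD1 i)//= lerDl sumr_ge0// => j _; exact: sqr_ge0.
Qed.

Lemma enorm_le n (x : 'rV[R]_n) : enorm x <= n%:R * `|x|.
Proof.
case: n x => [|n] x; first by rewrite /enorm big_ord0 sqrtr0 mul0r.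
rewrite /enorm -[leRHS]ger0_norm; last by rewrite mulr_ge0.
rewrite -sqrtr_sqr ler_sqrt ?sqr_ge0//.
apply: (@le_trans _ _ (\sum_(i < n.+1) `|x| ^+ 2)).
  apply: ler_sum => i _; rewrite -[x _ _ ^+ 2]ger0_norm ?sqr_ge0// normrX.
  by rewrite lerXn2r ?nnegrE// coord_le_norm.
rewrite sumr_const card_ord -[leLHS]mulr_natl exprMn ler_wpM2r ?sqr_ge0//.
by rewrite -natrX ler_nat leq_pmull.
Qed.

Lemma enormN n (x : 'rV[R]_n) : enorm (- x) = enorm x.
Proof. by rewrite /enorm; congr Num.sqrt; apply: eq_bigr => i _; rewrite mxE sqrrN. Qed.

Definition cube n (x : 'rV[R]_n) (r : R) : set 'rV[R]_n :=
  [set y | forall i, `|y ord0 i - x ord0 i| < r].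

Lemma cubeE n (x : 'rV[R]_n) r : 0 < r -> cube x r = [set y | `|y - x| < r].
Proof.
move=> r0; apply/seteqP; split => y /= H.
  by apply: rV_norm_lt => // i; rewrite !mxE; exact: H.
move=> i; apply: le_lt_trans H.
by have := coord_le_norm (y - x) i; rewrite !mxE.
Qed.

Lemma measurable_coordset n (i : 'I_n) (A : set R) : measurable A ->
  measurable [set x : 'rV[R]_n | A (x ord0 i)].
Proof.
move=> mA; rewrite -[X in measurable X]setTI.
exact: (measurable_rV_coord _ _ mA).
Qed.

Lemma measurable_rV_box n (A : 'I_n -> set R) : (forall i, measurable (A i)) ->
  measurable [set x : 'rV[R]_n | forall i, A i (x ord0 i)].
Proof.
move=> mA; rewrite (_ : mkset _ = \bigcap_(i in [set: 'I_n])
      ((fun x : 'rV[R]_n => x ord0 i) @^-1` A i)).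
  by apply: fin_bigcap_measurable => // i _; exact: measurable_coordset.
by apply/seteqP; split=> x Bx i; [move=> _|]; apply: Bx.
Qed.

Lemma measurable_cube n (x : 'rV[R]_n) r : measurable (cube x r).
Proof.
apply: (@measurable_rV_box _ (fun i => [set t : R | `|t - x ord0 i| < r])) => i.
rewrite (_ : mkset _ = `]x ord0 i - r, x ord0 i + r[%classic)//.
by apply/seteqP; split=> t /=; rewrite in_itv/= ltr_distl.
Qed.

Lemma open_cube n (A : set 'rV[R]_n) x : open A -> A x ->
  exists2 r, 0 < r & cube x r `<=` A.
Proof.
rewrite openE => oA /oA /nbhs_ballP[r /= r0 H]; exists r => // y; rewrite cubeE//= => yr.
by apply: H; rewrite mx_norm_ball /ball_ /= distrC.
Qed.

Lemma measurable_open_rV n (A : set 'rV[R]_n) : open A -> measurable A.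
Proof.
move=> oA.
pose F (k : nat) := if unpickle k is Some (c, j) then
  let B := cube (\row_i ratr ((c : 'rV[rat]_n) ord0 i)) (j.+1%:R^-1 : R) in
  if `[< B `<=` A >] then B else set0 else set0.
rewrite (_ : A = \bigcup_k F k).
  apply: bigcupT_measurable => k; rewrite /F; case: unpickle => [[c j]|//].
  by case: ifP => // _; exact: measurable_cube.
apply/seteqP; split => [x Ax|x [k _]]; last first.
  rewrite /F; case: unpickle => [[c j]|//]; case: ifP => // /asboolP H /H //.
have [r r0 rA] := open_cube oA Ax.
have r20 : 0 < r / 2 by rewrite divr_gt0.
have [j] := ltr_add_invr r20; rewrite add0r; set e := (j.+1%:R^-1 : R) => jr.
have /choice[c Hc] (i : 'I_n) : exists q : rat, `|x ord0 i - ratr q| < e.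
  have [|q] := @rat_in_itvoo R (x ord0 i - e) (x ord0 i + e).
    by rewrite ltrBlDr -addrA ltrDl addr_gt0// invr_gt0.
  by rewrite in_itv/= -ltr_distl distrC => ?; exists q.
exists (pickle ((\row_i c i : 'rV[rat]_n), j)) => //.
rewrite /F pickleK /=; set B := cube _ _.
have BA : B `<=` A.
  move=> y yB; apply: rA => i; have := yB i; have := Hc i; rewrite !mxE -/e => H1 H2.
  have := ler_distD (ratr (c i)) (y ord0 i) (x ord0 i).
  by move: H1; rewrite (distrC (x ord0 i) (ratr _)) => h1 h2; lra.
by rewrite asboolT// => i; rewrite !mxE; exact: Hc.
Qed.

(* translations *)

Lemma lebesgue_measure_translate (a : R) (A : set R) : measurable A ->
  lebesgue_measure [set x | A (x + a)] = lebesgue_measure A.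
Proof.
move=> mA; pose f := (fun x => x + a : measurableTypeR R) : R -> measurableTypeR R.
have mf : measurable_fun setT f by apply: measurable_funD => //; exact: measurable_cst.
apply/esym; apply: (@lebesgue_measure_unique R (pushforward lebesgue_measure f)) => //.
move=> _ [[u v]] _ <-; rewrite /pushforward.
rewrite [X in _ = lebesgue_measure X](_ : _ = `]u - a, v - a]%classic); last first.
  by apply/seteqP; split=> x /=; rewrite /f !in_itv/= ltrBlDr lerBrDr.
rewrite !lebesgue_measure_itv/= !lte_fin ltrD2r; case: ifP => // _.
by rewrite -!EFinB; congr EFin; ring.
Qed.
End space.

Section space.
Context {R : realType}.

Lemma integral_lebesgue_translate (a : R) (f : R -> \bar R) :
  measurable_fun setT f -> (forall x, 0 <= f x)%E ->
  (\int[@lebesgue_measure R]_x f (x + a)%R = \int[@lebesgue_measure R]_x f x)%E.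
Proof.
move=> mf f0; pose t := (fun x => x + a : measurableTypeR R) : measurableTypeR R -> measurableTypeR R.
have mt : measurable_fun setT t by apply: measurable_funD => //; exact: measurable_cst.
have := @ge0_integral_pushforward _ _ _ _ R t mt lebesgue_measure setT f measurableT mf.
rewrite preimage_setT => <- //.
by apply: eq_measure_integral => A mA _; exact: lebesgue_measure_translate.
Qed.

Lemma rV_consD n (a : 'rV[R]_n.+1) (x : R) (z : 'rV[R]_n) :
  rV_cons (x, z) + a = rV_cons (x + a ord0 ord0, z + @rsubmx _ 1 1 n a).
Proof.
apply/rowP => i; rewrite /rV_cons !mxE; case: splitP => j ij; rewrite !mxE/=.
  by congr (_ + a _ _); apply/val_inj; rewrite /= ij ord1.
by congr (_ + a _ _); apply/val_inj; rewrite /= ij.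
Qed.

Lemma lebesgue_rV_translate n (a : 'rV[R]_n) (A : set 'rV[R]_n) : measurable A ->
  lebesgue_rV n [set x | A (x + a)] = lebesgue_rV n A.
Proof.
elim: n a A => [|n IH] a A mA.
  by congr (lebesgue_rV 0 _); apply/seteqP; split=> x /=; rewrite (thinmx0 (x + a)) (thinmx0 x).
pose B := @rV_cons R n @^-1` A.
have mB : measurable B.
  by rewrite -[B]setTI; exact: measurable_rV_cons.
rewrite /= /lebesgue_rV_step /pushforward /product_measure1.
pose g (x : measurableTypeR R) := lebesgue_rV n (xsection B x).
transitivity (\int[@lebesgue_measure R]_x g (x + a ord0 ord0)%R)%E.
  apply: eq_integral => x _; rewrite /g/=.
  rewrite -(IH (@rsubmx _ 1 1 n a) (xsection B (x + a ord0 ord0 : R))); last first.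
    exact: measurable_xsection.
  congr (lebesgue_rV n _); apply/seteqP; split=> z /=;
    by rewrite /xsection/= !inE /B/= -rV_consD.
rewrite (@integral_lebesgue_translate _ g)//.
exact: measurable_fun_xsection.
Qed.

Lemma measurable_rV_translate n (a : 'rV[R]_n) :
  measurable_fun setT (fun x : 'rV[R]_n => x + a).
Proof.
apply: measurable_fun_rV => i; under eq_fun do rewrite mxE.
apply: measurable_funD; last exact: measurable_cst.
exact: measurable_rV_coord.
Qed.

Lemma integral_rV_translate n (a : 'rV[R]_n) (f : 'rV[R]_n -> \bar R) :
  measurable_fun setT f -> (forall x, 0 <= f x)%E ->
  (\int[lebesgue_rV n]_x f (x + a)%R = \int[lebesgue_rV n]_x f x)%E.
Proof.
move=> mf f0.
have := @ge0_integral_pushforward _ _ _ _ R _ (@measurable_rV_translate n a)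
  (lebesgue_rV n) setT f measurableT mf.
rewrite preimage_setT => <- //.
by apply: eq_measure_integral => [|? A mA _]; [exact: measurable_rV_translate|exact: lebesgue_rV_translate].
Qed.

Lemma measurable_enorm n : measurable_fun setT (@enorm R n).
Proof.
rewrite /enorm; apply: (@measurableT_comp _ _ _ _ _ _ (@Num.sqrt R)) => //.
  rewrite (_ : Num.sqrt = (fun x : R => Num.max x 0 `^ 2^-1)).
    by mfun; exact: measurable_id.
  apply/funext => x; have [x0|x0] := leP 0 x; first by rewrite powR12_sqrt.
  by rewrite powR0 ?invr_neq0// ler0_sqrtr// ltW.
apply: measurable_sum => i; apply: measurable_funX; exact: measurable_rV_coord.
Qed.

Lemma measurable_rV_sub n :
  measurable_fun setT (fun z : 'rV[R]_n * 'rV[R]_n => z.1 - z.2).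
Proof.
apply: measurable_fun_rV => i; under eq_fun do rewrite !mxE.
have := @measurable_rV_coord _ (measurableTypeR R) n i => mi.
apply: measurable_funB.
  exact: (measurableT_comp mi measurable_fst).
exact: (measurableT_comp mi measurable_snd).
Qed.

End space.

Section kernel.
Context {R : realType} (N : nat) (s : R).
Local Notation X := 'rV[R]_N.
Local Notation K := (Defs.kernel s).

Lemma measurable_kernel : measurable_fun [set: X * X] K.
Proof.
rewrite /Defs.kernel; apply: measurable_invr_fun; apply: measurable_powR_fun.
exact: (measurableT_comp (@measurable_enorm R N) (@measurable_rV_sub R N)).
Qed.

Lemma kernel_ge0 (z : X * X) : 0 <= K z.
Proof. by rewrite invr_ge0 powR_ge0. Qed.

Lemma kernelC (x y : X) : K (x, y) = K (y, x).
Proof. by rewrite /Defs.kernel/= -enormN opprB. Qed.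

Lemma kernelD (x y a : X) : K (x + a, y + a) = K (x, y).
Proof. by rewrite /Defs.kernel/= opprD addrACA subrr addr0. Qed.

Lemma enorm_eq0 n (x : 'rV[R]_n) : enorm x = 0 -> x = 0.
Proof.
move=> x0; apply/eqP; rewrite -normr_eq0 eq_le normr_ge0 andbT -x0.
exact: norm_le_enorm.
Qed.

Lemma kernel_gt0 (x y : X) : x != y -> 0 < K (x, y).
Proof.
move=> xy; rewrite invr_gt0 powR_gt0// lt_neqAle enorm_ge0 andbT eq_sym.
by apply: contra xy => /eqP/enorm_eq0/eqP; rewrite subr_eq0.
Qed.

Hypothesis s0 : 0 < s.
Let D := N%:R + 2 * s.
Let D0 : 0 < D. Proof. by rewrite ltr_wpDl ?ler0n ?mulr_gt0. Qed.

Lemma kernel_le (x y : X) r : 0 < r -> r <= `|x - y| -> K (x, y) <= (r `^ D)^-1.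
Proof.
move=> r0 rxy; rewrite /Defs.kernel/= lef_pV2 ?posrE ?powR_gt0//.
  apply: powR_mono; [exact: ltW|exact: ltW|].
  exact: le_trans (norm_le_enorm _).
by apply: lt_le_trans (norm_le_enorm _); exact: lt_le_trans rxy.
Qed.

Lemma kernel_ge (x y : X) r : x != y -> `|x - y| <= r ->
  ((N%:R * r) `^ D)^-1 <= K (x, y).
Proof.
move=> xy rxy; have e0 : 0 < enorm (x - y).
  rewrite lt_neqAle enorm_ge0 andbT eq_sym.
  by apply: contra xy => /eqP/enorm_eq0/eqP; rewrite subr_eq0.
have le : enorm (x - y) <= N%:R * r.
  by apply: le_trans (enorm_le _) _; rewrite ler_wpM2l.
rewrite /Defs.kernel/= lef_pV2 ?posrE ?powR_gt0//; last exact: lt_le_trans le.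
by apply: powR_mono => //; exact: ltW.
Qed.

End kernel.

Section indic.
Context d (T : measurableType d) (R : realType).

Variable mu : {measure set T -> \bar R}.
Implicit Types (f : T -> R) (P : set T).

Lemma lint_sum (I : Type) (r : seq I) (F : I -> T -> R) :
  (forall i, measurable_fun setT (F i)) -> (forall i x, 0 <= F i x) ->
  lint mu (fun x => \sum_(i <- r) F i x)%R = (\sum_(i <- r) lint mu (F i))%E.
Proof.
move=> mF F0; elim: r => [|i r IH].
  by rewrite big_nil; under [X in lint _ X]eq_fun do rewrite big_nil; exact: lint0.
rewrite big_cons -IH -lintD//; first by congr lint; apply/funext => x; rewrite big_cons.
  by apply: measurable_sum.
by move=> x; apply: sumr_ge0.
Qed.

Definition avg (P : set T) (f : T -> R) : R :=
  fine (lint mu (fun x => \1_P x * f x)%R) / fine (mu P).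

Lemma avg_ge0 P f : (forall x, 0 <= f x) -> 0 <= avg P f.
Proof.
move=> f0; rewrite divr_ge0// fine_ge0// lint_ge0// => x.
by rewrite mulr_ge0// indic_ge0.
Qed.

Lemma lint_weight_lty (k f : T -> R) : measurable_fun setT k -> measurable_fun setT f ->
  (forall x, 0 <= k x) -> (forall x, 0 <= f x) ->
  (lint mu k < +oo)%E -> (lint mu (fun x => k x * f x ^+ 2)%R < +oo)%E ->
  (lint mu (fun x => k x * f x)%R < +oo)%E.
Proof.
move=> mk mf k0 f0 ki fi.
apply: (@le_lt_trans _ _ (lint mu (fun x => k x + k x * f x ^+ 2)%R)).
  apply: lint_le; try side.
  move=> x; rewrite -[X in _ <= X + _]mulr1 -mulrDr; apply: ler_wpM2l => //.
  by have := sqr_ge0 (f x - 1); have := f0 x; lra.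
by rewrite lintD; try side; exact: lte_add_pinfty.
Qed.

(** The mean minimizes the weighted quadratic deviation, with the exact
excess; subtractions are avoided by moving the cross terms to the side where
they are nonnegative. *)
Lemma weighted_variance (k f : T -> R) (b : R) :
  measurable_fun setT k -> measurable_fun setT f ->
  (forall x, 0 <= k x) -> (forall x, 0 <= f x) ->
  (0 < lint mu k < +oo)%E -> (lint mu (fun x => k x * f x ^+ 2)%R < +oo)%E ->
  let a := fine (lint mu (fun x => k x * f x)%R) / fine (lint mu k) in
  lint mu (fun x => k x * (b - f x) ^+ 2)%R =
  (lint mu (fun x => k x * (a - f x) ^+ 2)%R + ((b - a) ^+ 2 * fine (lint mu k))%:E)%E.
Proof.
move=> mk mf k0 f0 /andP[V0' ki] fi a.
have fi1 := lint_weight_lty mk mf k0 f0 ki fi.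
set V := fine (lint mu k) in a *.
have VE : lint mu k = V%:E by rewrite fineK// ge0_fin_numE// ltW.
have V0 : 0 < V by rewrite fine_gt0// V0'.
have I0 : (0 <= lint mu (fun x => k x * f x)%R)%E by apply: lint_ge0; nn.
have aE : lint mu (fun x => k x * f x)%R = (a * V)%:E.
  by rewrite /a divfK ?gt_eqF// fineK// ge0_fin_numE.
have a0 : 0 <= a by rewrite divr_ge0 ?(ltW V0)// fine_ge0.
have cancel (I J : \bar R) (r u : R) : (I + r%:E)%E = (J + (r + u)%:E)%E -> I = (J + u%:E)%E.
  move=> h; rewrite -(@addeK _ r%:E I)// h EFinD (addeC r%:E) addeA addeK//.
pose t := a - b.
have -> : b - a = - t by rewrite /t opprB.
rewrite sqrrN; apply: (cancel _ _ (2 * `|t| * a * V)).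
have nt := normr_ge0 t; set n := `|t| in nt *.
have [t0|t0] := leP 0 t.
  have nE : n = t by rewrite /n ger0_norm.
  transitivity (lint mu (fun x => k x * (b - f x) ^+ 2 + 2 * n * a * k x)%R).
    by rewrite lintD; try side; rewrite lintZ; try side; rewrite VE EFinM.
  transitivity (lint mu (fun x => k x * (a - f x) ^+ 2 +
      (2 * n * (k x * f x) + t ^+ 2 * k x))%R).
    by congr lint; apply/funext => x; rewrite nE /t; ring.
  rewrite !lintD; try side; rewrite !lintZ; try side.
  by rewrite aE VE -!EFinM -EFinD; congr (_ + _%:E)%E; ring.
have nE : n = - t by rewrite /n ltr0_norm.
transitivity (lint mu (fun x => k x * (b - f x) ^+ 2 + 2 * n * (k x * f x))%R).
  by rewrite lintD; try side; rewrite lintZ; try side; rewrite aE -EFinM; congr (_ + _%:E)%E; ring.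
transitivity (lint mu (fun x => k x * (a - f x) ^+ 2 +
    (2 * n * a * k x + t ^+ 2 * k x))%R).
  by congr lint; apply/funext => x; rewrite nE /t; ring.
rewrite !lintD; try side; rewrite !lintZ; try side.
by rewrite VE -!EFinM -EFinD.
Qed.

Lemma avg_jensen P f b : measurable P -> (0 < mu P < +oo)%E ->
  measurable_fun setT f -> (forall x, 0 <= f x) ->
  (lint mu (fun x => (\1_P x * f x ^+ 2)%R)%R < +oo)%E ->
  (((b - avg P f) ^+ 2 * fine (mu P))%:E <=
   lint mu (fun x => \1_P x * (b - f x) ^+ 2)%R)%E.
Proof.
move=> mP Pf mf f0 fi.
have m1 : measurable_fun setT (\1_P : T -> R) by mfun.
have := @weighted_variance \1_P f b m1 mf (@indic_ge0 _ _ P) f0; rewrite lint_indic//.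
move=> /(_ Pf fi) ->; rewrite leeDr//; apply: lint_ge0; nn.
Qed.

End indic.

Section tonelli.
Context d1 d2 (T1 : measurableType d1) (T2 : measurableType d2) (R : realType).
Variables (m1 : {sigma_finite_measure set T1 -> \bar R})
          (m2 : {sigma_finite_measure set T2 -> \bar R}).
Variable F : T1 * T2 -> R.
Hypotheses (mF : measurable_fun setT F) (F0 : forall z, 0 <= F z).

Let mF' : measurable_fun setT (fun z => (F z)%:E).
Proof. by mfun. Qed.

Lemma lint_tonelli1 :
  lint (m1 \x m2)%E F = (\int[m1]_x lint m2 (fun y => F (x, y))%R)%E.
Proof. by apply: fubini_tonelli1 => // z; rewrite lee_fin. Qed.

Lemma lint_tonelli2 :
  lint (m1 \x m2)%E F = (\int[m2]_y lint m1 (fun x => F (x, y))%R)%E.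
Proof. by apply: fubini_tonelli2 => // z; rewrite lee_fin. Qed.

Lemma measurable_lint_snd : measurable_fun setT (fun x => lint m2 (fun y => F (x, y))%R).
Proof.
apply: (measurable_fun_fubini_tonelli_F (fun z => (F z)%:E)) => //.
Qed.

Lemma measurable_slice1 x : measurable_fun setT (fun y => F (x, y)).
Proof. exact: (measurableT_comp mF (pair1_measurable x)). Qed.

End tonelli.

Section grid.
Context {R : realType} (N : nat).
Local Notation X := 'rV[R]_N.
Local Notation mu := (lebesgue_rV N : {measure set X -> \bar R}).

Implicit Types (x y : X) (m : 'rV[int]_N).

Definition mesh (k : nat) : R := 2^-1 ^+ k.

Lemma mesh_gt0 k : 0 < mesh k.
Proof. by rewrite /mesh exprn_gt0// invr_gt0. Qed.

Lemma mesh_le1 k : mesh k <= 1.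
Proof. by rewrite /mesh exprn_ile1// ?invf_le1//; lra. Qed.

Definition cell (k : nat) (x : X) : 'rV[int]_N := \row_i Num.floor (x ord0 i / mesh k).

Definition box (k : nat) (m : 'rV[int]_N) : set X :=
  cube (\row_i (mesh k * (m ord0 i)%:~R)) (2 * mesh k).

Lemma cell_dist k x i :
  0 <= x ord0 i - mesh k * (cell k x ord0 i)%:~R < mesh k.
Proof.
rewrite mxE; have /andP[f1 f2] := floor_itv (x ord0 i / mesh k).
have h0 := mesh_gt0 k.
rewrite subr_ge0 mulrC -ler_pdivlMr// f1/= ltrBlDr.
move: f2; rewrite ltr_pdivrMr// intrD mulrDl mul1r => f2.
by rewrite addrC.
Qed.

Lemma cube_box k x : cube x (mesh k) `<=` box k (cell k x).
Proof.
move=> y yx i; have := yx i; have /andP[] := cell_dist k x i.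
rewrite !mxE; set a := mesh k * _; move=> H1 H2 H3.
have := ler_distD (x ord0 i) (y ord0 i) a.
rewrite (ger0_norm H1) => H4; apply: le_lt_trans H4 _.
rewrite mulrDl mul1r; exact: ltrD.
Qed.

Lemma box_dist k x y : box k (cell k x) y -> `|x - y| <= 3 * mesh k.
Proof.
move=> yx; have h0 := mesh_gt0 k.
apply: rV_norm_le => [|i]; first by rewrite mulr_ge0// ltW.
have := yx i; have /andP[] := cell_dist k x i.
rewrite !mxE; set a := mesh k * _; move=> H1 H2 H3.
have := ler_distD a (x ord0 i) (y ord0 i).
rewrite (distrC a) (ger0_norm H1) => H4; apply: le_trans H4 _.
rewrite (_ : 3 * mesh k = mesh k + 2 * mesh k); last by ring.
by apply: ltW; apply: ltrD.
Qed.

Lemma cube_measure x r : 0 < r -> mu (cube x r) = ((2 * r) ^+ N)%:E.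
Proof.
move=> r0; pose A i := `](x ord0 i - r), (x ord0 i + r)[%classic.
have mA i : measurable (A i) by exact: measurable_itv.
have -> : mu (cube x r) = (\prod_(i < N) lebesgue_measure (A i))%E.
  rewrite -(lebesgue_rV_box mA); congr (lebesgue_rV N _).
  by apply/seteqP; split=> y /= H i; have := H i; rewrite /A/= in_itv/= ltr_distl.
have E i : lebesgue_measure (A i) = (2 * r)%:E.
  rewrite /A lebesgue_measure_itv/= lte_fin ltrBlDr -addrA ltrDl addr_gt0//.
  by rewrite -EFinB; congr EFin; ring.
under eq_bigr do rewrite E.
by rewrite prodEFin prodr_const card_ord.
Qed.

Lemma cube_lty x r : 0 < r -> (mu (cube x r) < +oo)%E.
Proof. by move=> r0; rewrite cube_measure// ltry. Qed.

Lemma measurable_box k m : measurable (box k m).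
Proof. exact: measurable_cube. Qed.

Lemma measurable_box_graph k :
  measurable [set z : X * X | box k (cell k z.1) z.2].
Proof.
rewrite (_ : mkset _ = \bigcap_(i in [set: 'I_N])
   ((fun z : X * X => `|z.2 ord0 i - mesh k * (Num.floor (z.1 ord0 i / mesh k))%:~R|)
     @^-1` `]-oo, 2 * mesh k[%classic)).
  apply: fin_bigcap_measurable => // i _.
  rewrite -[X in measurable X]setTI.
  have mi := @measurable_rV_coord _ (measurableTypeR R) N i.
  suff : measurable_fun setT (fun z : X * X => `|z.2 ord0 i -
      mesh k * (Num.floor (z.1 ord0 i / mesh k))%:~R|) by apply.
  have m2 : measurable_fun setT (fun z : X * X => z.2 ord0 i).
    exact: (measurableT_comp mi measurable_snd).
  have m1 : measurable_fun setT (fun z : X * X => z.1 ord0 i / mesh k).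
    have := measurableT_comp mi (@measurable_fst _ _ X X) => m1.
    by apply: measurable_mulr_set => //; exact: measurable_cst.
  have mf : measurable_fun setT (fun t : R => (Num.floor t)%:~R : R).
    apply: nondecreasing_measurable => // a b ab; rewrite ler_int; exact: le_floor.
  have m3 := measurableT_comp mf m1.
  apply: measurable_norm_fun; apply: measurable_funB => //.
  by apply: measurable_mulr_set => //; exact: measurable_cst.
apply/seteqP; split=> -[x y]/= H i.
  by move=> _ /=; have := H i; rewrite in_itv/= !mxE.
by have := H i I; rewrite /= in_itv/= !mxE.
Qed.

End grid.

Section layers.
Context {R : realType}.

Lemma powR_sub2 (q t : R) : 2 < q -> 0 <= t -> t `^ q = t `^ (q - 2) * t ^+ 2.
Proof.
move=> q2 t0; rewrite -powR_mulrn// -powRD ?subrK//.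
by rewrite (gt_eqF (_ : 0 < q))//; lra.
Qed.

Lemma powR_layers (q dl t : R) (al lam : nat -> R) n : 2 < q -> 0 <= dl -> 0 <= t ->
  (forall i, 0 <= al i) -> (forall i, 0 <= lam i) ->
  al 0%N <= dl -> (forall i, 2 * al i <= lam i) -> t <= lam n.+1 ->
  t `^ q <= (2 * dl) `^ (q - 2) * t ^+ 2 +
    \sum_(i < n.+1) 4 * lam i.+1 `^ (q - 2) * (t - al i) ^+ 2.
Proof.
move=> q2 dl0 t0 al0 lam0 ald all.
have q20 : 0 <= q - 2 by lra.
have far i : lam i.+1 >= t -> 2 * al i <= t ->
    t `^ q <= 4 * lam i.+1 `^ (q - 2) * (t - al i) ^+ 2.
  move=> tl at_; rewrite powR_sub2//.
  have -> : 4 * lam i.+1 `^ (q - 2) * (t - al i) ^+ 2 =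
    lam i.+1 `^ (q - 2) * (4 * (t - al i) ^+ 2) by ring.
  apply: ler_pM; [exact: powR_ge0|exact: sqr_ge0|exact: powR_mono|].
  by have := al0 i; nra.
have term0 i : 0 <= 4 * lam i.+1 `^ (q - 2) * (t - al i) ^+ 2 by nn.
elim: n => [|n IH] tn.
  rewrite big_ord_recr big_ord0/= add0r.
  have [td|/ltW dt] := leP t (2 * dl).
    apply: ler_wpDr => //; rewrite powR_sub2//.
    by apply: ler_wpM2r; [exact: sqr_ge0|exact: powR_mono].
  apply: ler_wpDl; first by nn; lra.
  by apply: far => //; lra.
rewrite big_ord_recr/= addrA; have [/IH H|/ltW nt] := leP t (lam n.+1).
  exact: ler_wpDr.
apply: ler_wpDl.
  apply: addr_ge0; first by nn; lra.
  by apply: sumr_ge0 => i _; exact: term0.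
by apply: far => //; exact: le_trans (all n.+1) nt.
Qed.

Lemma geometric_sum_le (r : R) n : 0 <= r < 1 -> \sum_(i < n) r ^+ i <= (1 - r)^-1.
Proof.
move=> /andP[r0 r1]; have r10 : 0 < 1 - r by rewrite subr_gt0.
suff -> : \sum_(i < n) r ^+ i = (1 - r ^+ n) / (1 - r).
  rewrite -[leRHS]mul1r; apply: ler_wpM2r; first by rewrite invr_ge0 ltW.
  by rewrite gerBl exprn_ge0.
elim: n => [|n IH]; first by rewrite big_ord0 expr0 subrr mul0r.
by rewrite big_ord_recr/= IH exprS; field; rewrite gt_eqF.
Qed.

Lemma expr_unbounded (b t : R) : 1 < b -> exists n, t <= b ^+ n.
Proof.
move=> b1; have b10 : 0 < b - 1 by rewrite subr_gt0.
have B n : 1 + n%:R * (b - 1) <= b ^+ n.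
  elim: n => [|n IH]; first by rewrite mul0r addr0 expr0.
  rewrite exprS -natr1; move: (n%:R) (ler0n R n) IH => m m0 IH.
  have := ler_wpM2l (ltW (lt_trans ltr01 b1)) IH; apply: le_trans.
  by have := mulr_ge0 m0 (sqr_ge0 (b - 1)); lra.
exists (Num.bound (`|t| / (b - 1))).
have := archi_boundP (divr_ge0 (normr_ge0 t) (ltW b10)).
set m := Num.bound _; rewrite ltr_pdivrMr// => H.
by have := B m; have := ler_norm t; lra.
Qed.

End layers.

Section sobolev.
Context {R : realType} (N : nat) (s : R).
Local Notation X := 'rV[R]_N.
Local Notation mu := (lebesgue_rV N).
Local Notation mu2 := (lebesgue_rV N \x lebesgue_rV N)%E.
Local Notation K := (Defs.kernel s).
Hypotheses (s0 : 0 < s) (sN : 2 * s < N%:R).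

Definition ndim : R := N%:R + 2 * s.
Definition tau : R := 2^-1 `^ (2 * s).
Definition beta : R := 2 `^ ((N%:R - 2 * s) / 2).

Lemma N_gt0 : (0 : R) < N%:R.
Proof. by apply: lt_trans sN; rewrite mulr_gt0. Qed.

Lemma ndim_gt0 : 0 < ndim.
Proof. by rewrite addr_gt0 ?mulr_gt0 ?N_gt0. Qed.

Lemma tau_gt0 : 0 < tau.
Proof. by rewrite powR_gt0// invr_gt0. Qed.

Lemma powR_gt1 (a e : R) : 1 < a -> 0 < e -> 1 < a `^ e.
Proof.
move=> a1 e0; have := @gt0_ltr_powR _ e e0 1 a; rewrite !nnegrE powR1; apply => //.
by apply: ltW; apply: lt_trans a1.
Qed.

Lemma beta_gt1 : 1 < beta.
Proof. by apply: powR_gt1; rewrite ?ltr1n// divr_gt0// subr_gt0. Qed.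

Lemma mesh_powR k e : mesh k `^ e = (2^-1 `^ e) ^+ k :> R.
Proof.
rewrite /mesh -powR_mulrn ?invr_ge0// powRAC powR_mulrn//; exact: powR_ge0.
Qed.

Lemma mesh_ndim a k : 0 <= a ->
  (a * mesh k) `^ ndim = a `^ ndim * mesh k ^+ N * tau ^+ k.
Proof.
move=> a0; rewrite powRM ?(ltW (mesh_gt0 _))// /ndim [mesh k `^ _]powRD; last first.
  by rewrite (gt_eqF (mesh_gt0 k)) implybT.
by rewrite powR_mulrn ?(ltW (mesh_gt0 _))// mesh_powR mulrA.
Qed.

Lemma beta2 : beta ^+ 2 = 2 ^+ N * tau.
Proof.
rewrite -powR_mulrn ?powR_ge0// -powRrM divfK// powRB; last first.
  by rewrite pnatr_eq0 implybT.
rewrite powR_mulrn// /tau -(@powR_inv1 R 2)// -powRrM mulN1r powRN//.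
Qed.

Variables (D : set X) (c : R).
Hypotheses (mD : measurable D) (c0 : 0 < c).
Hypothesis dens : forall x r, D x -> 0 < r <= 1 ->
  ((c * r ^+ N)%:E <= mu (D `&` cube x r))%E.

Let P (k : nat) (x : X) : set X := D `&` box k (cell k x).

Let mP k x : measurable (P k x).
Proof. by apply: measurableI => //; exact: measurable_box. Qed.

Let P_lty k x : (mu (P k x) < +oo)%E.
Proof.
apply: (@le_lt_trans _ _ (mu (box k (cell k x)))).
  apply: le_measure; rewrite ?inE; [exact: mP|exact: measurable_box|].
  exact: subIsetr.
by apply: cube_lty; rewrite mulr_gt0 ?mesh_gt0.
Qed.

Let V (k : nat) (x : X) : R := fine (mu (P k x)).

Let VE k x : mu (P k x) = (V k x)%:E.
Proof. by rewrite fineK// ge0_fin_numE. Qed.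

Let V_ge k x : D x -> c * mesh k ^+ N <= V k x.
Proof.
move=> Dx; rewrite -lee_fin -VE.
apply: le_trans (dens Dx (_ : 0 < mesh k <= 1)) _.
  by rewrite mesh_gt0 mesh_le1.
apply: le_measure; rewrite ?inE; [|exact: mP|].
  by apply: measurableI => //; exact: measurable_cube.
by apply: setIS; exact: cube_box.
Qed.

Let cm0 k : 0 < c * mesh k ^+ N.
Proof. by rewrite mulr_gt0// exprn_gt0// mesh_gt0. Qed.

Let V_gt0 k x : D x -> 0 < V k x.
Proof. by move=> Dx; apply: lt_le_trans (V_ge k Dx). Qed.

Let P_pos k x : D x -> (0 < mu (P k x) < +oo)%E.
Proof. by move=> Dx; rewrite P_lty andbT VE lte_fin V_gt0. Qed.

Variables (f : X -> R) (A : R).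
Hypotheses (mf : measurable_fun setT f) (f0 : forall x, 0 <= f x).
Hypothesis A0 : 0 <= A.
Hypothesis fE : (lint mu (fun x => \1_D x * f x ^+ 2)%R <= (A ^+ 2)%:E)%E.
Definition gagl (D' : set X) (g : X -> R) (z : X * X) : R :=
  \1_D' z.1 * (\1_D' z.2 * ((g z.1 - g z.2) ^+ 2 * K z)).
Hypothesis fG : (lint mu2 (gagl D f) <= (A ^+ 2)%:E)%E.

Definition slice (x : X) : \bar R :=
  lint mu (fun y => \1_D y * ((f x - f y) ^+ 2 * K (x, y)))%R.

Lemma gagl_ge0 D' g z : 0 <= gagl D' g z.
Proof. by rewrite /gagl; have := @kernel_ge0 R N s z; nn. Qed.

Lemma measurable_gagl D' g : measurable D' -> measurable_fun setT g ->
  measurable_fun setT (gagl D' g).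
Proof.
move=> mD' mg; rewrite /gagl; have mi : measurable_fun setT (\1_D' : X -> R) by mfun.
by have mK := @measurable_kernel R N s; mfun.
Qed.

Lemma slice_ge0 x : (0 <= slice x)%E.
Proof. by apply: lint_ge0 => y; have := @kernel_ge0 R N s (x, y); nn. Qed.

Lemma measurable_slice : measurable_fun setT slice.
Proof.
have mK := @measurable_kernel R N s.
have mi : measurable_fun setT (\1_D : X -> R) by mfun.
apply: (@measurable_lint_snd _ _ X X R mu
  (fun z => \1_D z.2 * ((f z.1 - f z.2) ^+ 2 * K z))).
  by mfun.
by move=> z; have := kernel_ge0 s z; nn.
Qed.

Lemma lint_gagl : lint mu2 (gagl D f) = (\int[mu]_x ((\1_D x)%:E * slice x))%E.
Proof.
have mK := @measurable_kernel R N s.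
rewrite lint_tonelli1; [|exact: measurable_gagl|exact: gagl_ge0].
apply: eq_integral => x _; rewrite /slice -lintZ ?indic_ge0//.
  have mi : measurable_fun setT (\1_D : X -> R) by mfun.
  have : measurable_fun setT (fun z : X * X => \1_D z.2 * ((f z.1 - f z.2) ^+ 2 * K z)) by mfun.
  by move=> /measurable_slice1; exact.
by move=> y; have := kernel_ge0 s (x, y); nn.
Qed.

Lemma osc_le (Q : set X) x r : measurable Q -> Q `<=` D -> 0 < r ->
  (forall y, Q y -> `|x - y| <= r) ->
  (lint mu (fun y => \1_Q y * (f x - f y) ^+ 2)%R <=
    ((N%:R * r) `^ ndim)%:E * slice x)%E.
Proof.
move=> mQ QD r0 Qr; have mK := @measurable_kernel R N s.
have mK1 := measurable_slice1 mK x.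
have K0 y := kernel_ge0 s (x, y).
rewrite /slice -lintZ; [|side|by move=> y; nn|exact: powR_ge0].
apply: lint_le; try side.
move=> y; have [Qy|nQ] := pselect (Q y); last first.
  by rewrite (indic_out _ nQ) mul0r; nn.
rewrite (indic_in _ Qy) (indic_in _ (QD _ Qy)) !mul1r.
have [<-|xy] := eqVneq x y; first by rewrite subrr expr0n/= mul0r mulr0.
rewrite mulrCA ler_peMr ?sqr_ge0//.
have Nr0 : 0 < (N%:R * r) `^ ndim by rewrite powR_gt0// mulr_gt0// N_gt0.
by rewrite -ler_pdivrMl// mulr1 kernel_ge// Qr.
Qed.


Definition cavg (k : nat) (m : 'rV[int]_N) : R := avg mu (D `&` box k m) f.

Let a (k : nat) (x : X) : R := cavg k (cell k x).

Lemma cavg_ge0 k m : 0 <= cavg k m.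
Proof. exact: avg_ge0. Qed.

Lemma measurable_cavg k : measurable_fun setT (fun x : X => cavg k (cell k x)).
Proof.
have mW := @measurable_box_graph R N k.
have mi : measurable_fun setT (\1_D : X -> R) by mfun.
have key (g : X -> R) : measurable_fun setT g -> (forall x, 0 <= g x) ->
    measurable_fun setT (fun x => fine (lint mu (fun y => \1_(P k x) y * g y)%R)).
  move=> mg g0; apply: (measurableT_comp (@fine_measurable R setT measurableT)).
  rewrite (_ : (fun x => _) = (fun x => lint mu (fun y =>
    (\1_[set z : X * X | box k (cell k z.1) z.2] (x, y)) * (\1_D y * g y))%R)).
    apply: (@measurable_lint_snd _ _ X X R mu (fun z =>
      (\1_[set z : X * X | box k (cell k z.1) z.2] z) * (\1_D z.2 * g z.2))).
      by mfun.
    by move=> z; nn.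
  apply/funext => x; congr lint; apply/funext => y.
  rewrite mulrA; congr (_ * _); rewrite /P indicI mulrC/=; congr (_ * _).
have E : (fun x : X => cavg k (cell k x)) = (fun x : X =>
    fine (lint mu (fun y => \1_(P k x) y * f y)%R) *
    (fine (lint mu (fun y => \1_(P k x) y * 1)%R))^-1).
  apply/funext => x; rewrite /cavg /avg; congr (_ / fine _).
  by rewrite -[LHS](lint_indic _ (mP k x)); congr (lint _ _); apply/funext => y; rewrite mulr1.
rewrite E; apply: measurable_mulr_set; first exact: key.
apply: measurable_invr_fun; apply: (key (fun=> 1)) => //.
Qed.

Let fP_lty k x : (lint mu (fun y => \1_(P k x) y * f y ^+ 2)%R < +oo)%E.
Proof.
apply: le_lt_trans (ltry (A ^+ 2)); apply: le_trans fE.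
apply: lint_le; try side.
move=> y; rewrite /P indicI; apply: ler_wpM2r; first exact: sqr_ge0.
by rewrite ler_piMr ?indic_le1 ?indic_ge0.
Qed.

Definition Cosc : R := (N%:R * 3) `^ ndim / c.

Lemma Cosc_ge0 : 0 <= Cosc.
Proof. by rewrite divr_ge0 ?powR_ge0// ltW. Qed.

Lemma oscillation_le k :
  (lint mu (fun x => \1_D x * (f x - a k x) ^+ 2)%R <=
   (Cosc * tau ^+ k * A ^+ 2)%:E)%E.
Proof.
have mi : measurable_fun setT (\1_D : X -> R) by mfun.
have ma := measurable_cavg k.
have C0 : 0 <= Cosc * tau ^+ k.
  by rewrite mulr_ge0 ?Cosc_ge0// exprn_ge0// ltW// tau_gt0.
rewrite EFinM; apply: (@le_trans _ _ ((Cosc * tau ^+ k)%:E * lint mu2 (gagl D f))%E); last first.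
  by apply: lee_wpmul2l; rewrite ?lee_fin.
rewrite lint_gagl -ge0_integralZl_EFin//; last 2 first.
- by move=> x _; apply: mule_ge0; [rewrite lee_fin indic_ge0|exact: slice_ge0].
- by apply: emeasurable_funM; [mfun|exact: measurable_slice].
apply: ge0_le_integral => //.
- by move=> x _; rewrite lee_fin; nn.
- by rewrite /a; mfun.
- apply: emeasurable_funM; first exact: measurable_cst.
  by apply: emeasurable_funM; [mfun|exact: measurable_slice].
move=> x _; have [Dx|nD] := pselect (D x); last first.
  by rewrite (indic_out _ nD) !mul0r mul0e mule0.
rewrite (indic_in _ Dx) !mul1r mul1e.
have V0 := V_gt0 k Dx.
have := avg_jensen (f x) (mP k x) (P_pos k Dx) mf f0 (fP_lty k x).
rewrite -/(cavg k (cell k x)) -/(a k x) -/(V k x) => H.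
have m30 : 0 < 3 * mesh k :> R by rewrite mulr_gt0// mesh_gt0.
have := @osc_le (P k x) x _ (mP k x) (@subIsetl _ _ _) m30 (fun y h => box_dist h.2).
move=> /(le_trans H) H2.
have H3 : (((f x - a k x) ^+ 2)%:E <= (V k x)^-1%:E * (((N%:R * (3 * mesh k)) `^ ndim)%:E * slice x))%E.
  apply: (@le_trans _ _ ((V k x)^-1%:E * ((f x - a k x) ^+ 2 * V k x)%:E)%E).
    by rewrite -EFinM lee_fin mulrC mulfK// gt_eqF.
  by apply: lee_wpmul2l => //; rewrite lee_fin invr_ge0 ltW.
apply: (le_trans H3); rewrite muleA; apply: lee_wpmul2r; first exact: slice_ge0.
rewrite -EFinM lee_fin mulrA mesh_ndim ?mulr_ge0// mulrC ler_pdivrMr//.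
apply: (@le_trans _ _ (Cosc * tau ^+ k * (c * mesh k ^+ N))); last first.
  by apply: ler_wpM2l => //; exact: V_ge.
by rewrite /Cosc le_eqVlt; apply/orP; left; apply/eqP; field; rewrite gt_eqF.
Qed.


Definition Cjump : R := (N%:R * 5) `^ ndim * 2 ^+ N / c ^+ 2.

Lemma Cjump_ge0 : 0 <= Cjump.
Proof. by rewrite divr_ge0 ?mulr_ge0 ?powR_ge0 ?exprn_ge0// ltW. Qed.

Lemma mesh_beta k : (mesh k ^+ N)^-1 * tau ^+ k = (beta ^+ 2) ^+ k :> R.
Proof.
by rewrite beta2 exprMn /mesh -exprM mulnC exprM -exprVn -exprVn invrK.
Qed.

Lemma jump_le k x : D x ->
  (a k x - a k.+1 x) ^+ 2 <= Cjump * (beta ^+ 2) ^+ k * A ^+ 2.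
Proof.
move=> Dx; set b := a k x.
have mi : measurable_fun setT (\1_D : X -> R) by mfun.
have V0 := V_gt0 k Dx; have V1 := V_gt0 k.+1 Dx.
have h0 : 0 < mesh k :> R := mesh_gt0 k.
set M := (N%:R * (5 * mesh k)) `^ ndim.
have M0 : 0 <= M by exact: powR_ge0.
have J1 := avg_jensen b (mP k.+1 x) (P_pos k.+1 Dx) mf f0 (fP_lty k.+1 x).
have J2 : ((V k x)%:E * lint mu (fun y => \1_(P k.+1 x) y * (b - f y) ^+ 2)%R <=
    (M * A ^+ 2)%:E)%E.
  rewrite EFinM; apply: (@le_trans _ _ (M%:E * lint mu2 (gagl D f))%E); last first.
    by apply: lee_wpmul2l; rewrite ?lee_fin.
  have g0 (y : X) : setT y -> (0 <= (\1_D y)%:E * slice y)%E.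
    by move=> _; apply: mule_ge0; [rewrite lee_fin indic_ge0|exact: slice_ge0].
  have mg : measurable_fun setT (fun y : X => (\1_D y)%:E * slice y)%E.
    by apply: emeasurable_funM; [mfun|exact: measurable_slice].
  rewrite lint_gagl -(ge0_integralZl_EFin mu measurableT g0 mg M0).
  rewrite -lintZ; [|by mfun|by move=> y; nn|exact: ltW].
  apply: ge0_le_integral => //.
  - by move=> y _; rewrite lee_fin; nn.
  - by mfun.
  - apply: emeasurable_funM; first exact: measurable_cst.
    by apply: emeasurable_funM; [mfun|exact: measurable_slice].
  move=> y _; have [Qy|nQ] := pselect (P k.+1 x y); last first.
    rewrite (indic_out _ nQ) mul0r mulr0.
    by rewrite mule_ge0// mule_ge0// ?slice_ge0// lee_fin indic_ge0.
  rewrite (indic_in _ Qy) (indic_in _ Qy.1) mul1r mul1e.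
  have := avg_jensen (f y) (mP k x) (P_pos k Dx) mf f0 (fP_lty k x).
  rewrite -/(cavg k (cell k x)) -/(a k x) -/b -/(V k x) => H.
  rewrite mulrC -sqrrN opprB; apply: (le_trans H).
  apply: (osc_le (mP k x) (@subIsetl _ _ _)); first by rewrite mulr_gt0.
  move=> z [_ Pz]; have := box_dist Pz; have := box_dist Qy.2.
  have -> : mesh k.+1 = mesh k / 2 :> R by rewrite /mesh exprS mulrC.
  have := ler_distD x y z; rewrite (distrC y x) => e1 e2 e3.
  apply: (le_trans e1); apply: (le_trans (lerD e2 e3)).
  by move: h0; set m := mesh k => h0; lra.
have J3 : (b - a k.+1 x) ^+ 2 * V k.+1 x * V k x <= M * A ^+ 2.
  rewrite -lee_fin; apply: le_trans J2; rewrite EFinM muleC.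
  by apply: lee_wpmul2l; [rewrite lee_fin ltW|exact: J1].
have W : c ^+ 2 * (mesh k ^+ N) ^+ 2 * (2 ^+ N)^-1 <= V k.+1 x * V k x.
  have -> : c ^+ 2 * (mesh k ^+ N) ^+ 2 * (2 ^+ N)^-1 =
     (c * mesh k.+1 ^+ N) * (c * mesh k ^+ N).
    have -> : mesh k.+1 = 2^-1 * mesh k :> R by rewrite /mesh exprS.
    by rewrite [(2^-1 * _) ^+ N]exprMn exprVn; ring.
  by apply: ler_pM; rewrite ?(ltW (cm0 _))//; exact: V_ge.
have J4 : (b - a k.+1 x) ^+ 2 * (c ^+ 2 * (mesh k ^+ N) ^+ 2 * (2 ^+ N)^-1) <= M * A ^+ 2.
  by apply: le_trans J3; rewrite -[leRHS]mulrA; apply: ler_wpM2l; rewrite ?sqr_ge0.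
have W0 : 0 < c ^+ 2 * (mesh k ^+ N) ^+ 2 * (2 ^+ N)^-1.
  by rewrite !mulr_gt0 ?exprn_gt0 ?invr_gt0 ?exprn_gt0.
rewrite -mesh_beta -(ler_pM2r W0); apply: (le_trans J4).
rewrite /M mulrA mesh_ndim ?mulr_ge0// le_eqVlt; apply/orP; left; apply/eqP.
rewrite /Cjump; field.
by rewrite !gt_eqF ?exprn_gt0.
Qed.

Definition Cavg : R := (Num.sqrt c)^-1 + Num.sqrt Cjump / (beta - 1).

Lemma Cavg_gt0 : 0 < Cavg.
Proof.
rewrite ltr_pwDl ?invr_gt0 ?sqrtr_gt0// divr_ge0 ?sqrtr_ge0// subr_ge0 ltW//.
exact: beta_gt1.
Qed.

Lemma cavg_le k x : D x -> a k x <= Cavg * A * beta ^+ k.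
Proof.
move=> Dx; have b1 := beta_gt1; have b10 : 0 < beta - 1 by rewrite subr_gt0.
elim: k => [|k IH].
  have V0 := V_gt0 0 Dx; rewrite expr0 mulr1.
  have := avg_jensen 0 (mP 0 x) (P_pos 0 Dx) mf f0 (fP_lty 0 x).
  rewrite -/(cavg 0 (cell 0 x)) -/(a 0 x) -/(V 0 x) sub0r sqrrN => H.
  have H2 : a 0 x ^+ 2 * V 0 x <= A ^+ 2.
    rewrite -lee_fin; apply: (le_trans H); apply: le_trans fE.
    apply: lint_le; try side.
    move=> y; rewrite sub0r sqrrN /P indicI; apply: ler_wpM2r; first exact: sqr_ge0.
    by rewrite ler_piMr ?indic_le1 ?indic_ge0.
  have H3 : a 0 x ^+ 2 * c <= A ^+ 2.
    apply: le_trans H2; apply: ler_wpM2l; first exact: sqr_ge0.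
    by have := V_ge 0 Dx; rewrite /mesh expr0 expr1n mulr1.
  have H4 : a 0 x <= (Num.sqrt c)^-1 * A.
    rewrite mulrC ler_pdivlMr ?sqrtr_gt0//.
    have a0 : 0 <= a 0 x * Num.sqrt c by rewrite mulr_ge0 ?sqrtr_ge0// cavg_ge0.
    rewrite -(@ler_pXn2r _ 2 isT) ?nnegrE//.
    by rewrite exprMn sqr_sqrtr// ltW.
  apply: (le_trans H4); apply: ler_wpM2r => //.
  by rewrite lerDl divr_ge0 ?sqrtr_ge0// ltW.
have J := jump_le k Dx.
have J1 : a k.+1 x - a k x <= Num.sqrt Cjump * beta ^+ k * A.
  apply: (le_trans (ler_norm _)); rewrite distrC.
  have r0 : 0 <= Num.sqrt Cjump * beta ^+ k * A.
    by rewrite !mulr_ge0 ?sqrtr_ge0// exprn_ge0// ltW// (lt_trans ltr01).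
  rewrite -(@ler_pXn2r _ 2 isT) ?nnegrE// -normrX ger0_norm ?sqr_ge0//.
  by rewrite !exprMn sqr_sqrtr ?Cjump_ge0// exprAC.
have -> : a k.+1 x = a k x + (a k.+1 x - a k x) by ring.
apply: (le_trans (lerD IH J1)).
have J2 : Num.sqrt Cjump <= Cavg * (beta - 1).
  rewrite /Cavg mulrDl divfK ?gt_eqF// lerDr mulr_ge0 ?invr_ge0 ?sqrtr_ge0//.
  exact: ltW.
have bk0 : 0 <= beta ^+ k * A.
  by rewrite mulr_ge0// exprn_ge0// ltW// (lt_trans ltr01).
have := ler_wpM2r bk0 J2; rewrite exprS => H.
apply: (@le_trans _ _ (Cavg * A * beta ^+ k + Cavg * (beta - 1) * (beta ^+ k * A))).
  by rewrite lerD2l -mulrA.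
rewrite le_eqVlt; apply/orP; left; apply/eqP.
by ring.
Qed.


Variable q : R.
Hypothesis q2 : 2 < q.
Definition rho : R := beta `^ (q - 2) * tau.
Hypothesis rho1 : rho < 1.

Lemma rho_gt0 : 0 < rho.
Proof. by rewrite mulr_gt0 ?tau_gt0// powR_gt0// (lt_trans _ beta_gt1). Qed.

Definition Csob : R := 4 * (2 * Cavg * beta) `^ (q - 2) * Cosc / (1 - rho).

Lemma Csob_ge0 : 0 <= Csob.
Proof.
rewrite divr_ge0 ?subr_ge0 ?(ltW rho1)// mulr_ge0 ?Cosc_ge0//.
by rewrite mulr_ge0 ?powR_ge0.
Qed.

Lemma sobolev_level j dl : 0 < A -> 0 <= dl -> (forall x, D x -> a j x <= dl) ->
  (lint mu (fun x => \1_D x * f x `^ q)%R <=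
    ((2 * dl) `^ (q - 2) * A ^+ 2 + Csob * rho ^+ j * A `^ q)%:E)%E.
Proof.
move=> A1 dl0 adl.
have q20 : 0 <= q - 2 by rewrite subr_ge0 ltW.
have b1 := beta_gt1; have b0 : 0 < beta by exact: lt_trans b1.
have t0 := tau_gt0; have r0 := rho_gt0.
have Ca0 := Cavg_gt0; have Co0 := Cosc_ge0.
have L0 : 0 < Cavg * A by exact: mulr_gt0.
pose lam i := 2 * (Cavg * A * beta ^+ (j + i)).
have lam0 i : 0 < lam i by rewrite !mulr_gt0// exprn_gt0.
have mi : measurable_fun setT (\1_D : X -> R) by mfun.
have ma i := measurable_cavg i.
pose S n := [set x | f x <= lam n.+1].
have mS n : measurable (S n).
  have := mf; move=> /(_ measurableT `]-oo, lam n.+1]%classic (measurable_itv _)).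
  by rewrite setTI; congr measurable; apply/seteqP; split=> x /=; rewrite in_itv.
pose g n x := \1_(S n) x * (\1_D x * f x `^ q).
pose T i := 4 * lam i.+1 `^ (q - 2).
have T0 i : 0 <= T i by rewrite /T; nn.
apply: (@lint_fatou_cst _ _ _ _ g) => //.
- by move=> n; rewrite /g; mfun.
- by mfun.
- by move=> n x; rewrite /g; nn.
- apply: aeW => x.
  have [n Hn] := expr_unbounded (f x / (Cavg * A)) b1.
  apply: cvg_near_cst.
  exists n => // m /= nm; rewrite /g indic_in ?mul1r// /S/= /lam.
  apply: (@le_trans _ _ (Cavg * A * beta ^+ n)).
    by rewrite mulrC -ler_pdivrMr.
  apply: (@le_trans _ _ (Cavg * A * beta ^+ (j + m.+1))).
    rewrite ler_pM2l// ler_weXn2l// ?(ltW b1)//.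
    by rewrite (leq_trans nm)// addnS ltnW// ltnS leq_addl.
  by rewrite ler_peMl ?ler1n// mulr_ge0 ?exprn_ge0// ltW.
move=> n.
apply: (@le_trans _ _ (lint mu (fun x => (2 * dl) `^ (q - 2) * (\1_D x * f x ^+ 2) +
    \sum_(i < n.+1) T i * (\1_D x * (f x - a (j + i) x) ^+ 2))%R)).
  have mT (i : 'I_n.+1) : measurable_fun setT
      (fun x => T i * (\1_D x * (f x - a (j + i) x) ^+ 2)).
    by rewrite /a; mfun.
  apply: lint_le; [by rewrite /g; mfun| |by move=> x; rewrite /g; nn|].
    by apply: measurable_funD; [mfun|exact: measurable_sum].
  move=> x; rewrite /g; have [Dx|nD] := pselect (D x); last first.
    rewrite (indic_out _ nD) !(mul0r, mulr0) add0r.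
    by apply: sumr_ge0 => i _; rewrite mul0r mulr0.
  rewrite (indic_in _ Dx) !mul1r.
  under eq_bigr do rewrite mul1r.
  have [Sx|nS] := pselect (S n x); last first.
    rewrite (indic_out _ nS) mul0r; apply: addr_ge0; first by nn.
    by apply: sumr_ge0 => i _; nn.
  rewrite (indic_in _ Sx) mul1r.
  apply: (@powR_layers _ q dl (f x) (fun i => a (j + i) x) lam n) => //.
  - by move=> i; exact: cavg_ge0.
  - by move=> i; exact: ltW.
  - by rewrite addn0; exact: adl.
  - by move=> i; rewrite /lam ler_pM2l// cavg_le.
have mT (i : 'I_n.+1) : measurable_fun setT
    (fun x => T i * (\1_D x * (f x - a (j + i) x) ^+ 2)).
  by rewrite /a; mfun.
rewrite lintD; [|by mfun|exact: measurable_sum|by nn|]; last first.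
  by move=> x; apply: sumr_ge0 => i _; nn.
rewrite EFinD; apply: leeD.
  rewrite lintZ; [|by mfun|by nn|exact: powR_ge0].
  by rewrite EFinM; apply: lee_wpmul2l; rewrite ?lee_fin ?powR_ge0.
rewrite lint_sum//; last by move=> i x; nn.
apply: (@le_trans _ _ (\sum_(i < n.+1) (4 * (2 * Cavg * beta) `^ (q - 2) * Cosc *
   rho ^+ j * A `^ q * rho ^+ i)%:E)%E).
  apply: lee_sum => i _.
  rewrite lintZ; [|by rewrite /a; mfun|by move=> x; nn|by []].
  apply: (@le_trans _ _ ((T i)%:E * (Cosc * tau ^+ (j + i) * A ^+ 2)%:E)%E).
    by apply: lee_wpmul2l; [rewrite lee_fin|exact: oscillation_le].
  rewrite -EFinM lee_fin le_eqVlt; apply/orP; left; apply/eqP.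
  rewrite /T /lam (powR_sub2 q2 A0).
  have -> : 2 * (Cavg * A * beta ^+ (j + i.+1)) =
     (2 * Cavg * beta) * (A * beta ^+ (j + i)) by rewrite addnS exprS; ring.
  rewrite (@powRM _ (2 * Cavg * beta)) ?mulr_ge0 ?exprn_ge0 ?(ltW b0) ?(ltW Ca0)//.
  rewrite (@powRM _ A) ?exprn_ge0 ?(ltW b0)//.
  have -> : (beta ^+ (j + i)) `^ (q - 2) = (beta `^ (q - 2)) ^+ (j + i).
    by rewrite -powR_mulrn ?(ltW b0)// powRAC powR_mulrn// powR_ge0.
  by rewrite /rho !exprMn !exprD; ring.
rewrite sumEFin lee_fin -mulr_sumr.
apply: (@le_trans _ _ (4 * (2 * Cavg * beta) `^ (q - 2) * Cosc * rho ^+ j * A `^ q * (1 - rho)^-1)).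
  apply: ler_wpM2l; last by apply: geometric_sum_le; rewrite (ltW r0).
  by nn.
by rewrite le_eqVlt; apply/orP; left; apply/eqP; rewrite /Csob; ring.
Qed.

End sobolev.

Section extraction.
Context {R : realType}.

Lemma cvgn_geometric_steps (h : nat -> R) (C r : R) (k0 : nat) : 0 <= r < 1 ->
  (forall k, (k0 <= k)%N -> `|h k.+1 - h k| <= C * r ^+ k) ->
  cvgn h.
Proof.
move=> /andP[r0 r1] H.
pose u n := h (n + k0).+1 - h (n + k0)%N.
have cu : cvgn (series u).
  apply: normed_cvg; rewrite /normed_series_of/=.
  apply: (@series_le_cvg _ _ (geometric (C * r ^+ k0) r)).
  - by move=> n; exact: normr_ge0.
  - move=> n; apply: le_trans (normr_ge0 (h (n + k0).+1 - h (n + k0)%N)) _.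
    by apply: (le_trans (H _ (leq_addl _ _))); rewrite /= exprD mulrCA mulrC mulrAC.
  - move=> n; apply: (le_trans (H _ (leq_addl _ _))).
    by rewrite /= exprD mulrCA mulrC mulrAC.
  - by apply: is_cvg_geometric_series; rewrite ger0_norm.
have E n : h (n + k0)%N = h k0 + series u n.
  elim: n => [|n IH]; first by rewrite /series/= big_geq// addr0.
  by rewrite seriesSr addrA -IH /u addSn addrC subrK.
suff : cvgn (fun n => h (n + k0)%N).
  by move=> /cvg_ex[l hl]; apply/cvg_ex; exists l; rewrite -(cvg_shiftn k0 h _).
have -> : (fun n => h (n + k0)%N) = (fun n => h k0 + series u n) by apply/funext.
by apply: is_cvgD => //; exact: is_cvg_cst.
Qed.

Lemma ultra_fmap (T U : Type) (f : T -> U) (G : set_system T) :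
  UltraFilter G -> UltraFilter (f @ G).
Proof.
move=> UG; split; first exact: fmap_proper_filter.
move=> G' PG' GG'; apply/seteqP; split=> A; last exact: GG'.
move=> G'A; have [//|GnA] := in_ultra_setVsetC (f @^-1` A) UG.
have G'nA : G' (~` A) by exact: GG'.
have FG' : Filter G' by exact: filter_filter.
have : G' (A `&` ~` A) by exact: filterI.
by rewrite setICr => /(@filter_not_empty _ _ PG').
Qed.

(** A countable family of bounded real sequences converges along a common
subsequence: limits along an ultrafilter exist for all sequences at once, and
finitely many of them can be approximated at arbitrarily late times. *)
Lemma diagonal_extraction (I : countType) (v : nat -> I -> R) (B : I -> R) :
  (forall n i, `|v n i| <= B i) ->
  exists phi : nat -> nat, (forall n, (phi n < phi n.+1)%N) /\
    forall i, cvgn (fun n => v (phi n) i).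
Proof.
move=> vB.
have [G [UG EG]] := @ultraFilterLemma nat \oo _.
have /choice[l Hl] i : exists l : R, (fun n => v n i) @ G --> l.
  have := @segment_compact R (- B i) (B i); rewrite compact_ultra.
  move=> /(_ ((fun n => v n i) @ G) (ultra_fmap _ UG)) [].
    apply: (@filterS _ G _ setT); last exact: filterT.
    by move=> n _ /=; rewrite in_itv/= -ler_norml.
  by move=> l [_ Gl]; exists l.
have step k M : exists n, (M < n)%N /\
    forall i, (pickle i < k)%N -> `|v n i - l i| < k.+1%:R^-1.
  have H : G [set n | forall i : I, (pickle i < k)%N -> `|v n i - l i| < k.+1%:R^-1].
    have e0 : (0 : R) < k.+1%:R^-1 by rewrite invr_gt0.
    move: (k.+1%:R^-1) e0 => e e0.
    elim: k => [|k IH]; first by apply: (@filterS _ G _ setT) => //; exact: filterT.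
    have [[i ik]|no] := pselect (exists i : I, pickle i = k).
      have Hi : G [set n | `|v n i - l i| < e].
        have := Hl i => /cvgrPdist_lt/(_ _ e0); apply: filterS => n /=; by rewrite distrC.
      apply: filterS2 IH Hi => n Hn Hin j; rewrite ltnS leq_eqVlt => /orP[/eqP jk|/Hn//].
      by rewrite (_ : j = i)//; apply: (pcan_inj pickleK); rewrite jk.
    apply: filterS IH => n Hn j; rewrite ltnS leq_eqVlt => /orP[/eqP jk|/Hn//].
    by exfalso; apply: no; exists j.
  have GM : G [set n | (M < n)%N] by apply: EG; exists M.+1.
  have [n [n1 n2]] : ([set n | (M < n)%N] `&`
    [set n | forall i : I, (pickle i < k)%N -> `|v n i - l i| < k.+1%:R^-1]) !=set0.
    apply: (@filter_ex _ _ (@ultra_proper _ _ UG)).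
    by apply: filterI.
  by exists n.
pose nx k M := xget 0%N [set n | (M < n)%N /\
    forall i, (pickle i < k)%N -> `|v n i - l i| < k.+1%:R^-1].
have nxP k M : (M < nx k M)%N /\
    forall i, (pickle i < k)%N -> `|v (nx k M) i - l i| < k.+1%:R^-1.
  have [n Hn] := step k M; apply: (@xgetPex _ 0%N [set n | (M < n)%N /\ forall i, (pickle i < k)%N -> `|v n i - l i| < k.+1%:R^-1]); by exists n.
pose phi := fix phi n := if n is n'.+1 then nx n (phi n') else 0%N.
exists phi; split=> [n|i]; first by have [] := nxP n.+1 (phi n).
apply/cvg_ex; exists (l i); apply/cvgrPdist_lt => e e0.
have [N] := ltr_add_invr e0; rewrite add0r => Ne.
exists (maxn N (pickle i)).+1 => // -[//|n] /=; rewrite ltnS geq_max => /andP[Nn pn].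
rewrite distrC; have [_ H] := nxP n.+1 (phi n).
apply: lt_trans (H i _) _; first by rewrite ltnS.
apply: le_lt_trans Ne; rewrite lef_pV2 ?posrE// ler_nat.
by rewrite ltnS leqW.
Qed.

End extraction.

Section summable.
Context d (T : measurableType d) (R : realType) (mu : {measure set T -> \bar R}).

Lemma ae_geometric_bound (g : nat -> T -> R) (C r : R) : 0 < r < 1 ->
  (forall k, measurable_fun setT (g k)) -> (forall k x, 0 <= g k x) ->
  (forall k, (lint mu (g k) <= (C * r ^+ k)%:E)%E) ->
  {ae mu, forall x, exists M, forall k, g k x <= M * (Num.sqrt r) ^+ k}.
Proof.
move=> /andP[r0 r1] mg g0 gC.
have q0 : 0 < Num.sqrt r by rewrite sqrtr_gt0.
have q1 : Num.sqrt r < 1 by rewrite -sqrtr1 ltr_sqrt.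
have qq : Num.sqrt r ^+ 2 = r by rewrite sqr_sqrtr// ltW.
set q := Num.sqrt r in q0 q1 qq *.
have C0 : 0 <= C.
  have := gC 0%N; rewrite expr0 mulr1 -lee_fin; apply: le_trans.
  exact: lint_ge0.
pose f k x := q ^- k * g k x.
have f0 k x : 0 <= f k x by rewrite /f mulr_ge0// invr_ge0 exprn_ge0// ltW.
have mf k : measurable_fun setT (f k) by rewrite /f; mfun.
have fC k : (lint mu (f k) <= (C * q ^+ k)%:E)%E.
  rewrite /f lintZ//; last by rewrite invr_ge0 exprn_ge0// ltW.
  apply: (@le_trans _ _ ((q ^- k)%:E * (C * r ^+ k)%:E)%E).
    by apply: lee_wpmul2l => //; rewrite lee_fin invr_ge0 exprn_ge0// ltW.
  rewrite -EFinM lee_fin -qq -exprM mulnC exprM expr2 le_eqVlt.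
  apply/orP; left; apply/eqP; field; by rewrite expf_neq0// gt_eqF.
pose S x := (\sum_(0 <= k <oo) (f k x)%:E)%E.
have iS : mu.-integrable setT S.
  apply/integrableP; split.
    by apply: ge0_emeasurable_sum => [k x _ _|k _]; [rewrite lee_fin|mfun].
  rewrite (_ : (\int[mu]_x `|S x| = \int[mu]_x S x)%E); last first.
    apply: eq_integral => x _; rewrite gee0_abs//.
    by apply: nneseries_ge0 => k _ _; rewrite lee_fin.
  rewrite integral_nneseries//; [|by move=> k; mfun|by move=> k x _; rewrite lee_fin].
  apply: (@le_lt_trans _ _ (C / (1 - q))%:E); last exact: ltry.
  apply: lime_le.
    by apply: is_cvg_nneseries => k _ _; apply: integral_ge0 => x _; rewrite lee_fin.
  apply: nearW => n.
  apply: (@le_trans _ _ (\sum_(0 <= k < n) (C * q ^+ k)%:E)%E).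
    by apply: lee_sum => k _; exact: fC.
  rewrite sumEFin lee_fin -mulr_sumr; apply: ler_wpM2l => //.
  by rewrite big_mkord; apply: geometric_sum_le; rewrite ltW.
have := integrable_ae measurableT iS; apply: filterS => x /(_ I) Sx.
exists (fine (S x)) => k.
have : ((f k x)%:E <= S x)%E.
  apply: (@le_trans _ _ (\sum_(0 <= i < k.+1) (f i x)%:E)%E); last first.
    by apply: nneseries_lim_ge => i _ _; rewrite lee_fin.
  by rewrite big_nat_recr//= leeDr// sume_ge0// => i _; rewrite lee_fin.
rewrite -{1}(fineK Sx) lee_fin /f => H.
by rewrite -ler_pdivrMr ?exprn_gt0// mulrC.
Qed.

End summable.

Lemma sqr_sub_le_bound (R : realType) (a d b : R) :
  0 <= a <= b -> 0 <= d <= b -> (a - d) ^+ 2 <= b ^+ 2.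
Proof. by move=> /andP[? ?] /andP[? ?]; nra. Qed.

Lemma sqr_sub_le_chain (R : realType) (a b a' b' w : R) : (a - b) ^+ 2 <=
  4 * (((a - a') ^+ 2 + (b - b') ^+ 2) + ((a' - w) ^+ 2 + (b' - w) ^+ 2)).
Proof.
have := sqr_ge0 ((a - a') - (b' - b)); have := sqr_ge0 ((a' - w) - (w - b')).
have := sqr_ge0 ((a - a') + (b' - b) - ((a' - w) + (w - b'))).
by move=> *; nra.
Qed.

Section compactness.
Context {R : realType} (N : nat) (s : R).
Local Notation X := 'rV[R]_N.
Local Notation mu := (lebesgue_rV N).
Local Notation mu2 := (lebesgue_rV N \x lebesgue_rV N)%E.
Hypotheses (s0 : 0 < s) (sN : 2 * s < N%:R).

Lemma tau_lt1 : tau s < 1 :> R.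
Proof.
rewrite /tau -(@powR_inv1 R 2)// -powRrM mulN1r powRN invf_lt1 ?powR_gt0//.
by apply: powR_gt1; rewrite ?ltr1n// mulr_gt0.
Qed.

Variables (c A : R) (D_ : nat -> set X) (f_ : nat -> X -> R).
Hypotheses (c0 : 0 < c) (A0 : 0 <= A).
Hypothesis mD : forall n, measurable (D_ n).
Hypothesis dens : forall n x r, D_ n x -> 0 < r <= 1 ->
  ((c * r ^+ N)%:E <= mu (D_ n `&` cube x r))%E.
Hypothesis mf : forall n, measurable_fun setT (f_ n).
Hypothesis f0 : forall n x, 0 <= f_ n x.
Hypothesis fE : forall n, (lint mu (fun x => \1_(D_ n) x * f_ n x ^+ 2)%R <= (A ^+ 2)%:E)%E.
Hypothesis fG : forall n, (lint mu2 (gagl s (D_ n) (f_ n)) <= (A ^+ 2)%:E)%E.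

Let bd (k : nat) : R := Cavg N s c * A * beta N s ^+ k.
Let v (n : nat) (i : nat * 'rV[int]_N) : R :=
  Num.min (cavg (D_ n) (f_ n) i.1 i.2) (bd i.1).

Let bd0 k : 0 <= bd k.
Proof.
rewrite /bd !mulr_ge0// ?exprn_ge0// ltW//; first exact: Cavg_gt0.
by apply: lt_trans (beta_gt1 sN).
Qed.

Let v_bd n i : 0 <= v n i <= bd i.1.
Proof. by rewrite /v le_min cavg_ge0// bd0 ge_min lexx orbT. Qed.

Let v_in n k x : D_ n x -> v n (k, cell k x) = cavg (D_ n) (f_ n) k (cell k x).
Proof.
move=> Dx; apply: min_idPl => /=.
exact: (cavg_le s0 sN (mD n) c0 (@dens n) (mf n) (f0 n) A0 (fE n) (fG n)).
Qed.

Theorem ae_compactness : exists phi : nat -> nat,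
  (forall n, (phi n < phi n.+1)%N) /\
  {ae mu, forall x, (\forall n \near \oo, D_ (phi n) x) -> cvgn (fun n => f_ (phi n) x)}.
Proof.
have t0 := @tau_gt0 R s; have t1 := tau_lt1.
have [|phi [phi_inc phi_cvg]] := @diagonal_extraction R _ v (fun i => bd i.1).
  by move=> n i; have /andP[v0 vb] := v_bd n i; rewrite ger0_norm.
pose W k n (x : X) := v (phi n) (k, cell k x).
pose Winf k (x : X) := limn (fun n => v (phi n) (k, cell k x)).
have W_cvg k x : W k n x @[n --> \oo] --> Winf k x by exact: phi_cvg.
have mW k n : measurable_fun setT (W k n).
  rewrite /W /v /=; apply: measurable_minr => //.
  by apply: measurable_cavg.
have mWinf k : measurable_fun setT (Winf k).
  by apply: (@measurable_fun_cvg _ _ _ setT (W k)) => // x _; exact: W_cvg.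
have Winf_bd k x : 0 <= Winf k x <= bd k.
  apply/andP; split.
    apply: limr_ge; first by apply/cvg_ex; exists (Winf k x); exact: W_cvg.
    by apply: nearW => n; have /andP[] := v_bd (phi n) (k, cell k x).
  apply: limr_le; first by apply/cvg_ex; exists (Winf k x); exact: W_cvg.
  by apply: nearW => n; have /andP[] := v_bd (phi n) (k, cell k x).
pose B (k : nat) := cube (0 : X) k.+1%:R.
have mB k : measurable (B k) by exact: measurable_cube.
have small k : \forall n \near \oo,
    (lint mu (fun x => \1_(B k) x * (W k n x - Winf k x) ^+ 2)%R <= (tau s ^+ k)%:E)%E.
  apply: (@lint_dct0 _ _ _ _ _ (fun x => bd k ^+ 2 * \1_(B k) x)).
  - by mfun.
  - by mfun.
  - by nn.
  - move=> n x; rewrite mulrC; apply: ler_wpM2r; first exact: indic_ge0.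
    exact: (sqr_sub_le_bound (v_bd (phi n) (k, cell k x)) (Winf_bd k x)).
  - rewrite lintZ; [|by mfun|by nn|exact: sqr_ge0].
    rewrite lint_indic//; apply: lte_mul_pinfty; rewrite ?lee_fin ?sqr_ge0//.
    exact: cube_lty.
  - apply: aeW => x.
    have H : W k n x - Winf k x @[n --> \oo] --> (0 : R).
      by rewrite -(subrr (Winf k x)); apply: cvgB; [exact: W_cvg|exact: cvg_cst].
    rewrite -[X in _ --> X](mulr0 (\1_(B k) x : R)) -[X in _ * X](mulr0 (0 : R)).
    by apply: cvgM; [exact: cvg_cst|exact: cvgM].
  - exact: exprn_gt0.
have /choice[n_ Hn] k : exists n0, forall n, (n0 <= n)%N ->
    (lint mu (fun x => \1_(B k) x * (W k n x - Winf k x) ^+ 2)%R <= (tau s ^+ k)%:E)%E.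
  by have [n0 _ H] := small k; exists n0.
pose psi := fix psi k := if k is k'.+1 then maxn (psi k').+1 (n_ k) else n_ 0%N.
have psi_inc k : (psi k < psi k.+1)%N by rewrite /= leq_max leqnn.
have psi_ge k : (n_ k <= psi k)%N by case: k => //= k; exact: leq_maxr.
pose ph k := phi (psi k).
have phi_mono : {homo phi : m n / (m < n)%N} by apply: homo_ltn => //; exact: ltn_trans.
exists ph; split; first by move=> n; apply: phi_mono.
pose g k x := \1_(B k) x * (\1_(D_ (ph k)) x * (\1_(D_ (ph k.+1)) x *
   (f_ (ph k) x - f_ (ph k.+1) x) ^+ 2)).
have mg k : measurable_fun setT (g k) by rewrite /g; mfun.
pose osc n k x := \1_(D_ n) x * (f_ n x - cavg (D_ n) (f_ n) k (cell k x)) ^+ 2.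
have mosc n k : measurable_fun setT (osc n k).
  by rewrite /osc; have mc := measurable_cavg (mD n) (mf n) (f0 n) k; mfun.
have osc_bd n k : (lint mu (osc n k) <= (Cosc N s c * tau s ^+ k * A ^+ 2)%:E)%E.
  exact: (oscillation_le s0 sN (mD n) c0 (@dens n) (mf n) (f0 n) (fE n) (fG n)).
have osc0 n k x : 0 <= osc n k x by rewrite /osc; nn.
pose dv n k x := \1_(B k) x * (W k n x - Winf k x) ^+ 2.
have mdv n k : measurable_fun setT (dv n k) by rewrite /dv; mfun.
have dv0 n k x : 0 <= dv n k x by rewrite /dv; nn.
have gC k : (lint mu (g k) <= (4 * (2 * (Cosc N s c * A ^+ 2) + 2) * tau s ^+ k)%:E)%E.
  apply: (@le_trans _ _ (lint mu (fun x => 4 * ((osc (ph k) k x + osc (ph k.+1) k x) +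
     (dv (psi k) k x + dv (psi k.+1) k x)))%R)).
    apply: lint_le; [by []|by mfun|by rewrite /g; nn|].
    move=> x; have r0 : 0 <= 4 * ((osc (ph k) k x + osc (ph k.+1) k x) +
       (dv (psi k) k x + dv (psi k.+1) k x)) by nn.
    rewrite /g; have [Bx|nB] := pselect (B k x); last by rewrite (indic_out _ nB) mul0r.
    have [D1|nD] := pselect (D_ (ph k) x); last by rewrite (indic_out _ nD) mul0r mulr0.
    have [D2|nD] := pselect (D_ (ph k.+1) x); last by rewrite (indic_out _ nD) mul0r !mulr0.
    rewrite /osc /dv (indic_in _ Bx) (indic_in _ D1) (indic_in _ D2) !mul1r.
    rewrite /W -/(ph k) -/(ph k.+1) (v_in k D1) (v_in k D2).
    exact: sqr_sub_le_chain.
  rewrite lintZ; [|by mfun|by nn|by []].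
  rewrite !lintD; try side.
  apply: (@le_trans _ _ (4%:E * (((Cosc N s c * tau s ^+ k * A ^+ 2)%:E +
     (Cosc N s c * tau s ^+ k * A ^+ 2)%:E) + ((tau s ^+ k)%:E + (tau s ^+ k)%:E)))%E).
    apply: lee_wpmul2l; first by rewrite lee_fin.
    apply: leeD; apply: leeD => //; first exact: Hn.
    by apply: Hn; apply: leq_trans (psi_ge k) (ltnW _).
  rewrite -!EFinD -EFinM lee_fin le_eqVlt; apply/orP; left; apply/eqP; ring.
have tb : 0 < (tau s : R) < 1 by rewrite t0.
have := @ae_geometric_bound _ _ _ mu g _ _ tb mg _ gC.
move=> /(_ ltac:(by rewrite /g; nn)); apply: filterS => x [M HM] [n0 _ Dx].
set r := Num.sqrt (tau s) in HM.
have r0 : 0 < r by rewrite sqrtr_gt0.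
have r1 : r < 1 by rewrite -sqrtr1 ltr_sqrt.
apply: (@cvgn_geometric_steps _ _ (Num.sqrt M) (Num.sqrt r) (maxn n0 (Num.bound `|x|))).
  by rewrite sqrtr_ge0/= -sqrtr1 ltr_sqrt.
move=> k; rewrite geq_max => /andP[kn kx].
have Bx : B k x.
  rewrite /B cubeE//= subr0; apply: lt_le_trans (archi_boundP (normr_ge0 _)) _.
  by rewrite ler_nat leqW.
have D1 : D_ (ph k) x by exact: (Dx k kn).
have D2 : D_ (ph k.+1) x by exact: (Dx k.+1 (leqW kn)).
have := HM k; rewrite /g (indic_in _ Bx) (indic_in _ D1) (indic_in _ D2) !mul1r.
move=> H; have M0 : 0 <= M.
  by rewrite -(@pmulr_lge0 _ (r ^+ k)) ?exprn_gt0// (le_trans _ H)// sqr_ge0.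
have rk : Num.sqrt M * Num.sqrt r ^+ k = Num.sqrt (M * r ^+ k).
  rewrite sqrtrM//; congr (_ * _); elim: k {kn kx Bx H D1 D2} => [|k IH].
    by rewrite !expr0 sqrtr1.
  by rewrite !exprS sqrtrM ?(ltW r0)// IH.
by rewrite rk -sqrtr_sqr ler_sqrt ?mulr_ge0 ?exprn_ge0 ?(ltW r0)// -sqrrN opprB.
Qed.

End compactness.

Section ae_product.
Context d1 d2 (T1 : measurableType d1) (T2 : measurableType d2) (R : realType).
Variables (m1 : {sigma_finite_measure set T1 -> \bar R})
          (m2 : {sigma_finite_measure set T2 -> \bar R}).

Lemma ae_prod (P : T1 -> Prop) (Q : T2 -> Prop) :
  {ae m1, forall x, P x} -> {ae m2, forall x, Q x} ->
  {ae (m1 \x m2)%E, forall z, P z.1 /\ Q z.2}.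
Proof.
move=> [A [mA A0 HA]] [B [mB B0 HB]].
exists ((A `*` setT) `|` (setT `*` B)); split.
- by apply: measurableU; apply: measurableX.
- have A0' : m1 A = 0%E by exact: A0.
  have B0' : m2 B = 0%E by exact: B0.
  have E1 : (m1 \x m2)%E (A `*` setT) = (m1 A * m2 setT)%E by exact: product_measure1E.
  have E2 : (m1 \x m2)%E (setT `*` B) = (m1 setT * m2 B)%E by exact: product_measure1E.
  rewrite A0' mul0e in E1; rewrite B0' mule0 in E2.
  by rewrite measureU0//; apply: measurableX.
- move=> [x y] /= nPQ; have [Px|nP] := pselect (P x); last by left; split=> //; exact: HA.
  by right; split=> //; apply: HB => /= Qy; apply: nPQ.
Qed.

End ae_product.

Section swap.
Context d (T : measurableType d) (R : realType).
Variable m : {sigma_finite_measure set T -> \bar R}.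

Lemma lint_swap (F : T * T -> R) : measurable_fun setT F -> (forall z, 0 <= F z) ->
  lint (m \x m)%E (fun z => F (z.2, z.1)) = lint (m \x m)%E F.
Proof.
move=> mF F0.
have ms : measurable_fun setT (fun z : T * T => F (z.2, z.1)).
  apply: (measurableT_comp mF).
  by apply/measurable_fun_pairP; split; [exact: measurable_snd|exact: measurable_fst].
by rewrite lint_tonelli1// lint_tonelli2.
Qed.

End swap.

Section energy_norm.
Context {R : realType} (N : nat) (s : R).
Local Notation X := 'rV[R]_N.
Local Notation mu := (lebesgue_rV N).
Local Notation mu2 := (lebesgue_rV N \x lebesgue_rV N)%E.
Local Notation K := (Defs.kernel s).
Implicit Types (O : set X) (u v w : X -> R).

Definition interaction O : X * X -> R := fun z => \1_(~` (O `*` O)) z * K z.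
Definition cross O u (z : X * X) : R := interaction O z * (u z.1 - u z.2) ^+ 2.
Definition mass O u (x : X) : R := \1_(~` O) x * u x ^+ 2.

Lemma interaction_ge0 O z : 0 <= interaction O z.
Proof. by rewrite mulr_ge0 ?indic_ge0 ?kernel_ge0. Qed.

Lemma cross_ge0 O u z : 0 <= cross O u z.
Proof. by rewrite mulr_ge0 ?sqr_ge0 ?interaction_ge0. Qed.

Lemma mass_ge0 O u x : 0 <= mass O u x.
Proof. by rewrite mulr_ge0 ?sqr_ge0 ?indic_ge0. Qed.

Lemma Hs_norm2E O u : Hs_norm2 s O u =
  ((2^-1)%:E * lint mu2 (cross O u) + lint mu (mass O u))%E.
Proof.
rewrite /Hs_norm2; congr (_ * _ + _)%E.
  rewrite (@lint_mkcond _ _ _ mu2); congr lint; apply/funext => z.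
  by rewrite /cross /interaction -normrX ger0_norm ?sqr_ge0// mulrA mulrAC.
rewrite (@lint_mkcond _ _ _ mu); congr lint; apply/funext => x.
by rewrite /mass -normrX ger0_norm ?sqr_ge0.
Qed.

Lemma measurable_interaction O : measurable O -> measurable_fun setT (interaction O).
Proof.
move=> mO; have mK := @measurable_kernel R N s; rewrite /interaction; mfun.
by apply: measurableC; exact: measurableX.
Qed.

Lemma measurable_cross O u : measurable O -> measurable_fun setT u ->
  measurable_fun setT (cross O u).
Proof. by move=> mO mu_; have mi := measurable_interaction mO; rewrite /cross; mfun. Qed.

Lemma measurable_mass O u : measurable O -> measurable_fun setT u ->
  measurable_fun setT (mass O u).
Proof. by move=> /measurableC mO mu_; rewrite /mass; mfun. Qed.

Lemma Hs_norm2_ge0 O u : (0 <= Hs_norm2 s O u)%E.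
Proof.
rewrite Hs_norm2E adde_ge0 ?mule_ge0 ?lee_fin//; apply: lint_ge0 => ?.
  exact: cross_ge0.
exact: mass_ge0.
Qed.

Lemma Hs_norm2_le_abs O u v : measurable O -> measurable_fun setT u -> measurable_fun setT v ->
  (forall x y, (u x - u y) ^+ 2 <= (v x - v y) ^+ 2) -> (forall x, u x ^+ 2 <= v x ^+ 2) ->
  (Hs_norm2 s O u <= Hs_norm2 s O v)%E.
Proof.
move=> mO mu_ mv uv2 uv; rewrite !Hs_norm2E; apply: leeD.
  apply: lee_wpmul2l; first by rewrite lee_fin.
  apply: lint_le; [exact: measurable_cross|exact: measurable_cross|exact: cross_ge0|].
  by move=> z; rewrite /cross; apply: ler_wpM2l; rewrite ?interaction_ge0.
apply: lint_le; [exact: measurable_mass|exact: measurable_mass|exact: mass_ge0|].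
by move=> x; rewrite /mass; apply: ler_wpM2l; rewrite ?indic_ge0.
Qed.

Lemma Hs_norm2_abs O u : measurable O -> measurable_fun setT u ->
  (Hs_norm2 s O (fun x => `|u x|)%R <= Hs_norm2 s O u)%E.
Proof.
move=> mO mu_; apply: Hs_norm2_le_abs => //; first by mfun.
  move=> x y; rewrite -[leLHS]ger0_norm ?sqr_ge0// -[leRHS]ger0_norm ?sqr_ge0//.
  by rewrite !normrX lerXn2r ?nnegrE// ler_dist_dist.
by move=> x; rewrite -normrX ger0_norm ?sqr_ge0.
Qed.

Lemma Hs_norm2Z O u t : measurable O -> measurable_fun setT u ->
  Hs_norm2 s O (fun x => t * u x)%R = ((t ^+ 2)%:E * Hs_norm2 s O u)%E.
Proof.
move=> mO mu_; rewrite !Hs_norm2E.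
have -> : cross O (fun x => t * u x)%R = (fun z => t ^+ 2 * cross O u z).
  by apply/funext => z; rewrite /cross -mulrBr exprMn mulrCA.
have -> : mass O (fun x => t * u x)%R = (fun z => t ^+ 2 * mass O u z).
  by apply/funext => z; rewrite /mass exprMn mulrCA.
have c0 := cross_ge0 O u; have m0 := mass_ge0 O u.
rewrite !lintZ ?sqr_ge0//; [|exact: measurable_mass|exact: measurable_cross].
have g0 : (0 <= lint mu2 (cross O u))%E by exact: lint_ge0.
have g1 : (0 <= lint mu (mass O u))%E by exact: lint_ge0.
by rewrite [in RHS]ge0_muleDr// ?mule_ge0// ?lee_fin// muleCA.
Qed.

Lemma Hs_norm2_ltyP O u : (Hs_norm2 s O u < +oo)%E <->
  (lint mu2 (cross O u) < +oo)%E /\ (lint mu (mass O u) < +oo)%E.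
Proof.
rewrite Hs_norm2E.
have c0 : (0 <= lint mu2 (cross O u))%E by apply: lint_ge0; exact: cross_ge0.
have m0 : (0 <= lint mu (mass O u))%E by apply: lint_ge0; exact: mass_ge0.
split=> [h|[h1 h2]]; last first.
  by apply: lte_add_pinfty => //; apply: lte_mul_pinfty => //; rewrite lee_fin.
split.
  have : ((2^-1)%:E * lint mu2 (cross O u) < +oo)%E.
    by apply: le_lt_trans h; rewrite leeDl.
  move=> /(lte_mul_pinfty (_ : 0 <= 2%:E)%E (_ : 2%:E \is a fin_num)) => /(_ _ _).
  by rewrite muleA -EFinM mulfV// mul1e lee_fin; apply.
by apply: le_lt_trans h; rewrite leeDr// mule_ge0// lee_fin.
Qed.

Lemma Hs_norm2_lin O u v t : measurable O -> measurable_fun setT u -> measurable_fun setT v ->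
  (Hs_norm2 s O u < +oo)%E -> (Hs_norm2 s O v < +oo)%E ->
  (Hs_norm2 s O (fun x => u x + t * v x)%R < +oo)%E.
Proof.
move=> mO mu_ mv uoo voo.
set v' := fun x => t * v x; have mv' : measurable_fun setT v' by rewrite /v'; mfun.
have v'oo : (Hs_norm2 s O v' < +oo)%E.
  by rewrite Hs_norm2Z//; apply: lte_mul_pinfty => //; rewrite lee_fin sqr_ge0.
have sq (a b : R) : (a + b) ^+ 2 <= 2 * a ^+ 2 + 2 * b ^+ 2.
  by have := sqr_ge0 (a - b); lra.
have cu := cross_ge0 O u; have cv := cross_ge0 O v'.
have mu0 := mass_ge0 O u; have mv0 := mass_ge0 O v'.
have mcu := measurable_cross mO mu_; have mcv := measurable_cross mO mv'.
have mmu := measurable_mass mO mu_; have mmv := measurable_mass mO mv'.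
have H1 : (lint mu2 (cross O (fun x => u x + v' x)%R) <=
    2%:E * lint mu2 (cross O u) + 2%:E * lint mu2 (cross O v'))%E.
  rewrite -!lintZ// -lintD//; try side.
  apply: lint_le; [|by mfun|exact: cross_ge0|].
    by apply: measurable_cross => //; mfun.
  move=> z; rewrite /cross [X in _ <= X + _]mulrCA [X in _ <= _ + X]mulrCA -mulrDr.
  apply: ler_wpM2l; first exact: interaction_ge0.
  by rewrite opprD addrACA; exact: sq.
have H2 : (lint mu (mass O (fun x => u x + v' x)%R) <=
    2%:E * lint mu (mass O u) + 2%:E * lint mu (mass O v'))%E.
  rewrite -!lintZ// -lintD//; try side.
  apply: lint_le; [|by mfun|exact: mass_ge0|].
    by apply: measurable_mass => //; mfun.
  move=> z; rewrite /mass [X in _ <= X + _]mulrCA [X in _ <= _ + X]mulrCA -mulrDr.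
  by apply: ler_wpM2l; [exact: indic_ge0|exact: sq].
have [u1 u2] := (Hs_norm2_ltyP _ _).1 uoo; have [v1 v2] := (Hs_norm2_ltyP _ _).1 v'oo.
have fin2 (x y : \bar R) : (0 <= x)%E -> (0 <= y)%E -> (x < +oo)%E -> (y < +oo)%E ->
    (2%:E * x + 2%:E * y < +oo)%E.
  by move=> *; apply: lte_add_pinfty; apply: lte_mul_pinfty => //; rewrite lee_fin.
apply/Hs_norm2_ltyP; split.
  by apply: (le_lt_trans H1); apply: fin2 => //; exact: lint_ge0.
by apply: (le_lt_trans H2); apply: fin2 => //; exact: lint_ge0.
Qed.

End energy_norm.

Section profiles.
Context {R : realType} (N : nat) (s : R).
Local Notation X := 'rV[R]_N.
Local Notation mu := (lebesgue_rV N).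
Local Notation mu2 := (lebesgue_rV N \x lebesgue_rV N)%E.
Local Notation K := (Defs.kernel s).
Implicit Types (O : set X) (u v w : X -> R).

Lemma lint_translate (y : X) (f : X -> R) : measurable_fun setT f -> (forall x, 0 <= f x) ->
  lint mu (fun x => f (x + y))%R = lint mu f.
Proof.
move=> mf f0; apply: (@integral_rV_translate R N y (fun x => (f x)%:E)); first by mfun.
by move=> x; rewrite lee_fin.
Qed.

Lemma lint2_translate (y : X) (F : X * X -> R) :
  measurable_fun setT F -> (forall z, 0 <= F z) ->
  lint mu2 (fun z => F (z.1 + y, z.2 + y))%R = lint mu2 F.
Proof.
move=> mF F0.
have mt : measurable_fun setT (fun z : X * X => (z.1 + y, z.2 + y)).
  apply/measurable_fun_pairP; split.
    exact: (measurableT_comp (measurable_rV_translate y) measurable_fst).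
  exact: (measurableT_comp (measurable_rV_translate y) measurable_snd).
have mFt := measurableT_comp mF mt.
rewrite lint_tonelli1// [RHS]lint_tonelli1//=.
rewrite -[RHS](@integral_rV_translate R N y (fun x => lint mu (fun t => F (x, t))%R)).
- apply: eq_integral => x _.
  apply: (@lint_translate y (fun t => F (x + y, t))) => //.
  exact: measurable_slice1.
- exact: (@measurable_lint_snd _ _ X X R mu F).
- by move=> x; apply: lint_ge0.
Qed.

Definition shift (y : X) O : set X := [set x | O (x + y)].

Lemma measurable_shift y O : measurable O -> measurable (shift y O).
Proof.
by move=> mO; rewrite -[shift y O]setTI; exact: (measurable_rV_translate y measurableT mO).
Qed.

Lemma indic_shift y O x : \1_(shift y O) x = \1_O (x + y) :> R.
Proof. by rewrite !indicE; congr (_ (_ : bool))%:R; rewrite /shift; apply/idP/idP; rewrite !inE. Qed.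

Lemma measurable_fun_translate (y : X) u : measurable_fun setT u ->
  measurable_fun setT (fun x : X => u (x + y)).
Proof. by move=> mu_; exact: (measurableT_comp mu_ (measurable_rV_translate y)). Qed.

Lemma Hs_norm2_translate (y : X) O u : measurable O -> measurable_fun setT u ->
  Hs_norm2 s (shift y O) (fun x => u (x + y))%R = Hs_norm2 s O u.
Proof.
move=> mO mu_; rewrite !Hs_norm2E; congr (_ * _ + _)%E.
  rewrite -(lint2_translate y (measurable_cross s mO mu_) (cross_ge0 s O u)).
  congr lint; apply/funext => -[a b]; rewrite /cross /interaction/= kernelD.
  by congr (_ * _ * _).
rewrite -(lint_translate y (measurable_mass mO mu_) (mass_ge0 O u)).
by congr lint; apply/funext => x; rewrite /mass.
Qed.

Lemma powR_norm2 (x : R) : `|x| `^ 2 = x ^+ 2.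
Proof. by rewrite powR_mulrn ?normr_ge0// -normrX ger0_norm ?sqr_ge0. Qed.

Lemma cvg_indicC (T : Type) (O_ : nat -> set T) (O : set T) x :
  (forall n, O `<=` O_ n) -> (\forall n \near \oo, O_ n x -> O x) ->
  \1_(~` O_ n) x @[n --> \oo] --> (\1_(~` O) x : R).
Proof.
move=> sub ev; apply: cvg_near_cst; apply: filterS ev => n H.
rewrite !indicE; congr ((_ : bool)%:R); apply/idP/idP; rewrite !inE/=.
  by move=> nO; apply: contra_not nO; exact: sub.
by move=> nO /H.
Qed.

Lemma indicC_le (T : Type) (A B : set T) x : B `<=` A -> \1_(~` A) x <= (\1_(~` B) x : R).
Proof.
move=> BA; have [Ax|nA] := pselect (A x); last first.
  by rewrite [leRHS]indic_in ?indic_le1// => /BA.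
have nA : ~ (~` A) x by move=> h; exact: h.
by rewrite (indic_out _ nA) indic_ge0.
Qed.

Lemma Hs_brezis_lieb (O_ : nat -> set X) O (w_ : nat -> X -> R) w (c : R) :
  (forall n, measurable (O_ n)) -> measurable O ->
  (forall n, measurable_fun setT (w_ n)) -> measurable_fun setT w ->
  (forall n, O `<=` O_ n) -> (forall x, \forall n \near \oo, O_ n x -> O x) ->
  {ae mu, forall x, w_ n x @[n --> \oo] --> w x} ->
  (forall n, (Hs_norm2 s (O_ n) (w_ n) <= c%:E)%E) ->
  (Hs_norm2 s O w < +oo)%E /\
  forall e, 0 < e -> \forall n \near \oo,
   (Hs_norm2 s O w + Hs_norm2 s (O_ n) (fun x => w_ n x - w x)%R
     <= Hs_norm2 s (O_ n) (w_ n) + e%:E)%E.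
Proof.
move=> mO_ mO mw_ mw sub ev ww wc.
have q1 : 1 < 2 :> R by rewrite ltr1n.
have t0 : (0 <= (2 : R)%:E)%E by rewrite lee_fin.
have cr n : (lint mu2 (cross s (O_ n) (w_ n)) <= (2 * c)%:E)%E.
  have : ((2^-1)%:E * lint mu2 (cross s (O_ n) (w_ n)) <= c%:E)%E.
    by apply: le_trans (wc n); rewrite Hs_norm2E leeDl// lint_ge0// => x; exact: mass_ge0.
  by move=> /(lee_wpmul2l t0); rewrite muleA -!EFinM mulfV// mul1e.
have ms n : (lint mu (mass (O_ n) (w_ n)) <= c%:E)%E.
  apply: le_trans (wc n); rewrite Hs_norm2E leeDr// mule_ge0 ?lee_fin// lint_ge0// => x.
  exact: cross_ge0.
have [||||||||||A1 A2] := @brezis_lieb _ _ R mu2 2 1 (2 * c)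
  (fun n => interaction s (O_ n)) (fun n z => w_ n z.1 - w_ n z.2)
  (interaction s O) (fun z => w z.1 - w z.2) q1 ler01.
- by move=> n; exact: measurable_interaction.
- exact: measurable_interaction.
- by move=> n; have := mw_ n; move=> ?; mfun.
- by mfun.
- by move=> n z; exact: interaction_ge0.
- by move=> z; exact: interaction_ge0.
- move=> n z; rewrite mul1r /interaction; apply: ler_wpM2r; first exact: kernel_ge0.
  by apply: indicC_le => -[a b] /= [/sub ? /sub ?].
- apply: aeW => z; rewrite /interaction; apply: cvgM; last exact: cvg_cst.
  apply: (@cvg_indicC _ (fun n => O_ n `*` O_ n) (O `*` O)).
    by move=> n -[a b] /= [/sub ? /sub ?].
  apply: filterS2 (ev z.1) (ev z.2) => n H1 H2.
  by move=> [/= /H1 ? /H2 ?].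
- apply: filterS (ae_prod ww ww) => z [h1 h2]; right.
  by apply: cvgB.
- move=> n; apply: le_trans (cr n); rewrite le_eqVlt; apply/orP; left; apply/eqP.
  by congr lint; apply/funext => z; rewrite powR_norm2.
have [||||||||||B1 B2] := @brezis_lieb _ _ R mu 2 1 c
  (fun n => \1_(~` O_ n)) w_ (\1_(~` O)) w q1 ler01.
- by move=> n; have := measurableC (mO_ n); move=> ?; mfun.
- by have := measurableC mO; move=> ?; mfun.
- by [].
- by [].
- by move=> n x; exact: indic_ge0.
- by move=> x; exact: indic_ge0.
- by move=> n x; rewrite mul1r; exact: indicC_le.
- by apply: aeW => x; exact: cvg_indicC.
- by apply: filterS ww => x ?; right.
- move=> n; apply: le_trans (ms n); rewrite le_eqVlt; apply/orP; left; apply/eqP.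
  by congr lint; apply/funext => z; rewrite powR_norm2.
have EA u O' : (fun z => interaction s O' z * `|u z.1 - u z.2| `^ 2) = cross s O' u.
  by apply/funext => z; rewrite powR_norm2.
have EB u O' : (fun x => \1_(~` O') x * `|u x| `^ 2) = mass O' u.
  by apply/funext => z; rewrite powR_norm2.
rewrite EA in A1; rewrite EB in B1.
split.
  by apply/Hs_norm2_ltyP; split; [apply: le_lt_trans A1 _|apply: le_lt_trans B1 _]; exact: ltry.
move=> e e0; have e2 : 0 < e / 2 by rewrite divr_gt0.
apply: filterS2 (A2 e e0) (B2 (e / 2) e2) => n [+ _] [+ _].
rewrite !EA !EB.
have -> : (fun z : X * X => interaction s (O_ n) z *
   `|w_ n z.1 - w_ n z.2 - (w z.1 - w z.2)| `^ 2) = cross s (O_ n) (fun x => w_ n x - w x)%R.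
  by apply/funext => z; rewrite powR_norm2 /cross; congr (_ * _ ^+ 2); ring.
rewrite !Hs_norm2E => H1 H2.
have p0 : (0 <= (2^-1 : R)%:E)%E by rewrite lee_fin.
have n1 u O' : (0 <= lint mu2 (cross s O' u))%E by apply: lint_ge0; exact: cross_ge0.
have e00 : (0 <= e%:E)%E by rewrite lee_fin ltW.
have H3 : ((2^-1)%:E * lint mu2 (cross s O w) +
    (2^-1)%:E * lint mu2 (cross s (O_ n) (fun x => w_ n x - w x)%R) <=
    (2^-1)%:E * lint mu2 (cross s (O_ n) (w_ n)) + (e / 2)%:E)%E.
  have := lee_wpmul2l p0 H1.
  by rewrite (ge0_muleDr _ (n1 _ _) (n1 _ _)) (ge0_muleDr _ (n1 _ _) e00) -EFinM (mulrC _ e).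
rewrite addeACA; apply: (le_trans (leeD H3 H2)).
rewrite addeACA leeD2l// -EFinD lee_fin; lra.
Qed.

End profiles.

Section minimizing.
Context {R : realType} (N : nat) (s : R).
Local Notation X := 'rV[R]_N.
Local Notation mu := (lebesgue_rV N).
Implicit Types (O : set X) (u v w : X -> R).

Definition potential (Q : X -> R) (q : R) u : \bar R :=
  lint mu (fun x => Q x * `|u x| `^ q)%R.

Lemma potential_ge0 Q q u : (forall x, 0 <= Q x) -> (0 <= potential Q q u)%E.
Proof. by move=> Q0; apply: lint_ge0 => x; nn. Qed.

Lemma min1_powR_ge (t y a : R) : 0 < t <= 1 -> 0 <= y -> a <= y -> a <= 1 -> a <= y `^ t.
Proof.
move=> /andP[t0 t1] y0 ay a1; have [y1|/ltW y1] := leP y 1.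
  by apply: (le_trans ay); apply: le1_powR_ge => //; rewrite y0.
apply: (le_trans a1); rewrite -[leLHS](_ : 1 `^ t = 1) ?powR1//.
by have := powR_mono (ltW t0) ler01 y1; rewrite powR1.
Qed.

(** Splitting off the almost everywhere limit of a minimizing sequence: by the
Brezis-Lieb lemma the remainder carries the complementary fraction [1 - b] of
the constraint, hence costs at least [m * (1 - b)]. *)
Lemma minimizing_limit (q t m M : R) (O_ : nat -> set X) O (Q_ : nat -> X -> R) (Q : X -> R)
    (w_ : nat -> X -> R) w (e_ : nat -> R) :
  1 < q -> 0 < t <= 1 -> 0 <= m -> 0 <= M ->
  (forall n, measurable (O_ n)) -> measurable O ->
  (forall n, measurable_fun setT (w_ n)) -> measurable_fun setT w ->
  (forall n, measurable_fun setT (Q_ n)) -> measurable_fun setT Q ->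
  (forall n x, 0 <= Q_ n x) -> (forall x, 0 <= Q x) ->
  (forall n x, Q_ n x <= M * Q x) ->
  (forall x, Q_ n x @[n --> \oo] --> Q x) ->
  (forall n, O `<=` O_ n) -> (forall x, \forall n \near \oo, O_ n x -> O x) ->
  {ae mu, forall x, w_ n x @[n --> \oo] --> w x} ->
  e_ n @[n --> \oo] --> 0 ->
  (forall n, (Hs_norm2 s (O_ n) (w_ n) <= (m + e_ n)%:E)%E) ->
  (forall n, potential (Q_ n) q (w_ n) = 1%:E) ->
  (forall n v, measurable_fun setT v -> (Hs_norm2 s (O_ n) v < +oo)%E ->
    (potential (Q_ n) q v < +oo)%E /\
    ((m * fine (potential (Q_ n) q v) `^ t)%:E <= Hs_norm2 s (O_ n) v)%E) ->
  exists2 b, 0 <= b <= 1 & potential Q q w = b%:E /\ (Hs_norm2 s O w <= (m * b)%:E)%E.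
Proof.
move=> q1 t01 m0 M0 mO_ mO mw_ mw mQ_ mQ Q_0 Q0 QM QQ sub ev ww ee Sw Bw opt.
have [E HE] : exists E, forall n, e_ n <= E.
  have : cvgn e_ by apply/cvg_ex; exists 0.
  move=> /cvg_seq_bounded[E [_ HE]]; exists (E + 1) => n.
  by apply: le_trans (ler_norm _) _; apply: HE => //; rewrite ltrDl.
have SE n : (Hs_norm2 s (O_ n) (w_ n) <= (m + E)%:E)%E.
  by apply: le_trans (Sw n) _; rewrite lee_fin lerD2l.
have [Soo SBL] := Hs_brezis_lieb mO_ mO mw_ mw sub ev ww SE.
have [||B1 BBL] := @brezis_lieb _ _ R mu q M 1 Q_ w_ Q w q1 M0 mQ_ mQ mw_ mw Q_0 Q0 QM
  (aeW _ QQ).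
- by apply: filterS ww => x ?; right.
- by move=> n; rewrite -/(potential _ _ _) Bw.
have P0 := potential_ge0 q w Q0.
rewrite -/(potential Q q w) in B1.
have PE : potential Q q w = (fine (potential Q q w))%:E.
  by rewrite fineK// ge0_fin_numE// (le_lt_trans B1)// ltry.
set b := fine (potential Q q w) in PE.
have b0 : 0 <= b by rewrite fine_ge0.
have b1 : b <= 1 by rewrite -lee_fin -PE.
exists b; first by rewrite b0.
split=> //; apply/lee_addgt0Pr => e e0.
pose d := e / (m + 2).
have d0 : 0 < d by rewrite divr_gt0// ltr_wpDl.
have e_d : \forall n \near \oo, e_ n <= d by apply: (cvgr_le _ ee).
have [n [n1 [n2 n3]]] := filter_ex (filterI e_d (filterI (SBL d d0) (BBL d d0))).
have [_ n4] := n3.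
set v := fun x => w_ n x - w x in n2 *.
have mv : measurable_fun setT v by rewrite /v; have := mw_ n; move=> ?; mfun.
rewrite -/(potential _ _ _) Bw -/(potential _ _ w) -/(potential _ _ v) PE in n4.
have S0 := Hs_norm2_ge0 s O w; have Sv0 := Hs_norm2_ge0 s (O_ n) v.
have Stot : (Hs_norm2 s O w + Hs_norm2 s (O_ n) v <= (m + d + d)%:E)%E.
  by apply: le_trans n2 _; rewrite EFinD leeD2r// (le_trans (Sw n))// lee_fin lerD2l.
have Svoo : (Hs_norm2 s (O_ n) v < +oo)%E.
  by apply: le_lt_trans (ltry (m + d + d)); apply: le_trans Stot; rewrite leeDr.
have [Poo Hopt] := opt n v mv Svoo.
have y0 := potential_ge0 q v (Q_0 n).
have yE : potential (Q_ n) q v = (fine (potential (Q_ n) q v))%:E.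
  by rewrite fineK// ge0_fin_numE.
rewrite yE -!EFinD lee_fin in n4.
set y := fine _ in Hopt n4 yE.
have yp : 0 <= y by rewrite fine_ge0.
have low : 1 - b - d <= y `^ t.
  by apply: min1_powR_ge => //; lra.
have Slow : ((m * (1 - b - d))%:E <= Hs_norm2 s (O_ n) v)%E.
  by apply: le_trans Hopt; rewrite lee_fin ler_wpM2l.
have := le_trans (leeD (lexx (Hs_norm2 s O w)) Slow) Stot.
have -> : Hs_norm2 s O w = (fine (Hs_norm2 s O w))%:E.
  by rewrite fineK// ge0_fin_numE.
rewrite -!EFinD !lee_fin => H.
have : d * (m + 2) = e by rewrite /d divfK// gt_eqF// ltr_wpDl.
by nra.
Qed.

End minimizing.

Section levy.
Context {R : realType} (N : nat) (s : R).
Local Notation X := 'rV[R]_N.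
Local Notation mu := (lebesgue_rV N).
Local Notation K := (Defs.kernel s).
Hypotheses (s01 : 0 < s < 1).

Let s0 : 0 < s. Proof. by case/andP: s01. Qed.

Lemma measurable_rV_norm : measurable_fun [set: X] (fun x => `|x| : R).
Proof.
apply: (measurability _ (RGenInftyO.measurableE R)) => //.
move=> /= _ [_ [a ->] <-]; rewrite setTI.
have [a0|a0] := leP a 0.
  rewrite (_ : _ @^-1` _ = set0)//; apply/seteqP; split=> x //=.
  by rewrite in_itv/= => /(le_lt_trans (normr_ge0 x)) /lt_le_trans /(_ a0); rewrite ltxx.
rewrite (_ : _ @^-1` _ = cube 0 a); first exact: measurable_cube.
by rewrite cubeE//; apply/seteqP; split=> x /=; rewrite in_itv/= subr0.
Qed.

Definition shell (r : R) : set X := [set h | r <= `|h| < 2 * r].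

Lemma measurable_shell r : measurable (shell r).
Proof.
have := measurable_rV_norm measurableT (measurable_itv `[r, 2 * r[).
by rewrite setTI; congr measurable; apply/seteqP; split=> x /=; rewrite in_itv.
Qed.

Lemma measurable_kernel0 : measurable_fun setT (fun h : X => K (h, 0)).
Proof. exact: (measurableT_comp (@measurable_kernel R N s) (pair2_measurable (0 : X))). Qed.

Lemma shell_mass r : 0 < r ->
  (lint mu (fun h => \1_(shell r) h * K (h, 0))%R <= (4 ^+ N * r `^ (- (2 * s)))%:E)%E.
Proof.
move=> r0; have msh := measurable_shell r; have mK := measurable_kernel0.
have r2 : 0 < 2 * r by rewrite mulr_gt0.
pose C := (r `^ (N%:R + 2 * s))^-1; have C0 : 0 <= C by rewrite invr_ge0 powR_ge0.
apply: (@le_trans _ _ (lint mu (fun h => C * \1_(cube (0 : X) (2 * r)) h)%R)).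
  have mc := @measurable_cube R N 0 (2 * r).
  apply: lint_le; [by mfun|by mfun|by move=> h; rewrite mulr_ge0 ?kernel_ge0|].
  move=> h; have [sh|nsh] := pselect (shell r h); last by rewrite (indic_out _ nsh) mul0r; nn.
  have ch : cube 0 (2 * r) h by rewrite cubeE//= subr0; case/andP: sh.
  rewrite (indic_in _ sh) (indic_in _ ch) mul1r mulr1; apply: kernel_le => //.
  by rewrite subr0; case/andP: sh.
rewrite lintZ//; last by apply: measurable_indic; exact: measurable_cube.
rewrite lint_indic; last exact: measurable_cube.
have -> : 4 ^+ N * r `^ (- (2 * s)) = C * (2 * (2 * r)) ^+ N.
  rewrite /C powRD; last by rewrite (gt_eqF r0) implybT.
  rewrite powR_mulrn ?(ltW r0)// powRN mulrA -natrM exprMn; field.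
  by rewrite !gt_eqF ?powR_gt0 ?exprn_gt0.
by rewrite EFinM lee_wpmul2l ?lee_fin// cube_measure.
Qed.

Definition levy (h : X) : R := Num.min 1 (`|h| ^+ 2) * K (h, 0).

Lemma levy_ge0 h : 0 <= levy h.
Proof. by rewrite mulr_ge0 ?kernel_ge0// le_min ler01 sqr_ge0. Qed.

Lemma measurable_levy : measurable_fun setT levy.
Proof.
by have mK := measurable_kernel0; have mn := measurable_rV_norm; rewrite /levy; mfun.
Qed.

Let pw2 n : (2 : R) ^+ n > 0.
Proof. by rewrite exprn_gt0. Qed.

Lemma annulus_shells n (h : X) : mesh n <= `|h| < 2 ^+ n ->
  levy h <= \sum_(j < n) (\1_(shell (2 ^+ j)) h * K (h, 0)) +
    \sum_(j < n) 4 * mesh j.+1 ^+ 2 * (\1_(shell (mesh j.+1)) h * K (h, 0)).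
Proof.
have K0 := kernel_ge0 s (h, 0).
have t1 j : 0 <= \1_(shell (2 ^+ j)) h * K (h, 0) by nn.
have t2 j : 0 <= 4 * mesh j.+1 ^+ 2 * (\1_(shell (mesh j.+1)) h * K (h, 0)) by nn.
elim: n => [|n IH] /andP[h1 h2].
  by move: h1 h2; rewrite /mesh !expr0 => h1 /(le_lt_trans h1); rewrite ltxx.
rewrite !big_ord_recr/=.
set S1 := \sum_(_ < _) _; set S2 := \sum_(_ < _) _.
have S10 : 0 <= S1 by apply: sumr_ge0.
have S20 : 0 <= S2 by apply: sumr_ge0.
have [a1|a1] := leP (2 ^+ n) `|h|.
  have sh : shell (2 ^+ n) h by rewrite /shell/= a1/= -exprS.
  have u1 : levy h <= K (h, 0) by rewrite /levy ler_piMl// ge_min lexx.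
  have := t2 n; rewrite (indic_in _ sh) mul1r => u2; lra.
have [a2|a2] := leP (mesh n) `|h|.
  have := IH; rewrite a2 a1 => /(_ isT); rewrite -/S1 -/S2.
  by have u1 := t1 n; have u2 := t2 n => u3; lra.
have m2 : mesh n = 2 * mesh n.+1 :> R by rewrite /mesh exprS mulrA mulfV// mul1r.
have sh : shell (mesh n.+1) h by rewrite /shell/= h1/= -m2.
have H : levy h <= 4 * mesh n.+1 ^+ 2 * K (h, 0).
  rewrite /levy; apply: ler_wpM2r => //; rewrite ge_min; apply/orP; right.
  have -> : 4 * mesh n.+1 ^+ 2 = mesh n ^+ 2 :> R by rewrite m2; ring.
  by rewrite lerXn2r ?nnegrE// ltW// mesh_gt0.
by have u1 := t1 n; rewrite (indic_in _ sh) mul1r; lra.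
Qed.

(** The kernel is a Levy measure density: quadratically integrable near the
diagonal because [s < 1] and integrable at infinity because [0 < s]. *)
Lemma levy_lty : (lint mu levy < +oo)%E.
Proof.
have mK := measurable_kernel0; have K0 h := kernel_ge0 s (h, 0 : X).
pose sg : R := 2^-1 `^ (2 - 2 * s).
have half : 0 < (2^-1 : R) by rewrite invr_gt0.
have e0 : 0 < 2 - 2 * s.
  by case/andP: s01 => _ s1; rewrite subr_gt0 -[ltRHS]mulr1 ltr_pM2l.
have sg0 : 0 < sg by rewrite powR_gt0.
have sg1 : sg < 1.
  by rewrite /sg -(@powR_inv1 R 2)// -powRrM mulN1r powRN invf_lt1 ?powR_gt0// powR_gt1// ltr1n.
have t0 := @tau_gt0 R s; have t1 := tau_lt1 s0.
pose C := 4 ^+ N * (1 - tau s)^-1 + 4 * 4 ^+ N * (1 - sg)^-1.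
pose ann n := [set h : X | mesh n <= `|h| < 2 ^+ n].
have mann n : measurable (ann n).
  have := measurable_rV_norm measurableT (measurable_itv `[mesh n, 2 ^+ n[).
  by rewrite setTI; congr measurable; apply/seteqP; split=> x /=; rewrite in_itv.
have mlevy := measurable_levy.
apply: (@le_lt_trans _ _ C%:E); last exact: ltry.
apply: (@lint_fatou_cst _ _ _ _ (fun n h => \1_(ann n) h * levy h)).
- by move=> n; mfun.
- by [].
- by move=> n h; rewrite mulr_ge0 ?indic_ge0 ?levy_ge0.
- apply: aeW => h; apply: cvg_near_cst.
  have [->|h0] := eqVneq h 0.
    by apply: nearW => n; rewrite /levy normr0 expr0n/= minEle ler10/= mul0r mulr0.
  have n0 : 0 < `|h| by rewrite normr_gt0.
  have two1 : 1 < 2 :> R by rewrite ltr1n.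
  have [n1 Hn1] := expr_unbounded (`|h| + 1) two1.
  have [n2 Hn2] := expr_unbounded (`|h|^-1) two1.
  exists (maxn n1 n2) => // m /=; rewrite geq_max => /andP[m1 m2].
  rewrite indic_in ?mul1r//; apply/andP; split.
    rewrite /mesh exprVn -[leRHS]invrK lef_pV2 ?posrE ?invr_gt0//.
    by apply: (le_trans Hn2); rewrite ler_weXn2l// ltW.
  apply: (@lt_le_trans _ _ (`|h| + 1)); first by rewrite ltrDl.
  by apply: (le_trans Hn1); rewrite ler_weXn2l// ltW.
move=> n.
have m1 (j : 'I_n) : measurable_fun setT (fun h : X => \1_(shell (2 ^+ j)) h * K (h, 0)).
  by have := @measurable_shell (2 ^+ j); move=> ?; mfun.
have m2 (j : 'I_n) : measurable_fun setT (fun h : X =>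
    4 * mesh j.+1 ^+ 2 * (\1_(shell (mesh j.+1)) h * K (h, 0))).
  by have := @measurable_shell (mesh j.+1); move=> ?; mfun.
apply: (@le_trans _ _ (lint mu (fun h => \sum_(j < n) (\1_(shell (2 ^+ j)) h * K (h, 0)) +
    \sum_(j < n) 4 * mesh j.+1 ^+ 2 * (\1_(shell (mesh j.+1)) h * K (h, 0)))%R)).
  apply: lint_le; [by mfun| | |].
  - by apply: measurable_funD; exact: measurable_sum.
  - by move=> h; rewrite mulr_ge0 ?indic_ge0 ?levy_ge0.
  move=> h; have [ah|nah] := pselect (ann n h).
    by rewrite (indic_in _ ah) mul1r; exact: annulus_shells.
  by rewrite (indic_out _ nah) mul0r; apply: addr_ge0; apply: sumr_ge0 => j _; nn.
rewrite lintD; [|exact: measurable_sum|exact: measurable_sum| |]; last 2 first.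
- by move=> h; apply: sumr_ge0 => j _; nn.
- by move=> h; apply: sumr_ge0 => j _; nn.
rewrite !lint_sum//; [|by move=> j h; nn|by move=> j h; nn].
rewrite EFinD; apply: leeD.
  apply: (@le_trans _ _ (\sum_(j < n) (4 ^+ N * tau s ^+ j)%:E)%E).
    apply: lee_sum => j _; apply: (le_trans (shell_mass (pw2 j))).
    rewrite lee_fin ler_pM2l ?exprn_gt0// le_eqVlt; apply/orP; left; apply/eqP.
    rewrite /tau -powR_mulrn// -powRrM -(@powR_inv1 R 2)// -powRrM.
    rewrite -[RHS]powR_mulrn ?powR_ge0// -powRrM; congr (_ `^ _); ring.
  rewrite sumEFin lee_fin -mulr_sumr ler_pM2l ?exprn_gt0//.
  by apply: geometric_sum_le; rewrite (ltW t0).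
apply: (@le_trans _ _ (\sum_(j < n) (4 * 4 ^+ N * sg ^+ j)%:E)%E).
  apply: lee_sum => j _; have mp := mesh_gt0 (R := R) j.+1.
  have msh := measurable_shell (mesh j.+1).
  rewrite lintZ; [|by mfun|by move=> h; nn|by nn].
  apply: (@le_trans _ _ ((4 * mesh j.+1 ^+ 2)%:E *
    (4 ^+ N * mesh j.+1 `^ (- (2 * s)))%:E)%E).
    apply: lee_wpmul2l; first by rewrite lee_fin; nn.
    exact: shell_mass.
  rewrite -EFinM lee_fin.
  have -> : 4 * mesh j.+1 ^+ 2 * (4 ^+ N * mesh j.+1 `^ (- (2 * s))) =
     4 * 4 ^+ N * (mesh j.+1 ^+ 2 * mesh j.+1 `^ (- (2 * s))) by ring.
  rewrite ler_pM2l ?mulr_gt0 ?exprn_gt0//.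
  have -> : mesh j.+1 ^+ 2 * mesh j.+1 `^ (- (2 * s)) = sg ^+ j.+1 :> R.
    rewrite -powR_mulrn ?(ltW mp)// -powRD; last by rewrite (gt_eqF mp) implybT.
    by rewrite mesh_powR.
  by rewrite ler_wiXn2l// ltW.
rewrite sumEFin lee_fin -mulr_sumr ler_pM2l ?mulr_gt0 ?exprn_gt0//.
by apply: geometric_sum_le; rewrite (ltW sg0).
Qed.

End levy.

Section balayage.
Context {R : realType} (N : nat) (s : R).
Local Notation X := 'rV[R]_N.
Local Notation mu := (lebesgue_rV N).
Local Notation mu2 := (lebesgue_rV N \x lebesgue_rV N)%E.
Local Notation K := (Defs.kernel s).
Hypotheses (s01 : 0 < s < 1).

Let s0 : 0 < s. Proof. by case/andP: s01. Qed.

Lemma measurable_kernel_slice x : measurable_fun setT (fun y : X => K (x, y)).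
Proof. exact: (measurable_slice1 (@measurable_kernel R N s)). Qed.

Lemma kernel_tail (x : X) (r : R) : 0 < r ->
  (lint mu (fun y => \1_(~` cube x r) y * K (x, y))%R < +oo)%E.
Proof.
move=> r0; have mK := measurable_kernel_slice x.
have mc := measurableC (measurable_cube x r).
pose c : R := Num.min 1 (r ^+ 2).
have c0 : 0 < c by rewrite lt_min ltr01 exprn_gt0.
have mt : measurable_fun setT (fun y : X => levy s (y - x)).
  exact: (measurable_fun_translate (- x) (@measurable_levy R N s)).
have l0 (y : X) := levy_ge0 s (y - x).
apply: (@le_lt_trans _ _ (lint mu (fun y => c^-1 * levy s (y - x))%R)).
  apply: lint_le; [by mfun|by mfun|by move=> y; rewrite mulr_ge0 ?indic_ge0 ?kernel_ge0|].
  move=> y; have [nc|yc] := pselect ((~` cube x r) y); last first.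
    by rewrite (indic_out _ yc) mul0r mulr_ge0// invr_ge0 ltW.
  rewrite (indic_in _ nc) mul1r /levy mulrA.
  have -> : K (y - x, 0) = K (x, y).
    by rewrite kernelC -{1}(subrr x) kernelD.
  rewrite ler_peMl ?kernel_ge0//.
  have ry : r <= `|y - x|.
    by rewrite leNgt; apply/negP => h; apply: nc; rewrite cubeE.
  rewrite mulrC ler_pdivlMr// mul1r /c le_min; apply/andP; split.
    by rewrite ge_min lexx.
  by rewrite ge_min; apply/orP; right; rewrite lerXn2r ?nnegrE// ltW.
rewrite lintZ//; last by rewrite invr_ge0 ltW.
rewrite (lint_translate (- x) (@measurable_levy R N s) (levy_ge0 s)).
by apply: lte_mul_pinfty; rewrite ?lee_fin ?invr_ge0 ?(ltW c0)//; exact: levy_lty.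
Qed.

Variable O : set X.
Implicit Types (u : X -> R) (x y : X).
Hypotheses (oO : open O) (ext0 : (0 < mu (~` O))%E).

Let mO : measurable O. Proof. exact: measurable_open_rV. Qed.
Let mOc : measurable (~` O). Proof. exact: measurableC. Qed.

Definition ext_kernel (x y : X) : R := \1_(~` O) y * K (x, y).
Local Notation kx := ext_kernel.
Definition kappa (x : X) : R := fine (lint mu (kx x)).

(** The value inside [O] of least energy for the given exterior values; it
realizes the nonlocal Neumann condition. *)
Definition balayage (u : X -> R) (x : X) : R :=
  if x \in O then fine (lint mu (fun y => kx x y * u y)%R) / kappa x else u x.

Lemma measurable_ext_kernel2 : measurable_fun setT (fun z : X * X => kx z.1 z.2).
Proof.
have mi : measurable_fun setT (\1_(~` O) : X -> R) by mfun.
have mK := @measurable_kernel R N s.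
rewrite /kx; apply: measurable_mulr_set.
  exact: (measurableT_comp mi measurable_snd).
by rewrite (_ : (fun z => _) = K)//; apply/funext => -[].
Qed.

Lemma measurable_ext_kernel x : measurable_fun setT (kx x).
Proof. exact: (measurable_slice1 measurable_ext_kernel2). Qed.

Lemma ext_kernel_ge0 x y : 0 <= kx x y.
Proof. by rewrite mulr_ge0 ?indic_ge0 ?kernel_ge0. Qed.

Lemma measurable_kappa : measurable_fun setT kappa.
Proof.
apply: (measurableT_comp (@fine_measurable R setT measurableT)).
apply: (@measurable_lint_snd _ _ X X R mu (fun z => kx z.1 z.2)).
  exact: measurable_ext_kernel2.
by move=> z; exact: ext_kernel_ge0.
Qed.

Lemma measurable_balayage u : measurable_fun setT u -> (forall x, 0 <= u x) ->
  measurable_fun setT (balayage u).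
Proof.
move=> mu_ u0.
have mk := measurable_kappa; have mi : measurable_fun setT (\1_O : X -> R) by mfun.
have mI : measurable_fun setT (fun x => fine (lint mu (fun y => kx x y * u y)%R)).
  apply: (measurableT_comp (@fine_measurable R setT measurableT)).
  apply: (@measurable_lint_snd _ _ X X R mu (fun z => kx z.1 z.2 * u z.2)).
    by have m2 := measurable_ext_kernel2; mfun.
  by move=> z; rewrite mulr_ge0// ext_kernel_ge0.
rewrite (_ : balayage u = (fun x => \1_O x * (fine (lint mu (fun y => kx x y * u y)%R) / kappa x)
    + (1 - \1_O x) * u x)); first by mfun.
apply/funext => x; rewrite /balayage indicE; case: ifP => _.
  by rewrite mul1r subrr mul0r addr0.
by rewrite mul0r subr0 mul1r add0r.
Qed.

Lemma balayage_ge0 u x : (forall x, 0 <= u x) -> 0 <= balayage u x.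
Proof.
move=> u0; rewrite /balayage; case: ifP => // _; rewrite divr_ge0 ?fine_ge0 ?lint_ge0//.
  by move=> y; rewrite mulr_ge0// ext_kernel_ge0.
by move=> y; exact: ext_kernel_ge0.
Qed.

Lemma balayage_out u x : ~ O x -> balayage u x = u x.
Proof. by move=> nO; rewrite /balayage memNset. Qed.

Lemma ext_kernel_bound x : O x -> exists2 M, 0 <= M & forall y, kx x y <= M * \1_(~` O) y.
Proof.
move=> Ox; have [r r0 rO] := open_cube oO Ox.
exists (r `^ (N%:R + 2 * s))^-1; first by rewrite invr_ge0 powR_ge0.
move=> y; have [nO|yO] := pselect ((~` O) y); last by rewrite /kx (indic_out _ yO) mul0r mulr0.
rewrite /kx (indic_in _ nO) mul1r mulr1; apply: kernel_le => //.
by rewrite leNgt; apply/negP => h; apply: nO; apply: rO; rewrite cubeE//= distrC.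
Qed.

Lemma ext_kernel_lty x : O x -> (0 < lint mu (kx x) < +oo)%E.
Proof.
move=> Ox; have mk := measurable_ext_kernel x; have k0 := ext_kernel_ge0 x.
apply/andP; split; last first.
  have [r r0 rO] := open_cube oO Ox.
  apply: le_lt_trans (kernel_tail x r0).
  have mK := measurable_kernel_slice x; have mc := measurableC (measurable_cube x r).
  apply: lint_le => //; first by mfun.
  move=> y; rewrite /kx; apply: ler_wpM2r; first exact: kernel_ge0.
  by apply: indicC_le.
rewrite lt_neqAle lint_ge0// andbT eq_sym; apply/eqP => /(lint_eq0 _ mk k0) H.
move: ext0; rewrite -(lint_indic mu mOc) (_ : lint _ _ = 0%E) ?ltxx//.
apply/lint_eq0; [by mfun|by move=> y; exact: indic_ge0|].
apply: filterS H => y; rewrite /kx; have [nO|yO] := pselect ((~` O) y); last first.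
  by rewrite (indic_out _ yO).
move=> /eqP; rewrite (indic_in _ nO) mul1r gt_eqF//; apply: kernel_gt0.
by apply/eqP => xy; apply: nO; rewrite -xy.
Qed.

Lemma kappa_gt0 x : O x -> 0 < kappa x.
Proof. by move=> Ox; rewrite fine_gt0// ext_kernel_lty. Qed.

Lemma lint_kappa x : O x -> lint mu (kx x) = (kappa x)%:E.
Proof.
move=> Ox; have /andP[h1 h2] := ext_kernel_lty Ox.
by rewrite fineK// ge0_fin_numE// ltW.
Qed.

Lemma ext_kernel_sqr_lty x u : O x -> measurable_fun setT u ->
  (lint mu (mass O u) < +oo)%E -> (lint mu (fun y => kx x y * u y ^+ 2)%R < +oo)%E.
Proof.
move=> Ox mu_ uoo; have [M M0 HM] := ext_kernel_bound Ox.
have mk := measurable_ext_kernel x; have k0 := ext_kernel_ge0 x.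
have mm := measurable_mass mO mu_; have m0 := mass_ge0 O u.
apply: (@le_lt_trans _ _ (lint mu (fun y => M * mass O u y)%R)).
  apply: lint_le; [by mfun|by mfun|by move=> y; rewrite mulr_ge0 ?sqr_ge0|].
  by move=> y; rewrite /mass [leRHS]mulrA; apply: ler_wpM2r; rewrite ?sqr_ge0.
by rewrite lintZ//; apply: lte_mul_pinfty.
Qed.

Lemma ext_kernel2_lty x : O x -> (lint mu (fun y => kx x y ^+ 2)%R < +oo)%E.
Proof.
move=> Ox; have [M M0 HM] := ext_kernel_bound Ox.
have mk := measurable_ext_kernel x; have k0 := ext_kernel_ge0 x.
apply: (@le_lt_trans _ _ (lint mu (fun y => M * kx x y)%R)).
  apply: lint_le; [by mfun|by mfun|by move=> y; exact: sqr_ge0|].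
  move=> y; rewrite expr2; apply: ler_wpM2r => //; apply: le_trans (HM y) _.
  by rewrite ler_piMr// indic_le1.
by rewrite lintZ//; apply: lte_mul_pinfty; rewrite ?lee_fin// lint_kappa// ltry.
Qed.

Definition inner u (x : X) : \bar R := lint mu (fun y => kx x y * (u x - u y) ^+ 2)%R.

Lemma measurable_inner u : measurable_fun setT u -> measurable_fun setT (inner u).
Proof.
move=> mu_; have mk := measurable_ext_kernel2.
apply: (@measurable_lint_snd _ _ X X R mu (fun z => kx z.1 z.2 * (u z.1 - u z.2) ^+ 2)).
  by mfun.
by move=> z; rewrite mulr_ge0 ?sqr_ge0// ext_kernel_ge0.
Qed.

Lemma inner_ge0 u x : (0 <= inner u x)%E.
Proof. by apply: lint_ge0 => y; rewrite mulr_ge0 ?sqr_ge0// ext_kernel_ge0. Qed.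

Lemma Hs_norm2_split u : measurable_fun setT u -> Hs_norm2 s O u =
  ((2^-1)%:E * lint mu2 (gagl s (~` O) u) + \int[mu]_x ((\1_O x)%:E * inner u x) +
   lint mu (mass O u))%E.
Proof.
move=> mu_; rewrite Hs_norm2E; congr (_ + _)%E.
have mk := measurable_ext_kernel2.
have mi : measurable_fun setT (\1_O : X -> R) by mfun.
have mG := measurable_gagl s mOc mu_; have G0 := gagl_ge0 s (~` O) u.
pose F (z : X * X) := \1_O z.1 * (kx z.1 z.2 * (u z.1 - u z.2) ^+ 2).
have F0 z : 0 <= F z.
  by rewrite /F mulr_ge0 ?indic_ge0// mulr_ge0 ?sqr_ge0// ext_kernel_ge0.
have mF : measurable_fun setT F by rewrite /F; mfun.
have msw : measurable_fun setT (fun z : X * X => F (z.2, z.1)).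
  apply: (measurableT_comp mF).
  by apply/measurable_fun_pairP; split; [exact: measurable_snd|exact: measurable_fst].
have -> : cross s O u = (fun z => gagl s (~` O) u z + (F z + F (z.2, z.1))).
  apply/funext => -[x y]; rewrite /cross /interaction /gagl /F /kx/=.
  have sq : (u y - u x) ^+ 2 = (u x - u y) ^+ 2 by rewrite -sqrrN opprB.
  rewrite (kernelC s y x) sq !indicE !in_setC in_setX.
  by case: (x \in O); case: (y \in O); rewrite /= ?(mul0r, mulr0, mul1r, mulr1, add0r, addr0) // mulrC.
rewrite lintD//; [|by mfun|by move=> z; rewrite addr_ge0].
rewrite lintD// (lint_swap mu mF F0).
have IE : lint mu2 F = (\int[mu]_x ((\1_O x)%:E * inner u x))%E.
  rewrite lint_tonelli1//; apply: eq_integral => x _.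
  rewrite /inner -lintZ ?indic_ge0//.
    have : measurable_fun setT (fun z : X * X => kx z.1 z.2 * (u z.1 - u z.2) ^+ 2) by mfun.
    by move=> /measurable_slice1; exact.
  by move=> y; rewrite mulr_ge0 ?sqr_ge0// ext_kernel_ge0.
have I0 : (0 <= lint mu2 F)%E by exact: lint_ge0.
have g0 : (0 <= lint mu2 (gagl s (~` O) u))%E by exact: lint_ge0.
rewrite (ge0_muleDr _ g0 (adde_ge0 I0 I0)); congr (_ + _)%E; rewrite -IE.
rewrite (ge0_muleDr _ I0 I0) -ge0_muleDl ?lee_fin// -EFinD.
by rewrite (_ : 2^-1 + 2^-1 = 1 :> R) ?mul1e//; field.
Qed.

Lemma balayage_gain u : measurable_fun setT u -> (forall x, 0 <= u x) ->
  (lint mu (mass O u) < +oo)%E ->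
  Hs_norm2 s O u = (Hs_norm2 s O (balayage u) +
    lint mu (fun x => \1_O x * ((u x - balayage u x) ^+ 2 * kappa x))%R)%E.
Proof.
move=> mu_ u0 uoo; have mb := measurable_balayage mu_ u0.
have mi : measurable_fun setT (\1_O : X -> R) by mfun.
have mk := measurable_kappa.
have k0 x : 0 <= kappa x by rewrite fine_ge0// lint_ge0// => y; exact: ext_kernel_ge0.
rewrite !Hs_norm2_split//.
have -> : gagl s (~` O) (balayage u) = gagl s (~` O) u.
  apply/funext => -[x y]; rewrite /gagl/=.
  have [xO|nx] := pselect (O x); first by rewrite [\1_(~` O) x]indic_out ?mul0r//; apply.
  have [yO|ny] := pselect (O y).
    by rewrite [\1_(~` O) y]indic_out ?mul0r ?mulr0//; apply.
  by rewrite !balayage_out.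
have -> : mass O (balayage u) = mass O u.
  apply/funext => x; rewrite /mass.
  have [xO|nx] := pselect (O x); first by rewrite indic_out ?mul0r//; apply.
  by rewrite balayage_out.
rewrite [RHS]addeAC; congr (_ + _)%E; rewrite -addeA; congr (_ + _)%E.
rewrite [lint mu _]/lint -ge0_integralD//; first last.
- by mfun.
- by move=> x _; rewrite lee_fin mulr_ge0 ?indic_ge0// mulr_ge0 ?sqr_ge0.
- by apply: emeasurable_funM; [mfun|exact: measurable_inner].
- by move=> x _; rewrite mule_ge0 ?lee_fin ?indic_ge0 ?inner_ge0.
apply: eq_integral => x _; have [xO|nx] := pselect (O x); last first.
  by rewrite (indic_out _ nx) !mul0e mul0r add0e.
rewrite (indic_in _ xO) !mul1e mul1r.
have := @weighted_variance _ X R mu (kx x) u (u x) (measurable_ext_kernel x) mu_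
  (ext_kernel_ge0 x) u0 (ext_kernel_lty xO) (ext_kernel_sqr_lty xO mu_ uoo).
rewrite /inner => ->; rewrite -/(kappa x).
have bE : balayage u x = fine (lint mu (fun y => kx x y * u y)%R) / kappa x.
  by rewrite /balayage mem_set.
rewrite -bE; congr (_ + _)%E; congr lint; apply/funext => y.
rewrite /kx; have [yO|ny] := pselect (O y); first by rewrite indic_out ?mul0r//; apply.
by rewrite (balayage_out u ny).
Qed.

End balayage.

Section lint_dist.
Context d (T : measurableType d) (R : realType) (mu : {measure set T -> \bar R}).

Lemma lint_dist_le (f g : T -> R) (e : R) : measurable_fun setT f -> measurable_fun setT g ->
  (forall x, 0 <= f x) -> (forall x, 0 <= g x) ->
  (lint mu f < +oo)%E -> (lint mu g < +oo)%E ->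
  (lint mu (fun x => `|f x - g x|)%R <= e%:E)%E ->
  `|fine (lint mu f) - fine (lint mu g)| <= e.
Proof.
move=> mf mg f0 g0 fi gi; wlog H : f g mf mg f0 g0 fi gi /
    fine (lint mu g) <= fine (lint mu f).
  move=> wl he; have [fg|/ltW fg] := leP (fine (lint mu g)) (fine (lint mu f)).
    exact: wl.
  rewrite distrC; apply: wl => //.
  by rewrite (_ : (fun x => _) = (fun x => `|f x - g x|))//; apply/funext => x; rewrite distrC.
move=> he; rewrite ger0_norm ?subr_ge0// lerBlDr addrC -lee_fin EFinD.
have e1 : lint mu f = (fine (lint mu f))%:E by rewrite fineK// ge0_fin_numE// lint_ge0.
have e2 : lint mu g = (fine (lint mu g))%:E by rewrite fineK// ge0_fin_numE// lint_ge0.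
rewrite -e1 -e2; apply: (@le_trans _ _ (lint mu g + lint mu (fun x => `|f x - g x|)%R)%E).
  rewrite -lintD; try side.
  apply: lint_le; try side.
  by move=> x; have := ler_norm (f x - g x); lra.
exact: leeD2l.
Qed.

(** A measurable limit function for a sequence converging almost everywhere on
a measurable set. *)
Lemma ae_limit (E : set T) (f_ : nat -> T -> R) : measurable E ->
  (forall n, measurable_fun setT (f_ n)) -> (forall n x, 0 <= f_ n x) ->
  {ae mu, forall x, E x -> cvgn (fun n => f_ n x)} ->
  exists w : T -> R, [/\ measurable_fun setT w, forall x, 0 <= w x,
    (forall x, ~ E x -> w x = 0) &
    {ae mu, forall x, E x -> f_ n x @[n --> \oo] --> w x}].
Proof.
move=> mE mf f0 [A [mA A0 HA]].
pose B := E `&` ~` A.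
have mB : measurable B by apply: measurableI => //; exact: measurableC.
pose g n x := \1_B x * f_ n x.
have cg x : cvgn (fun n => g n x).
  have [Bx|nB] := pselect (B x); last first.
    rewrite (_ : (fun n => _) = fun=> 0); first exact: is_cvg_cst.
    by apply/funext => n; rewrite /g (indic_out _ nB) mul0r.
  rewrite (_ : (fun n => _) = (fun n => f_ n x)); last first.
    by apply/funext => n; rewrite /g (indic_in _ Bx) mul1r.
  case: Bx => Ex nA; apply/not_notP => nc; apply: nA; apply: HA => /= h.
  by apply: nc; exact: h.
exists (fun x => limn (fun n => g n x)); split.
- apply: (@measurable_fun_cvg _ _ _ setT g) => [n|x _]; first by rewrite /g; mfun.
  exact: cg.
- move=> x; apply: limr_ge; first exact: cg.
  by apply: nearW => n; rewrite /g mulr_ge0// indic_ge0.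
- move=> x nE; apply/cvg_lim => //; rewrite (_ : (fun n => _) = fun=> 0); first exact: cvg_cst.
  by apply/funext => n; rewrite /g indic_out ?mul0r// => -[].
- exists A; split=> // x /= nH; apply/not_notP => nA; apply: nH => Ex.
  have Bx : B x by [].
  rewrite (_ : (fun n => f_ n x) = (fun n => g n x)); first exact: cg.
  by apply/funext => n; rewrite /g (indic_in _ Bx) mul1r.
Qed.

End lint_dist.

Section balayage_limits.
Context {R : realType} (N : nat) (s : R).
Local Notation X := 'rV[R]_N.
Local Notation mu := (lebesgue_rV N).
Hypotheses (s01 : 0 < s < 1).
Variable O : set X.
Hypotheses (oO : open O) (ext0 : (0 < mu (~` O))%E).
Implicit Types (u : X -> R) (x y : X).

Let mO : measurable O. Proof. exact: measurable_open_rV. Qed.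
Let mOc : measurable (~` O). Proof. exact: measurableC. Qed.

Lemma balayage_cvg (w_ : nat -> X -> R) (w : X -> R) (c : R) x :
  (forall n, measurable_fun setT (w_ n)) -> measurable_fun setT w ->
  (forall n y, 0 <= w_ n y) -> (forall y, 0 <= w y) ->
  {ae mu, forall y, (~` O) y -> w_ n y @[n --> \oo] --> w y} ->
  (forall n, (lint mu (mass O (w_ n)) <= c%:E)%E) -> O x ->
  balayage s O (w_ n) x @[n --> \oo] --> balayage s O w x.
Proof.
move=> mw_ mw w_0 w0 ww wc Ox.
have mk := measurable_ext_kernel s oO x; have k0 := @ext_kernel_ge0 R N s O x.
have mi : measurable_fun setT (\1_(~` O) : X -> R) by mfun.
pose f n y := \1_(~` O) y * w_ n y; pose g y := \1_(~` O) y * w y.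
have mf n : measurable_fun setT (f n) by rewrite /f; mfun.
have mg : measurable_fun setT g by rewrite /g; mfun.
have sqE u : (fun y => (\1_(~` O) y * u y) ^+ 2) = mass O u.
  apply/funext => y; rewrite /mass exprMn; congr (_ * _).
  by rewrite indicE; case: (_ \in _); rewrite ?expr1n ?expr0n.
have fg : {ae mu, forall y, f n y @[n --> \oo] --> g y}.
  apply: filterS ww => y H; rewrite /f /g; have [Oy|nO] := pselect ((~` O) y).
    by apply: cvgM; [exact: cvg_cst|exact: H].
  by rewrite (indic_out _ nO); under eq_fun do rewrite mul0r; rewrite mul0r; exact: cvg_cst.
have fc n : (lint mu (fun y => f n y ^+ 2)%R <= c%:E)%E by rewrite sqE.
have W := ae_cvg_weak mf mg mk k0 fg fc (ext_kernel2_lty s01 oO ext0 Ox).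
have kk u : (fun y => ext_kernel s O x y * (\1_(~` O) y * u y)) =
   (fun y => ext_kernel s O x y * u y).
  apply/funext => y; rewrite /ext_kernel indicE; case: (_ \in _) => /=;
    by rewrite ?mul1r ?mul0r.
have gc : (lint mu (mass O w) <= c%:E)%E.
  rewrite -sqE; apply: (@lint_fatou_cst _ _ _ _ (fun n y => f n y ^+ 2)) => //.
  - by move=> n; have := mf n; move=> ?; mfun.
  - by mfun.
  - by nn.
  - by apply: filterS fg => y h; exact: cvgM.
have fin u : measurable_fun setT u -> (forall y, 0 <= u y) ->
    (lint mu (mass O u) <= c%:E)%E ->
    (lint mu (fun y => ext_kernel s O x y * u y)%R < +oo)%E.
  move=> mu_ u0 uc; apply: lint_weight_lty => //.
    by have /andP[] := ext_kernel_lty s01 oO ext0 Ox.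
  by apply: ext_kernel_sqr_lty => //; apply: le_lt_trans uc _; exact: ltry.
have bE u : balayage s O u x =
    fine (lint mu (fun y => ext_kernel s O x y * u y)%R) / kappa s O x.
  by rewrite /balayage mem_set.
rewrite bE; under eq_fun do rewrite bE.
apply: cvgM; last exact: cvg_cst.
apply/cvgrPdist_le => e e0; apply: filterS (W e e0) => n He.
rewrite distrC; apply: lint_dist_le; [by have := mw_ n; move=> ?; mfun|by mfun| | | | |].
- by move=> y; rewrite mulr_ge0.
- by move=> y; rewrite mulr_ge0.
- exact: fin.
- exact: fin.
apply: le_trans He; rewrite le_eqVlt; apply/orP; left; apply/eqP; congr lint.
apply/funext => y; rewrite /f /g -mulrBr -mulrBr (normrM (ext_kernel s O x y)).
rewrite (ger0_norm (k0 y)) (normrM (\1_(~` O) y)) (ger0_norm (indic_ge0 _ _ _)).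
rewrite /ext_kernel indicE.
by case: (_ \in _); rewrite /= ?mul1r ?mul0r// mulrC.
Qed.

Lemma balayage_le u : measurable_fun setT u -> (forall x, 0 <= u x) ->
  (lint mu (mass O u) < +oo)%E -> (Hs_norm2 s O (balayage s O u) <= Hs_norm2 s O u)%E.
Proof.
move=> mu_ u0 uoo; rewrite (balayage_gain s01 oO ext0 mu_ u0 uoo) leeDl//.
apply: lint_ge0 => x; rewrite mulr_ge0 ?indic_ge0// mulr_ge0 ?sqr_ge0//.
by rewrite fine_ge0// lint_ge0// => y; exact: ext_kernel_ge0.
Qed.

(** A function vanishing in [O] but not outside strictly loses energy when its
values in [O] are relaxed: the relaxed values are positive. *)
Lemma balayage_lt u : O !=set0 -> measurable_fun setT u -> (forall x, 0 <= u x) ->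
  (Hs_norm2 s O u < +oo)%E -> {ae mu, forall x, O x -> u x = 0} ->
  ~ {ae mu, forall x, u x = 0} ->
  (Hs_norm2 s O (balayage s O u) < Hs_norm2 s O u)%E.
Proof.
move=> [x0 Ox0] mu_ u0 uoo uO unz.
have [_ moo] := (Hs_norm2_ltyP _ _ _).1 uoo.
have mb := measurable_balayage s oO mu_ u0.
have mi : measurable_fun setT (\1_O : X -> R) by mfun.
have mk := measurable_kappa s oO.
have k0 x : 0 <= kappa s O x.
  by rewrite fine_ge0// lint_ge0// => y; exact: ext_kernel_ge0.
have := balayage_gain s01 oO ext0 mu_ u0 moo.
set G := lint mu _; set S' := Hs_norm2 s O (balayage s O u) => SE.
have G0 : (0 <= G)%E.
  by apply: lint_ge0 => x; rewrite mulr_ge0 ?indic_ge0// mulr_ge0 ?sqr_ge0.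
have [GZ|GN] := eqVneq G 0%E; last first.
  have S'0 : (0 <= S')%E by exact: Hs_norm2_ge0.
  have Gp : (0 < G)%E by rewrite lt_neqAle eq_sym GN.
  have S'f : S' \is a fin_num.
    rewrite ge0_fin_numE//; apply: le_lt_trans uoo; rewrite SE leeDl//.
  by rewrite SE lteDl.
exfalso.
have H : {ae mu, forall x, \1_O x * ((u x - balayage s O u x) ^+ 2 * kappa s O x) = 0}.
  apply/lint_eq0; [by mfun| |exact: GZ].
  by move=> x; rewrite mulr_ge0 ?indic_ge0// mulr_ge0 ?sqr_ge0.
have pos x : O x -> 0 < balayage s O u x.
  move=> Ox; rewrite /balayage mem_set// divr_gt0 ?(kappa_gt0 s01)//.
  have mkx := measurable_ext_kernel s oO x; have kx0 := @ext_kernel_ge0 R N s O x.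
  have p0 y : 0 <= ext_kernel s O x y * u y by rewrite mulr_ge0.
  rewrite fine_gt0//; apply/andP; split; last first.
    apply: lint_weight_lty => //; first by have /andP[] := ext_kernel_lty s01 oO ext0 Ox.
    exact: ext_kernel_sqr_lty.
  rewrite lt_neqAle lint_ge0// andbT eq_sym; apply/eqP => Z; apply: unz.
  have := (lint_eq0 mu (_ : measurable_fun setT _) p0).1 Z => /(_ ltac:(by mfun)).
  apply: filterS2 uO => y uOy.
  have [Oy|nO] := pselect (O y); first by move=> _; exact: uOy.
  rewrite /ext_kernel indic_in// mul1r => /eqP; rewrite mulf_eq0 => /orP[|/eqP//].
  rewrite gt_eqF// kernel_gt0//; apply/eqP => xy; apply: nO; by rewrite -xy.
have : mu O = 0%E.
  rewrite -(lint_indic mu mO); apply/lint_eq0; [by mfun|by move=> x; exact: indic_ge0|].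
  apply: filterS2 uO H => x uOx; have [Ox|nO] := pselect (O x); last first.
    by rewrite (indic_out _ nO).
  move=> /eqP; rewrite (indic_in _ Ox) mul1r mulf_eq0 (gt_eqF (kappa_gt0 s01 oO ext0 Ox)) orbF.
  by rewrite sqrf_eq0 uOx// sub0r oppr_eq0 gt_eqF// pos.
have [r r0 rO] := open_cube oO Ox0.
apply/eqP; rewrite gt_eqF//; apply: (@lt_le_trans _ _ (mu (cube x0 r))).
  by rewrite cube_measure// lte_fin exprn_gt0// mulr_gt0.
by apply: le_measure; rewrite ?inE//; exact: measurable_cube.
Qed.

End balayage_limits.

Section embedding.
Context {R : realType} (N : nat) (s : R).
Local Notation X := 'rV[R]_N.
Local Notation mu := (lebesgue_rV N).
Local Notation mu2 := (lebesgue_rV N \x lebesgue_rV N)%E.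
Hypotheses (s0 : 0 < s) (sN : 2 * s < N%:R).

Lemma rho_lt1 (p : R) : 1 < p < (N%:R + 2 * s) / (N%:R - 2 * s) -> rho N s (p + 1) < 1.
Proof.
move=> /andP[p1 p2]; have d0 : 0 < N%:R - 2 * s by rewrite subr_gt0.
move: p2; rewrite ltr_pdivlMr// => p2.
have tE : tau s = 2 `^ (- 1 * (2 * s)) :> R by rewrite /tau -(@powR_inv1 R 2)// -powRrM.
rewrite /rho tE /beta -powRrM -powRD; last first.
  by rewrite pnatr_eq0 implybT.
set e := _ + _.
have e0 : e < 0.
  have -> : e = (p * (N%:R - 2 * s) - (N%:R + 2 * s)) / 2 by rewrite /e; field.
  by rewrite pmulr_llt0// subr_lt0.
rewrite -[e]opprK powRN invf_lt1 ?powR_gt0//.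
by apply: powR_gt1; rewrite ?ltr1n// oppr_gt0.
Qed.

Definition thick (c : R) (D : set X) : Prop :=
  forall x r, D x -> 0 < r <= 1 -> ((c * r ^+ N)%:E <= mu (D `&` cube x r))%E.

Variable q : R.
Hypotheses (q2 : 2 < q) (rho1 : rho N s q < 1).

Implicit Types (u : X -> R).

Section fixed_set.
Variables (c : R) (D : set X).
Hypotheses (mD : measurable D) (c0 : 0 < c) (tD : thick c D).

Lemma gagl_abs_le u : measurable_fun setT u ->
  (lint mu2 (gagl s D (fun x => `|u x|)%R) <= lint mu2 (gagl s D u))%E.
Proof.
move=> mu_; have ma : measurable_fun setT (fun x : X => `|u x|) by mfun.
apply: lint_le; [exact: measurable_gagl|exact: measurable_gagl|exact: gagl_ge0|].
move=> z; rewrite /gagl; do 2 (apply: ler_wpM2l; first exact: indic_ge0).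
apply: ler_wpM2r; first exact: kernel_ge0.
rewrite -[leLHS]ger0_norm ?sqr_ge0// -[leRHS]ger0_norm ?sqr_ge0//.
by rewrite !normrX lerXn2r ?nnegrE// ler_dist_dist.
Qed.

Lemma sobolev : exists2 C, 0 <= C & forall u A, measurable_fun setT u -> 0 <= A ->
  (lint mu (fun x => \1_D x * u x ^+ 2)%R <= (A ^+ 2)%:E)%E ->
  (lint mu2 (gagl s D u) <= (A ^+ 2)%:E)%E ->
  (lint mu (fun x => \1_D x * `|u x| `^ q)%R <= (C * A `^ q)%:E)%E.
Proof.
have Ca0 := Cavg_gt0 sN c0.
exists ((2 * Cavg N s c) `^ (q - 2) + Csob N s c q).
  by rewrite addr_ge0 ?powR_ge0// Csob_ge0.
move=> u A mu_ A0 uE uG.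
have ma : measurable_fun setT (fun x : X => `|u x|) by mfun.
have n0 (x : X) : 0 <= `|u x| by [].
have aE : (lint mu (fun x => \1_D x * `|u x| ^+ 2)%R <= (A ^+ 2)%:E)%E.
  apply: le_trans uE; rewrite le_eqVlt; apply/orP; left; apply/eqP; congr lint.
  by apply/funext => x; rewrite -normrX ger0_norm ?sqr_ge0.
have aG := le_trans (gagl_abs_le mu_) uG.
have mi : measurable_fun setT (\1_D : X -> R) by mfun.
have [A00|An] := eqVneq A 0.
  have q0 : q != 0 by rewrite gt_eqF// (lt_trans _ q2).
  rewrite A00 powR0// mulr0.
  have Z : lint mu (fun x => \1_D x * u x ^+ 2)%R = 0%E.
    apply/eqP; rewrite eq_le; apply/andP; split; last by apply: lint_ge0; nn.
    by apply: (le_trans uE); rewrite A00 expr0n.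
  rewrite (_ : lint _ _ = 0%E)//; apply/lint_eq0; [by mfun|by nn|].
  have mm : measurable_fun setT (fun x : X => \1_D x * u x ^+ 2) by mfun.
  have n2 (x : X) : 0 <= \1_D x * u x ^+ 2 by nn.
  have H := (lint_eq0 mu mm n2).1 Z.
  apply: filterS H => x /eqP; rewrite mulf_eq0 sqrf_eq0 => /orP[/eqP ->|/eqP ->]; first by rewrite mul0r.
  by rewrite normr0 powR0// mulr0.
have Ap : 0 < A by rewrite lt0r An.
have dl0 : 0 <= Cavg N s c * A by rewrite mulr_ge0// ltW.
have b0 x : D x -> cavg D (fun x => `|u x|) 0 (cell 0 x) <= Cavg N s c * A.
  move=> Dx; rewrite -[leRHS]mulr1 -(expr0 (beta N s)).
  exact: (cavg_le s0 sN mD c0 tD ma n0 A0 aE aG).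
have := sobolev_level s0 sN mD c0 tD ma n0 A0 aE aG q2 rho1 Ap dl0 b0.
move=> H; apply: le_trans H _.
rewrite lee_fin expr0 mulr1 [leRHS]mulrDl lerD2r (powR_sub2 q2 A0).
have -> : (2 * (Cavg N s c * A)) `^ (q - 2) = (2 * Cavg N s c) `^ (q - 2) * A `^ (q - 2).
  by rewrite mulrA (@powRM _ (2 * Cavg N s c))// mulr_ge0// ltW.
by rewrite -mulrA.
Qed.

(** If the local averages at every fixed scale become uniformly small along a
bounded sequence, its [L^q] norms tend to zero; contrapositively, some scale
and some threshold detect non-vanishing uniformly. *)
Lemma nonvanishing (kp A : R) : 0 < kp -> 0 <= A -> exists k dl, 0 < dl /\
  forall u, measurable_fun setT u -> (forall x, 0 <= u x) ->
  (lint mu (fun x => \1_D x * u x ^+ 2)%R <= (A ^+ 2)%:E)%E ->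
  (lint mu2 (gagl s D u) <= (A ^+ 2)%:E)%E ->
  (kp%:E <= lint mu (fun x => \1_D x * `|u x| `^ q)%R)%E ->
  exists2 x, D x & dl < cavg D u k (cell k x).
Proof.
move=> kp0 A0'; pose A' := A + 1.
have Ap : 0 < A' by rewrite ltr_wpDl.
have A0 : 0 <= A' by exact: ltW.
have AA : A ^+ 2 <= A' ^+ 2 by rewrite lerXn2r ?nnegrE// lerDl.
have q20 : 0 < q - 2 by rewrite subr_gt0.
have r0 := rho_gt0 sN q.
have C0 := Csob_ge0 c0 rho1.
set C := Csob N s c q in C0.
have ri : 1 < (rho N s q)^-1 by rewrite invf_gt1.
pose E := C * A' `^ q.
have E0 : 0 <= E by rewrite mulr_ge0 ?powR_ge0.
have [j Hj] := expr_unbounded ((E + 1) * 4 / kp) ri.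
pose dl := (kp / (4 * A' ^+ 2)) `^ (q - 2)^-1 / 2.
have A2 : 0 < A' ^+ 2 by rewrite exprn_gt0.
have x0 : 0 < kp / (4 * A' ^+ 2) by rewrite divr_gt0// mulr_gt0.
have dl0 : 0 < dl by rewrite divr_gt0// powR_gt0.
exists j, dl; split=> // u mu_ u0 uE uG uq.
apply/not_notP => no.
have b0 x : D x -> cavg D u j (cell j x) <= dl.
  by move=> Dx; rewrite leNgt; apply/negP => h; apply: no; exists x.
have uE' := le_trans uE (_ : (A ^+ 2)%:E <= (A' ^+ 2)%:E)%E.
have uG' := le_trans uG (_ : (A ^+ 2)%:E <= (A' ^+ 2)%:E)%E.
have := sobolev_level s0 sN mD c0 tD mu_ u0 A0 (uE' _) (uG' _) q2 rho1 Ap (ltW dl0) b0.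
rewrite !lee_fin => /(_ AA AA).
rewrite (_ : lint mu _ = lint mu (fun x => \1_D x * `|u x| `^ q)%R); last first.
  by congr lint; apply/funext => x; rewrite ger0_norm.
move=> /(le_trans uq); rewrite lee_fin; apply/negP; rewrite -ltNge.
have -> : (2 * dl) `^ (q - 2) * A' ^+ 2 = kp / 4.
  rewrite /dl (mulrC 2) divfK// -powRrM mulVf ?gt_eqF// powRr1 ?(ltW x0)//.
  by field; rewrite gt_eqF.
have : Csob N s c q * rho N s q ^+ j * A' `^ q <= kp / 4.
  rewrite mulrAC -/C -/E.
  have rj : 0 < rho N s q ^+ j by rewrite exprn_gt0.
  rewrite -ler_pdivlMr//.
  apply: (@le_trans _ _ (kp / 4 * ((E + 1) * 4 / kp))).
    have -> : kp / 4 * ((E + 1) * 4 / kp) = E + 1 by field; rewrite gt_eqF.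
    by rewrite lerDl.
  by rewrite ler_pM2l ?divr_gt0// -exprVn.
move=> h; apply: le_lt_trans (lerD (lexx _) h) _.
by rewrite -mulrDr -mulr2n -[X in X < _]mulr1; move: kp0 => *; lra.
Qed.

End fixed_set.

Lemma thick_shift c D y : measurable D -> thick c D -> thick c (shift y D).
Proof.
move=> mD tD x r Dx r01; apply: le_trans (tD (x + y) r Dx r01) _.
rewrite -(lebesgue_rV_translate y); last by apply: measurableI => //; exact: measurable_cube.
rewrite le_eqVlt; apply/orP; left; apply/eqP; congr (lebesgue_rV N _).
apply/seteqP; split=> z /= -[Dz cz]; split => // i; have := cz i; rewrite !mxE.
  by rewrite opprD addrACA subrr addr0.
by rewrite opprD addrACA subrr addr0.
Qed.

End embedding.

Section best_constant.
Context {R : realType} (N : nat) (s : R).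
Local Notation X := 'rV[R]_N.
Local Notation mu := (lebesgue_rV N).
Local Notation mu2 := (lebesgue_rV N \x lebesgue_rV N)%E.
Implicit Types (u v : X -> R) (x y : X).
Hypotheses (s01 : 0 < s < 1) (sN : 2 * s < N%:R).

Let s0 : 0 < s. Proof. by case/andP: s01. Qed.

Variable q : R.
Hypotheses (q2 : 2 < q) (rho1 : rho N s q < 1).

Let q0 : 0 < q. Proof. exact: lt_trans q2. Qed.

Lemma sqrt_powR (a : R) : 0 <= a -> Num.sqrt a `^ q = a `^ (q / 2).
Proof. by move=> a0; rewrite -powR12_sqrt// -powRrM mulrC. Qed.

Variables (O : set X) (c : R).
Hypotheses (oO : open O) (ext0 : (0 < mu (~` O))%E) (c0 : 0 < c).
Hypotheses (tO : thick c O) (tE : thick c (~` O)).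

Let mO : measurable O. Proof. exact: measurable_open_rV. Qed.
Let mOc : measurable (~` O). Proof. exact: measurableC. Qed.

Lemma Hs_norm2_parts u (a : R) : measurable_fun setT u -> 0 <= a ->
  (Hs_norm2 s O u <= a%:E)%E ->
  (lint mu (mass O u) <= (Num.sqrt (2 * a) ^+ 2)%:E)%E /\
  (lint mu2 (gagl s (~` O) u) <= (Num.sqrt (2 * a) ^+ 2)%:E)%E.
Proof.
move=> mu_ a0; rewrite (Hs_norm2_split s oO mu_) => H.
have a2 : 0 <= 2 * a by rewrite mulr_ge0.
rewrite sqr_sqrtr//.
have g0 : (0 <= lint mu2 (gagl s (~` O) u))%E by apply: lint_ge0; exact: gagl_ge0.
have i0 : (0 <= \int[mu]_x ((\1_O x)%:E * inner s O u x))%E.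
  by apply: integral_ge0 => x _; rewrite mule_ge0 ?lee_fin ?indic_ge0 ?inner_ge0.
have m0 : (0 <= lint mu (mass O u))%E by apply: lint_ge0; exact: mass_ge0.
have h0 : (0 <= (2^-1 : R)%:E)%E by rewrite lee_fin.
have hg0 := mule_ge0 h0 g0.
split.
  apply: (@le_trans _ _ a%:E); last by rewrite lee_fin ler_peMl// ler1n.
  by apply: le_trans H; rewrite leeDr// adde_ge0.
have : ((2^-1)%:E * lint mu2 (gagl s (~` O) u) <= a%:E)%E.
  by apply: le_trans H; rewrite -addeA leeDl// adde_ge0.
have t0 : (0 <= (2 : R)%:E)%E by rewrite lee_fin.
by move=> /(lee_wpmul2l t0); rewrite muleA -!EFinM mulfV// mul1e.
Qed.

Variables (Q : X -> R) (Qm : R).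
Hypotheses (mQ : measurable_fun setT Q) (Q0 : forall x, 0 <= Q x).
Hypotheses (QO : forall x, O x -> Q x = 0) (QQm : forall x, Q x <= Qm).

Let Qm0 : 0 <= Qm. Proof. exact: le_trans (Q0 0) (QQm 0). Qed.

Local Notation S := (Hs_norm2 s O).
Local Notation B := (potential Q q).

Lemma potential_le_ext u : measurable_fun setT u ->
  (B u <= Qm%:E * lint mu (fun x => \1_(~` O) x * `|u x| `^ q)%R)%E.
Proof.
move=> mu_; rewrite -lintZ; try side.
apply: lint_le; [by mfun|by mfun|by nn|].
move=> x; rewrite mulrA; apply: ler_wpM2r; first exact: powR_ge0.
have [Ox|nO] := pselect (O x); first by rewrite QO// mulr_ge0 ?indic_ge0.
by rewrite indic_in// mulr1.
Qed.

Lemma potential_sobolev : exists2 C, 0 < C & forall u a, measurable_fun setT u -> 0 <= a ->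
  (S u <= a%:E)%E -> (B u <= (C * a `^ (q / 2))%:E)%E.
Proof.
have [C C0 HC] := sobolev s0 sN q2 rho1 mOc c0 tE.
exists (Qm * (C * 2 `^ (q / 2)) + 1) => [|u a mu_ a0 Sa].
  by rewrite ltr_wpDl// !mulr_ge0// powR_ge0.
have [H1 H2] := Hs_norm2_parts mu_ a0 Sa.
apply: (le_trans (potential_le_ext mu_)).
have := HC u _ mu_ (sqrtr_ge0 _) H1 H2.
rewrite sqrt_powR ?mulr_ge0// powRM// => H.
apply: (@le_trans _ _ (Qm%:E * (C * (2 `^ (q / 2) * a `^ (q / 2)))%:E)%E).
  by apply: lee_wpmul2l; rewrite ?lee_fin.
rewrite -EFinM lee_fin mulrDl mul1r [C * (_ * _)]mulrA [Qm * (_ * _)]mulrA lerDl.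
exact: powR_ge0.
Qed.

Lemma potential_lty u : measurable_fun setT u -> (S u < +oo)%E -> (B u < +oo)%E.
Proof.
move=> mu_ Soo; have [C _ HC] := potential_sobolev.
have S0 := Hs_norm2_ge0 s O u.
have SE : S u = (fine (S u))%:E by rewrite fineK// ge0_fin_numE.
apply: le_lt_trans (ltry (C * fine (S u) `^ (q / 2))).
by apply: HC => //; rewrite ?fine_ge0// -SE.
Qed.

Lemma potentialZ u t : measurable_fun setT u -> 0 <= t ->
  B (fun x => t * u x)%R = ((t `^ q)%:E * B u)%E.
Proof.
move=> mu_ t0; rewrite /potential -lintZ; try side.
congr lint; apply/funext => x; rewrite normrM powRM// (ger0_norm t0).
by rewrite mulrCA.
Qed.

Hypothesis testfun : exists u, [/\ measurable_fun setT u, (S u < +oo)%E & (0 < B u)%E].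

Local Notation th := (2 / q).

Lemma th01 : 0 < th <= 1.
Proof. by rewrite divr_gt0//= ler_pdivrMr// mul1r ltW. Qed.

Definition levels : set R := [set r | exists u,
  [/\ measurable_fun setT u, S u = r%:E & B u = 1%:E]].

Lemma normalize_level u : measurable_fun setT u -> (S u < +oo)%E -> (0 < B u)%E ->
  levels (fine (S u) / fine (B u) `^ th).
Proof.
move=> mu_ Soo B0; have Boo := potential_lty mu_ Soo.
have S0 := Hs_norm2_ge0 s O u.
have SE : S u = (fine (S u))%:E by rewrite fineK// ge0_fin_numE.
have BE : B u = (fine (B u))%:E by rewrite fineK// ge0_fin_numE// ltW.
set b := fine (B u) in BE *; have b0 : 0 < b by rewrite fine_gt0// B0.
pose t := b `^ (- q^-1); have t0 : 0 < t by rewrite powR_gt0.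
exists (fun x => t * u x); split; first by mfun.
  rewrite Hs_norm2Z// SE -EFinM; congr EFin; rewrite mulrC; congr (_ * _).
  by rewrite /t -powR_mulrn ?powR_ge0// -powRrM -powRN; congr (_ `^ _); rewrite mulNr mulrC.
rewrite potentialZ ?(ltW t0)// BE -EFinM; congr EFin.
by rewrite /t -powRrM mulNr mulVf ?gt_eqF// powR_inv1 ?(ltW b0)// mulVf// gt_eqF.
Qed.

Lemma levels_inf : has_inf levels.
Proof.
split; last first.
  exists 0 => r [u [_ Sr _]]; rewrite -lee_fin -Sr; exact: Hs_norm2_ge0.
have [u [mu_ Soo B0]] := testfun.
by exists (fine (S u) / fine (B u) `^ th); exact: normalize_level.
Qed.

Definition best : R := inf levels.

Lemma best_gt0 : 0 < best.
Proof.
have [C C0 HC] := potential_sobolev.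
apply: (@lt_le_trans _ _ (C^-1 `^ th)); first by rewrite powR_gt0// invr_gt0.
apply: lb_le_inf; first by case: levels_inf.
move=> r [u [mu_ Sr Br]].
have r0 : 0 <= r by rewrite -lee_fin -Sr; exact: Hs_norm2_ge0.
have := HC u r mu_ r0; rewrite Sr Br lee_fin => /(_ (lexx _)) H.
have H1 : C^-1 <= r `^ (q / 2) by rewrite -[C^-1]mul1r ler_pdivrMr// mulrC.
have /andP[t0 _] := th01.
have Ci : 0 <= C^-1 by rewrite invr_ge0 ltW.
have := powR_mono (ltW t0) Ci H1.
by rewrite -[in leRHS]powRrM (_ : q / 2 * th = 1) ?powRr1//; field; rewrite gt_eqF.
Qed.

Lemma best_le v : measurable_fun setT v -> (S v < +oo)%E ->
  (B v < +oo)%E /\ ((best * fine (B v) `^ th)%:E <= S v)%E.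
Proof.
move=> mv Soo; have Boo := potential_lty mv Soo; split=> //.
have S0 := Hs_norm2_ge0 s O v; have B0 := potential_ge0 q v Q0.
have SE : S v = (fine (S v))%:E by rewrite fineK// ge0_fin_numE.
have [BZ|Bn] := eqVneq (B v) 0%E.
  by rewrite BZ /= powR0 ?mulr0// gt_eqF//; case/andP: th01.
have Bp : (0 < B v)%E by rewrite lt0e Bn.
have b0 : 0 < fine (B v) by rewrite fine_gt0// Bp.
rewrite SE lee_fin -ler_pdivlMr ?powR_gt0//.
apply: inf_lbound; first by case: levels_inf.
exact: normalize_level.
Qed.

Lemma best_approx e : 0 < e -> exists u, [/\ measurable_fun setT u,
  (S u <= (best + e)%:E)%E & B u = 1%:E].
Proof.
move=> e0; have [r [u [mu_ Su Bu]] re] := inf_adherent e0 levels_inf.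
by exists u; split=> //; rewrite Su lee_fin ltW.
Qed.

End best_constant.

Lemma small_power_gap (R : realType) (K0 K1 r : R) : 0 <= K0 -> 0 <= K1 -> 1 < r ->
  exists2 e, 0 < e & forall h, 0 < h <= e -> K0 * h `^ r < h /\ K1 * h `^ r < 1.
Proof.
move=> K00 K10 r1; have r10 : 0 < r - 1 by rewrite subr_gt0.
pose k := (K0 + K1 + 1) * 2.
have k1 : 1 <= k by rewrite /k; lra.
have k0 : 0 < k by exact: lt_le_trans k1.
exists (k^-1 `^ (r - 1)^-1); first by rewrite powR_gt0// invr_gt0.
move=> h /andP[h0 hk].
have hr : h `^ (r - 1) <= k^-1.
  have := powR_mono (ltW r10) (ltW h0) hk.
  by rewrite -[in leRHS]powRrM mulVf ?gt_eqF// powRr1// invr_ge0 ltW.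
have kh : k * h `^ (r - 1) <= 1 by rewrite -ler_pdivlMl// mulr1.
have h1 : h <= 1.
  have a1 : 0 <= (r - 1)^-1 by rewrite invr_ge0 ltW.
  have a2 : 0 <= k^-1 by rewrite invr_ge0 ltW.
  have a3 : k^-1 <= 1 by rewrite invf_le1.
  by apply: (le_trans hk); have := powR_mono a1 a2 a3; rewrite powR1.
have p0 := powR_gt0 (r - 1) h0.
rewrite (powR_subM1 r1 (ltW h0)).
set x := h `^ (r - 1) in kh p0 *.
have kx : (K0 + K1 + 1) * x < 1 by move: kh; rewrite /k; nra.
have K0x := mulr_ge0 K00 (ltW p0); have K1x := mulr_ge0 K10 (ltW p0).
have a0 : K0 * x < 1 by lra.
have a1 : K1 * x <= 1 by lra.
rewrite !mulrA; split; first by rewrite -[ltRHS]mul1r ltr_pM2r.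
have a2 : K1 * x < 1 by lra.
by apply: le_lt_trans a2; rewrite ler_piMr.
Qed.

Section escape.
Context {R : realType} (N : nat) (s : R).
Local Notation X := 'rV[R]_N.
Local Notation mu := (lebesgue_rV N).
Local Notation mu2 := (lebesgue_rV N \x lebesgue_rV N)%E.
Implicit Types (u v w : X -> R) (x y : X).
Hypotheses (s01 : 0 < s < 1) (sN : 2 * s < N%:R).

Let s0 : 0 < s. Proof. by case/andP: s01. Qed.

Variable q : R.
Hypotheses (q2 : 2 < q) (rho1 : rho N s q < 1).

Let q0 : 0 < q. Proof. exact: lt_trans q2. Qed.

Variables (O : set X) (c r0 : R).
Hypotheses (oO : open O) (ext0 : (0 < mu (~` O))%E) (c0 : 0 < c) (nO : O !=set0).
Hypotheses (tO : thick c O) (tE : thick c (~` O)) (bO : forall x, O x -> `|x| <= r0).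

Let mO : measurable O. Proof. exact: measurable_open_rV. Qed.

Variables (Q : X -> R) (Qm Qt : R).
Hypotheses (mQ : measurable_fun setT Q) (Q0 : forall x, 0 <= Q x).
Hypotheses (QO : forall x, O x -> Q x = 0) (QQm : forall x, Q x <= Qm).
Hypotheses (Qt0 : 0 < Qt) (QQt : forall x, ~ O x -> Qt <= Q x).

Local Notation S := (Hs_norm2 s O).
Local Notation B := (potential Q q).
Local Notation th := (2 / q).
Hypothesis testfun : exists u, [/\ measurable_fun setT u, (S u < +oo)%E & (0 < B u)%E].

Local Notation m := (best s q O Q).
Let m0 : 0 < m.
Proof. exact: (best_gt0 s01 sN q2 rho1 oO c0 tE mQ Q0 QO QQm testfun). Qed.

Definition inside u : \bar R :=
  ((2^-1)%:E * lint mu2 (gagl s O u) + lint mu (fun x => \1_O x * u x ^+ 2)%R)%E.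

Lemma Hs_norm2_inside u : measurable_fun setT u ->
  Hs_norm2 s set0 u = (S u + inside u)%E.
Proof.
move=> mu_; rewrite !Hs_norm2E /inside.
have mi : measurable_fun setT (\1_O : X -> R) by mfun.
have mc := measurable_cross s mO mu_; have mm := measurable_mass mO mu_.
have mg := measurable_gagl s mO mu_.
have c0' := cross_ge0 s O u; have g0 := gagl_ge0 s O u; have ms0 := mass_ge0 O u.
have -> : cross s set0 u = (fun z => cross s O u z + gagl s O u z).
  apply/funext => -[x y]; rewrite /cross /interaction /gagl/= !indicE !in_setC !in_setX.
  rewrite !in_set0; case: (x \in O); case: (y \in O); rewrite /=; ring.
have -> : mass set0 u = (fun x => mass O u x + \1_O x * u x ^+ 2).
  apply/funext => x; rewrite /mass !indicE !in_setC !in_set0.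
  by case: (x \in O) => /=; ring.
rewrite !lintD//; [|by mfun|by nn].
rewrite ge0_muleDr ?lint_ge0//.
by rewrite addeACA.
Qed.

Lemma inside_ge0 u : (0 <= inside u)%E.
Proof.
rewrite /inside adde_ge0 ?mule_ge0 ?lee_fin// lint_ge0//; first exact: gagl_ge0.
by nn.
Qed.

Lemma inside_small w (e : R) : measurable_fun setT w -> (Hs_norm2 s set0 w < +oo)%E -> 0 < e ->
  exists y, (inside (fun x => w (x + y))%R <= e%:E)%E.
Proof.
move=> mw woo e0.
have [h1 h2] := (Hs_norm2_ltyP _ _ _).1 woo.
pose z (n : nat) : X := const_mx n%:R.
have N0 : (0 < N)%N by rewrite -(ltr0n R) (N_gt0 s0 sN).
have zn n : n%:R <= `|z n| :> R.
  have := coord_le_norm (z n) (Ordinal N0); rewrite mxE; apply: le_trans.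
  exact: ler_norm.
have out x : \forall n \near \oo, ~ shift (z n) O x.
  exists (Num.bound `|r0 + `|x| |) => // n /= nb Oz.
  have b1 : r0 + `|x| < n%:R.
    apply: (le_lt_trans (ler_norm _)); apply: (lt_le_trans (archi_boundP (normr_ge0 _))).
    by rewrite ler_nat.
  have h3 := ler_normD (x + z n) (- x); rewrite normrN addrAC subrr add0r in h3.
  have h4 := bO Oz; have h5 := zn n.
  have := le_lt_trans (le_trans h5 (le_trans h3 (lerD h4 (lexx _)))) b1.
  by rewrite ltxx.
have mz n : measurable (shift (z n) O) by exact: measurable_shift.
pose G n := gagl s (shift (z n) O) w.
pose L n (x : X) := \1_(shift (z n) O) x * w x ^+ 2.
have mG n : measurable_fun setT (G n) by exact: measurable_gagl.
have mL n : measurable_fun setT (L n) by have := mz n; move=> ?; rewrite /L; mfun.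
have tG n : lint mu2 (gagl s O (fun x => w (x - z n))%R) = lint mu2 (G n).
  have mw' := measurable_fun_translate (- z n) mw.
  rewrite -(lint2_translate (z n) (measurable_gagl s mO mw') (gagl_ge0 _ _ _)).
  congr lint; apply/funext => -[a b]; rewrite /G /gagl/= !addrK !indic_shift.
  by rewrite kernelD.
have tL n : lint mu (fun x => \1_O x * w (x - z n) ^+ 2)%R = lint mu (L n).
  have mw' := measurable_fun_translate (- z n) mw.
  have m1 : measurable_fun setT (fun x : X => \1_O x * w (x - z n) ^+ 2) by mfun.
  rewrite -(lint_translate (z n) m1); last by nn.
  by congr lint; apply/funext => x; rewrite /L addrK indic_shift.
have cE : \forall n \near \oo, (lint mu2 (G n) <= e%:E)%E.
  apply: (@lint_dct0 _ _ _ _ G (cross s set0 w)) => //.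
  - exact: measurable_cross.
  - by move=> n; exact: gagl_ge0.
  - move=> n x; rewrite /G /gagl /cross /interaction mulrA.
    have -> : \1_(~` (set0 `*` set0)) x = 1 :> R by rewrite indic_in// => -[].
    rewrite mul1r [leRHS]mulrC; apply: ler_piMl.
      by rewrite mulr_ge0 ?sqr_ge0 ?kernel_ge0.
    by apply: mulr_ile1; rewrite ?indic_ge0 ?indic_le1.
  - apply: aeW => x; apply: cvg_near_cst; apply: filterS (out x.1) => n h.
    by rewrite /G /gagl indic_out// mul0r.
have lE : \forall n \near \oo, (lint mu (L n) <= (e / 2)%:E)%E.
  apply: (@lint_dct0 _ _ _ _ L (mass set0 w)) => //.
  - exact: measurable_mass.
  - by rewrite /L; nn.
  - move=> n x; rewrite /L /mass; apply: ler_wpM2r; first exact: sqr_ge0.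
    by rewrite (_ : \1_(~` set0) x = 1 :> R) ?indic_le1// indic_in.
  - apply: aeW => x; apply: cvg_near_cst; apply: filterS (out x) => n h.
    by rewrite /L indic_out// mul0r.
  - by rewrite divr_gt0.
have [n [H1 H2]] := filter_ex (filterI cE lE).
exists (- z n); rewrite /inside tG tL.
have h0 : (0 <= (2^-1 : R)%:E)%E by rewrite lee_fin.
apply: (le_trans (leeD (lee_wpmul2l h0 H1) H2)).
rewrite -EFinM -EFinD lee_fin; lra.
Qed.

(** Beyond the obstacle there is room for improvement: a profile of the
problem on the whole space, moved far away from [O], would beat the best
constant, because the energy saved inside [O] is of lower order than the
potential lost there; if nothing is saved, relaxing the values in [O] gains. *)
Lemma no_escaping_profile w b : measurable_fun setT w -> (forall x, 0 <= w x) ->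
  0 < b -> lint mu (fun x => Qt * `|w x| `^ q)%R = b%:E ->
  ~ (Hs_norm2 s set0 w <= (m * b `^ th)%:E)%E.
Proof.
move=> mw w0 b0 wb Sw.
have woo : (Hs_norm2 s set0 w < +oo)%E by apply: le_lt_trans Sw (ltry _).
have /andP[t0 t1] := th01 q2.
have [C C0 HC] := sobolev s0 sN q2 rho1 mO c0 tO.
pose Ch := Qt * C * 2 `^ (q / 2).
have Ch0 : 0 <= Ch by rewrite !mulr_ge0 ?powR_ge0// ltW.
have bt0 : 0 < b `^ th by exact: powR_gt0.
pose K0 := m * b `^ th * (Ch / b).
have K00 : 0 <= K0 by rewrite !mulr_ge0 ?invr_ge0// ltW.
have K10 : 0 <= Ch / b by rewrite divr_ge0// ltW.
have q21 : 1 < q / 2 by rewrite ltr_pdivlMr// mul1r.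
have [e e0 He] := small_power_gap K00 K10 q21.
have [y Hy] := inside_small mw woo e0.
pose u x := w (x + y).
have mu_ : measurable_fun setT u by exact: measurable_fun_translate.
have u0 x : 0 <= u x by exact: w0.
have Su : (S u + inside u <= (m * b `^ th)%:E)%E.
  rewrite -Hs_norm2_inside//; apply: le_trans Sw.
  have := @Hs_norm2_translate R N s y set0 w measurable0 mw.
  by rewrite (_ : shift y set0 = set0)// => ->.
have ub : lint mu (fun x => Qt * `|u x| `^ q)%R = b%:E.
  rewrite -wb; apply: (@lint_translate R N y (fun x => Qt * `|w x| `^ q)); first by mfun.
  by nn.
have mi : measurable_fun setT (\1_O : X -> R) by mfun.
have i0 := inside_ge0 u; have Su0 := Hs_norm2_ge0 s O u.
have Soo : (S u < +oo)%E.
  by apply: le_lt_trans (ltry (m * b `^ th)); apply: le_trans Su; rewrite leeDl.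
have iE : inside u = (fine (inside u))%:E.
  by rewrite fineK// ge0_fin_numE//; apply: le_lt_trans Hy (ltry _).
set h := fine (inside u) in iE.
have h0 : 0 <= h by rewrite fine_ge0.
have he : h <= e by rewrite -lee_fin -iE.
have SE : S u = (fine (S u))%:E by rewrite fineK// ge0_fin_numE.
have [Boo Hopt] := best_le s01 sN q2 rho1 oO c0 tE mQ Q0 QO QQm testfun mu_ Soo.
have B0 := potential_ge0 q u Q0.
have BE : B u = (fine (B u))%:E by rewrite fineK// ge0_fin_numE.
have lossE : (b%:E <= B u + Qt%:E * lint mu (fun x => \1_O x * `|u x| `^ q)%R)%E.
  rewrite -ub /potential -lintZ; try side; rewrite -lintD; try side.
  apply: lint_le; try side.
  move=> x; have [Ox|nOx] := pselect (O x).
    by rewrite QO// mul0r add0r (indic_in _ Ox) mul1r.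
  rewrite (indic_out _ nOx) mul0r mulr0 addr0; apply: ler_wpM2r; first exact: powR_ge0.
  exact: QQt.
have g1 : (0 <= lint mu2 (gagl s O u))%E by apply: lint_ge0; exact: gagl_ge0.
have l1 : (0 <= lint mu (fun x => \1_O x * u x ^+ 2)%R)%E by apply: lint_ge0; nn.
have half0 : (0 <= (2^-1 : R)%:E)%E by rewrite lee_fin.
have two0 : (0 <= (2 : R)%:E)%E by rewrite lee_fin.
have A2 : Num.sqrt (2 * h) ^+ 2 = 2 * h by rewrite sqr_sqrtr// mulr_ge0.
have lh : (lint mu (fun x => \1_O x * u x ^+ 2)%R <= h%:E)%E.
  by rewrite -iE /inside leeDr// mule_ge0.
have gh : (lint mu2 (gagl s O u) <= (2 * h)%:E)%E.
  have : ((2^-1)%:E * lint mu2 (gagl s O u) <= h%:E)%E by rewrite -iE /inside leeDl.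
  by move=> /(lee_wpmul2l two0); rewrite muleA -!EFinM mulfV// mul1e.
have lh2 : (lint mu (fun x => \1_O x * u x ^+ 2)%R <= (2 * h)%:E)%E.
  by apply: (le_trans lh); rewrite lee_fin; lra.
have := HC u (Num.sqrt (2 * h)) mu_ (sqrtr_ge0 _); rewrite A2 => /(_ lh2 gh).
rewrite (sqrt_powR q) ?mulr_ge0// powRM// => loss.
have low : b - Ch * h `^ (q / 2) <= fine (B u).
  rewrite lerBlDr -lee_fin EFinD -BE; apply: (le_trans lossE); apply: leeD2l.
  have Qt00 : (0 <= Qt%:E)%E by rewrite lee_fin ltW.
  apply: (le_trans (lee_wpmul2l Qt00 loss)).
  rewrite -EFinM lee_fin le_eqVlt; apply/orP; left; apply/eqP; rewrite /Ch; ring.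
have Sup : fine (S u) + h <= m * b `^ th by rewrite -lee_fin EFinD -SE -iE.
have [hz|hp] := eqVneq h 0.
  have q20 : q / 2 != 0 by rewrite gt_eqF// (lt_trans _ q21).
  rewrite hz powR0// mulr0 subr0 in low.
  have uO : {ae mu, forall x, O x -> u x = 0}.
    have m1 : measurable_fun setT (fun x : X => \1_O x * u x ^+ 2) by mfun.
    have n1 (x : X) : 0 <= \1_O x * u x ^+ 2 by nn.
    have Z : lint mu (fun x => \1_O x * u x ^+ 2)%R = 0%E.
      by apply/eqP; rewrite eq_le l1 andbT; move: lh; rewrite hz.
    have := (lint_eq0 mu m1 n1).1 Z; apply: filterS => x + Ox.
    by rewrite (indic_in _ Ox) mul1r => /eqP; rewrite sqrf_eq0 => /eqP.
  have unz : ~ {ae mu, forall x, u x = 0}.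
    move=> uz; have := low; apply/negP; rewrite -ltNge (_ : fine (B u) = 0)//.
    rewrite (_ : B u = 0%E)//; apply/lint_eq0; [by mfun|by nn|].
    by apply: filterS uz => x ->; rewrite normr0 powR0 ?mulr0// gt_eqF.
  have lt := balayage_lt s01 oO ext0 nO mu_ u0 Soo uO unz.
  have mb := measurable_balayage s oO mu_ u0.
  have [_ Hb] := best_le s01 sN q2 rho1 oO c0 tE mQ Q0 QO QQm testfun mb (lt_trans lt Soo).
  have BB : B (balayage s O u) = B u.
    congr lint; apply/funext => x; have [Ox|nOx] := pselect (O x); first by rewrite QO// !mul0r.
    by rewrite balayage_out.
  have := le_lt_trans Hb lt; rewrite BB SE lte_fin; apply/negP; rewrite -leNgt.
  rewrite hz addr0 in Sup; apply: (le_trans Sup); rewrite ler_pM2l//.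
  by apply: powR_mono => //; exact: ltW.
have hpos : 0 < h by rewrite lt0r hp.
have [e1 e2] := He h (introT andP (conj hpos he)).
have hq0 : 0 <= h `^ (q / 2) by exact: powR_ge0.
pose d := Ch / b * h `^ (q / 2).
have d0 : 0 <= d by rewrite mulr_ge0.
have bd : b - Ch * h `^ (q / 2) = b * (1 - d).
  by rewrite /d; field; rewrite gt_eqF.
rewrite bd in low.
have low2 : 0 <= 1 - d by rewrite subr_ge0 ltW.
have P1 : 1 - d <= (1 - d) `^ th.
  by apply: le1_powR_ge => //; rewrite low2 gerBl.
have P2 : b `^ th * (1 - d) <= fine (B u) `^ th.
  apply: (@le_trans _ _ ((b * (1 - d)) `^ th)).
    by rewrite powRM ?(ltW b0)// ler_pM2l.
  by apply: powR_mono => //; [exact: ltW|rewrite mulr_ge0// ltW].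
have P3 : m * (b `^ th * (1 - d)) <= m * fine (B u) `^ th by rewrite ler_pM2l.
move: Hopt; rewrite SE lee_fin => P4.
have E1 : K0 * h `^ (q / 2) = m * b `^ th * d by rewrite /K0 /d; ring.
have E2 : m * (b `^ th * (1 - d)) = m * b `^ th - m * b `^ th * d by ring.
have := le_trans (lerD (le_trans P3 P4) (lexx h)) Sup.
rewrite E2 -E1 addrAC -[leRHS]addr0 -addrA lerD2l subr_le0 => /(lt_le_trans e1).
by rewrite ltxx.
Qed.

End escape.

Lemma increasing_ge_id (phi : nat -> nat) : (forall n, (phi n < phi n.+1)%N) ->
  forall n, (n <= phi n)%N.
Proof. by move=> inc; elim=> [//|n IH]; exact: leq_ltn_trans IH (inc n). Qed.

Lemma near_subsequence (phi : nat -> nat) (P : nat -> Prop) :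
  (forall n, (phi n < phi n.+1)%N) -> (\forall n \near \oo, P n) ->
  \forall n \near \oo, P (phi n).
Proof.
move=> inc [n0 _ H]; exists n0 => // n /= nn0; apply: H => /=.
exact: leq_trans nn0 (increasing_ge_id inc n).
Qed.

Section translations.
Context {R : realType} (N : nat) (s : R).
Local Notation X := 'rV[R]_N.
Local Notation mu := (lebesgue_rV N).
Local Notation mu2 := (lebesgue_rV N \x lebesgue_rV N)%E.
Implicit Types (u v w : X -> R) (x y : X) (O D : set X).

Lemma mass_translate y O u : measurable O -> measurable_fun setT u ->
  lint mu (mass (shift y O) (fun x => u (x + y))%R) = lint mu (mass O u).
Proof.
move=> mO mu_; rewrite -(lint_translate y (measurable_mass mO mu_) (mass_ge0 O u)).
by congr lint; apply/funext => x; rewrite /mass.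
Qed.

Lemma gagl_translate y D u : measurable D -> measurable_fun setT u ->
  lint mu2 (gagl s (shift y D) (fun x => u (x + y))%R) = lint mu2 (gagl s D u).
Proof.
move=> mD mu_; rewrite -(lint2_translate y (measurable_gagl s mD mu_) (gagl_ge0 s D u)).
by congr lint; apply/funext => -[a b]; rewrite /gagl/= kernelD !indic_shift.
Qed.

Lemma potential_translate y (Q : X -> R) q u : measurable_fun setT Q -> (forall x, 0 <= Q x) ->
  measurable_fun setT u ->
  potential (fun x => Q (x + y)) q (fun x => u (x + y)) = potential Q q u.
Proof.
move=> mQ Q0 mu_; have m1 : measurable_fun setT (fun x : X => Q x * `|u x| `^ q) by mfun.
by rewrite /potential (lint_translate y m1)//; nn.
Qed.

Lemma cavg_lower c D (f : X -> R) k x (dl : R) : measurable D -> thick c D ->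
  measurable_fun setT f -> (forall x, 0 <= f x) -> 0 < dl -> 0 < c -> D x ->
  dl < cavg D f k (cell k x) ->
  ((dl * (c * mesh k ^+ N))%:E <=
    lint mu (fun y => \1_(D `&` box k (cell k x)) y * f y)%R)%E.
Proof.
move=> mD tD mf f0 dl0 c0 Dx; rewrite /cavg /avg.
set P := D `&` _; set I := lint mu _.
have mP : measurable P by apply: measurableI => //; exact: measurable_box.
have I0 : (0 <= I)%E by apply: lint_ge0; nn.
have [->|In] := eqVneq I +oo%E; first by rewrite leey.
have IE : I = (fine I)%:E by rewrite fineK// ge0_fin_numE// ltey.
have Poo : (mu P < +oo)%E.
  apply: (@le_lt_trans _ _ (mu (box k (cell k x)))).
    by apply: le_measure; rewrite ?inE//; [exact: measurable_box|exact: subIsetr].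
  by apply: cube_lty; rewrite mulr_gt0 ?mesh_gt0.
have VE : mu P = (fine (mu P))%:E by rewrite fineK// ge0_fin_numE.
have V1 : c * mesh k ^+ N <= fine (mu P).
  rewrite -lee_fin -VE; apply: le_trans (tD x (mesh k) Dx _) _.
    by rewrite mesh_gt0 mesh_le1.
  apply: le_measure; rewrite ?inE//.
    by apply: measurableI => //; exact: measurable_cube.
  by apply: setIS; exact: cube_box.
have V0 : 0 < fine (mu P) by apply: lt_le_trans V1; rewrite mulr_gt0// exprn_gt0// mesh_gt0.
rewrite ltr_pdivlMr// => H.
by rewrite IE lee_fin; apply: le_trans (ltW H); rewrite ler_pM2l.
Qed.

End translations.

Section existence.
Context {R : realType} (N : nat) (s : R).
Local Notation X := 'rV[R]_N.
Local Notation mu := (lebesgue_rV N).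
Local Notation mu2 := (lebesgue_rV N \x lebesgue_rV N)%E.
Implicit Types (u v w : X -> R) (x y : X).
Hypotheses (s01 : 0 < s < 1) (sN : 2 * s < N%:R).

Let s0 : 0 < s. Proof. by case/andP: s01. Qed.

Variable q : R.
Hypotheses (q2 : 2 < q) (rho1 : rho N s q < 1).

Let q0 : 0 < q. Proof. exact: lt_trans q2. Qed.
Let q1 : 1 < q. Proof. by apply: lt_trans q2; rewrite ltr1n. Qed.

Variables (O : set X) (c r0 : R).
Hypotheses (oO : open O) (ext0 : (0 < mu (~` O))%E) (c0 : 0 < c) (nO : O !=set0).
Hypotheses (tO : thick c O) (tE : thick c (~` O)) (bO : forall x, O x -> `|x| <= r0).

Let mO : measurable O. Proof. exact: measurable_open_rV. Qed.
Let mOc : measurable (~` O). Proof. exact: measurableC. Qed.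

Variables (Q : X -> R) (Qm Qt : R).
Hypotheses (mQ : measurable_fun setT Q) (Q0 : forall x, 0 <= Q x).
Hypotheses (QO : forall x, O x -> Q x = 0) (QQm : forall x, Q x <= Qm).
Hypotheses (Qt0 : 0 < Qt) (QQt : forall x, ~ O x -> Qt <= Q x).
Hypothesis Qlim : forall e : R, 0 < e -> exists M : R,
  forall x, ~ O x -> M < `|x| -> `|Q x - Qt| < e.

Local Notation S := (Hs_norm2 s O).
Local Notation B := (potential Q q).
Local Notation th := (2 / q).
Hypothesis testfun : exists u, [/\ measurable_fun setT u, (S u < +oo)%E & (0 < B u)%E].

Local Notation m := (best s q O Q).
Let m0 : 0 < m.
Proof. exact: (best_gt0 s01 sN q2 rho1 oO c0 tE mQ Q0 QO QQm testfun). Qed.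

Let optimal u : measurable_fun setT u -> (S u < +oo)%E ->
  (B u < +oo)%E /\ ((m * fine (B u) `^ th)%:E <= S u)%E.
Proof. exact: (best_le s01 sN q2 rho1 oO c0 tE mQ Q0 QO QQm testfun). Qed.

Lemma potential_ext u v : (forall x, ~ O x -> `|u x| = `|v x|) -> B u = B v.
Proof.
move=> uv; congr lint; apply/funext => x; have [Ox|nOx] := pselect (O x).
  by rewrite QO// !mul0r.
by rewrite uv.
Qed.

Lemma balayage_idem u : balayage s O (balayage s O u) = balayage s O u.
Proof.
apply/funext => x; rewrite {1}/balayage; case: ifPn => // xO.
rewrite [RHS]/balayage xO; congr (fine _ / _); congr lint; apply/funext => y.
rewrite /ext_kernel; have [Oy|nOy] := pselect ((~` O) y); last first.
  by rewrite (indic_out _ nOy) !mul0r.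
by rewrite balayage_out.
Qed.

Lemma minimizing_sequence : exists u_ : nat -> X -> R, forall n,
  [/\ measurable_fun setT (u_ n), forall x, 0 <= u_ n x,
      (S (u_ n) <= (m + n.+1%:R^-1)%:E)%E, B (u_ n) = 1%:E &
      balayage s O (u_ n) = u_ n].
Proof.
suff /choice[u_ H] : forall n : nat, exists u : X -> R,
    [/\ measurable_fun setT u, forall x, 0 <= u x,
      (S u <= (m + n.+1%:R^-1)%:E)%E, B u = 1%:E & balayage s O u = u] by exists u_.
move=> n.
have e0 : (0 : R) < n.+1%:R^-1 by rewrite invr_gt0.
have [u [mu_ Su Bu]] := best_approx s01 sN q2 rho1 oO c0 tE mQ Q0 QO QQm testfun e0.
pose v x := `|u x|.
have mv : measurable_fun setT v by rewrite /v; mfun.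
have v0 x : 0 <= v x by exact: normr_ge0.
have Sv : (S v <= (m + n.+1%:R^-1)%:E)%E by apply: le_trans (Hs_norm2_abs _ _ _) Su.
have [_ voo] := (Hs_norm2_ltyP _ _ _).1 (le_lt_trans Sv (ltry _)).
exists (balayage s O v); split.
- exact: measurable_balayage.
- by move=> x; exact: balayage_ge0.
- exact: le_trans (balayage_le s01 oO ext0 mv v0 voo) Sv.
- rewrite -Bu; apply: potential_ext => x nOx.
  by rewrite balayage_out// /v normr_id.
- exact: balayage_idem.
Qed.


Lemma windowed_limit (a : R) (y_ : nat -> X) (E : set X) (u_ : nat -> X -> R) :
  measurable E -> (forall x, E x -> \forall n \near \oo, ~ O (x + y_ n)) ->
  (forall n, measurable_fun setT (u_ n)) -> (forall n x, 0 <= u_ n x) ->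
  0 <= a -> (forall n, (S (u_ n) <= a%:E)%E) ->
  exists phi w, [/\ forall n, (phi n < phi n.+1)%N, measurable_fun setT w,
    forall x, 0 <= w x &
    {ae mu, forall x, E x -> u_ (phi n) (x + y_ (phi n)) @[n --> \oo] --> w x}].
Proof.
move=> mE Eout mu_ u0 a0 Sa.
pose D n := shift (y_ n) (~` O); pose f n (x : X) := u_ n (x + y_ n).
have mD n : measurable (D n) by exact: measurable_shift.
have mf n : measurable_fun setT (f n) by exact: measurable_fun_translate.
have f0 n x : 0 <= f n x by exact: u0.
have parts n := Hs_norm2_parts oO (mu_ n) a0 (Sa n).
have fE n : (lint mu (fun x => \1_(D n) x * f n x ^+ 2)%R <= (Num.sqrt (2 * a) ^+ 2)%:E)%E.
  by rewrite -[X in (X <= _)%E](_ : lint mu (mass (shift (y_ n) O) (f n)) = _)//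
    (mass_translate _ mO (mu_ n)); case: (parts n).
have fG n : (lint mu2 (gagl s (D n) (f n)) <= (Num.sqrt (2 * a) ^+ 2)%:E)%E.
  by rewrite (gagl_translate s (y_ n) mOc (mu_ n)); case: (parts n).
have tD n : thick c (D n) by exact: thick_shift.
have [phi [inc ae_]] := ae_compactness s0 sN c0 (sqrtr_ge0 _) mD tD mf f0 fE fG.
have [|w [mw w0 _ ww]] := @ae_limit _ X R mu E (fun n => f (phi n)) mE (fun n => mf (phi n))
  (fun n => f0 (phi n)).
  by apply: filterS ae_ => x h Ex; apply: h; exact: near_subsequence (Eout x Ex).
by exists phi, w.
Qed.

Lemma weakly_vanishing (f_ : nat -> X -> R) (P : set X) (a e : R) :
  (forall n, measurable_fun setT (f_ n)) -> (forall n x, 0 <= f_ n x) ->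
  {ae mu, forall x, f_ n x @[n --> \oo] --> 0} ->
  (forall n, (lint mu (fun x => f_ n x ^+ 2)%R <= a%:E)%E) ->
  measurable P -> (mu P < +oo)%E -> 0 < e ->
  \forall n \near \oo, (lint mu (fun x => \1_P x * f_ n x)%R <= e%:E)%E.
Proof.
move=> mf f0 ff fa mP Poo e0.
have mi : measurable_fun setT (\1_P : X -> R) by mfun.
have i0 (x : X) : 0 <= \1_P x :> R by exact: indic_ge0.
have m0' : measurable_fun setT (fun _ : X => 0 : R) by mfun.
have ioo : (lint mu (fun x => \1_P x ^+ 2)%R < +oo)%E.
  rewrite (_ : (fun x => _) = (\1_P : X -> R)); first by rewrite lint_indic.
  by apply/funext => x; rewrite indicE; case: (x \in P); rewrite ?expr1n ?expr0n.
apply: filterS (ae_cvg_weak mf m0' mi i0 ff fa ioo e0) => n; apply: le_trans.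
rewrite le_eqVlt; apply/orP; left; apply/eqP; congr lint; apply/funext => x.
by rewrite subr0 ger0_norm// mulrC.
Qed.

(** A minimizing sequence, relaxed in [O], has an almost everywhere limit,
which carries a fraction [b] of the constraint at the cost [m * b]. If [b] is
positive, concavity of [b `^ (2 / q)] makes the normalized limit a minimizer.
If [b = 0], the sequence does not vanish at some fixed scale, and following the
lumps of mass, which must escape to infinity, yields a profile of the limit
problem on the whole space whose cost is too small. *)
Theorem minimizer_exists : exists u, [/\ measurable_fun setT u, (S u <= m%:E)%E & B u = 1%:E].
Proof.
have /andP[t0 t1] := th01 q2.
have [u_ Hu] := minimizing_sequence.
have mu_ n : measurable_fun setT (u_ n) by case: (Hu n).
have u0 n x : 0 <= u_ n x by case: (Hu n).
have Se n : (S (u_ n) <= (m + n.+1%:R^-1)%:E)%E by case: (Hu n).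
have B1 n : B (u_ n) = 1%:E by case: (Hu n).
have bal n : balayage s O (u_ n) = u_ n by case: (Hu n).
have a0 : 0 <= m + 1 by rewrite addr_ge0 ?ltW.
have Sa n : (S (u_ n) <= (m + 1)%:E)%E.
  by apply: (le_trans (Se n)); rewrite lee_fin lerD2l invf_le1// ler1n.
have parts n := Hs_norm2_parts oO (mu_ n) a0 (Sa n).
set A := Num.sqrt (2 * (m + 1)) in parts.
have harm (phi : nat -> nat) : (forall n, (phi n < phi n.+1)%N) ->
    (phi n).+1%:R^-1 @[n --> \oo] --> (0 : R).
  move=> inc; apply: (@squeeze_cvgr _ _ _ _ (fun=> 0) (@harmonic R)).
  - apply: nearW => n; rewrite invr_ge0 ler0n/= lef_pV2 ?posrE// ler_nat ltnS.
    exact: increasing_ge_id.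
  - exact: cvg_cst.
  - exact: cvg_harmonic.
have [|phi [w0 [inc mw0 w00 ww0]]] := @windowed_limit (m + 1) (fun=> 0) (~` O) u_ mOc _ mu_ u0 a0 Sa.
  by move=> x Ox; apply: nearW => n; rewrite addr0.
have ww1 : {ae mu, forall x, (~` O) x -> u_ (phi n) x @[n --> \oo] --> w0 x}.
  apply: filterS ww0 => x h Ox; have := h Ox.
  by rewrite (_ : (fun n => _) = (fun n => u_ (phi n) x))//; apply/funext => n; rewrite addr0.
pose W := balayage s O w0.
have mW : measurable_fun setT W by exact: measurable_balayage.
have ww : {ae mu, forall x, u_ (phi n) x @[n --> \oo] --> W x}.
  apply: filterS (ww1) => x h; have [Ox|nO'] := pselect (O x); last first.
    by rewrite /W balayage_out//; exact: h.
  have := @balayage_cvg R N s s01 O oO ext0 (fun n => u_ (phi n)) w0 (A ^+ 2) x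
    (fun n => mu_ (phi n)) mw0 (fun n => u0 (phi n)) w00 ww1
    (fun n => (parts (phi n)).1) Ox.
  by rewrite (_ : (fun n => _) = (fun n => u_ (phi n) x))//; apply/funext => n; rewrite bal.
have [b /andP[b0 b1] [BW SW]] := minimizing_limit q1 (th01 q2) (ltW m0) ler01 (fun=> mO) mO
  (fun n => mu_ (phi n)) mW (fun=> mQ) mQ (fun=> Q0) Q0 (fun _ x => eq_ind_r (fun z => Q x <= z) (lexx _) (mul1r (Q x)))
  (fun x => cvg_cst (Q x)) (fun _ x h => h) (fun x => nearW _ (fun n => id)) ww
  (harm phi inc) (fun n => Se (phi n)) (fun n => B1 (phi n)) (fun _ => optimal).
have [bz|bn] := eqVneq b 0; last first.
  have bp : 0 < b by rewrite lt0r bn.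
  have Soo : (S W < +oo)%E by apply: le_lt_trans SW (ltry _).
  have Bpos : (0 < B W)%E by rewrite BW lte_fin.
  have [u [mu' Su Bu]] := normalize_level s01 sN q2 rho1 oO c0 tE mQ Q0 QO QQm mW Soo Bpos.
  exists u; split => //; rewrite Su lee_fin BW /=.
  have bt0 : 0 < b `^ th by exact: powR_gt0.
  have bb : b <= b `^ th by apply: le1_powR_ge => //; rewrite b0.
  rewrite ler_pdivrMr//; apply: (@le_trans _ _ (m * b)).
    by rewrite -lee_fin fineK// ge0_fin_numE// Hs_norm2_ge0.
  by rewrite ler_pM2l.
exfalso; move: BW {SW}; rewrite {b b0 b1}bz => BW.
have Wz : {ae mu, forall x, (~` O) x -> W x = 0}.
  have m1 : measurable_fun setT (fun x : X => Q x * `|W x| `^ q) by mfun.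
  have n1 (x : X) : 0 <= Q x * `|W x| `^ q by nn.
  apply: filterS ((lint_eq0 mu m1 n1).1 BW) => x /eqP + Ox.
  have Qx : 0 < Q x by exact: lt_le_trans (QQt Ox).
  by rewrite mulf_eq0 gt_eqF//= powR_eq0 normr_eq0 => /andP[/eqP].
pose v_ n := u_ (phi n).
have mv n : measurable_fun setT (v_ n) by exact: mu_.
have v0 n x : 0 <= v_ n x by exact: u0.
have Qm0 : 0 <= Qm by exact: le_trans (Q0 0) (QQm 0).
have kp0 : 0 < (Qm + 1)^-1 by rewrite invr_gt0 ltr_wpDl.
have Av0 : 0 <= A by exact: sqrtr_ge0.
have [k [dl [dl0 nonv]]] := nonvanishing s0 sN q2 rho1 mOc c0 tE kp0 Av0.
have lump n : exists x, ~ O x /\ dl < cavg (~` O) (v_ n) k (cell k x).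
  have [p1 p2] := parts (phi n).
  have [|x Ox Hx] := nonv (v_ n) (mv n) (v0 n) p1 p2; last by exists x.
  have := potential_le_ext q oO mQ Q0 QO QQm (mv n); rewrite B1.
  set I := lint mu _ => H; rewrite leNgt; apply/negP => HI.
  have I0 : (0 <= I)%E by apply: lint_ge0; nn.
  have IE : I = (fine I)%:E by rewrite fineK// ge0_fin_numE// (lt_trans HI)// ltry.
  move: H HI; rewrite IE lte_fin -EFinM lee_fin => H HI.
  have := le_lt_trans (ler_wpM2l Qm0 (ltW HI)) (_ : Qm / (Qm + 1) < 1).
  rewrite ltr_pdivrMr ?mul1r ?ltrDl ?ltr_wpDl// => /(_ ltr01).
  by apply/negP; rewrite -leNgt.
have {lump}[x_ /all_and2[xO xdl]] := choice lump.
pose y_ n : X := \row_i (mesh k * (cell k (x_ n) ord0 i)%:~R).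
have h0 : 0 < 2 * mesh k :> R by rewrite mulr_gt0 ?mesh_gt0.
pose d := dl * (c * mesh k ^+ N).
have d0 : 0 < d by rewrite !mulr_gt0// exprn_gt0 ?mesh_gt0.
have d20 : 0 < d / 2 by rewrite divr_gt0.
have low n : (d%:E <= lint mu (fun y => \1_(~` O `&` cube (y_ n) (2 * mesh k)) y * v_ n y)%R)%E.
  exact: (cavg_lower mOc tE (mv n) (v0 n) dl0 c0 (xO n) (xdl n)).
have no_low (z : \bar R) : (d%:E <= z)%E -> (z <= (d / 2)%:E)%E -> False.
  by move=> /le_trans h /h; rewrite lee_fin; move: (d0) => *; lra.
have mi : measurable_fun setT (\1_(~` O) : X -> R) by mfun.
have i0 (x : X) : 0 <= \1_(~` O) x :> R by exact: indic_ge0.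
have esc (r : R) : 0 < r -> \forall n \near \oo, r < `|y_ n|.
  move=> r0'; pose f n x := \1_(~` O) x * v_ n x.
  have mf n : measurable_fun setT (f n) by have := mv n; rewrite /f => ?; mfun.
  have f0 n x : 0 <= f n x by rewrite mulr_ge0.
  have ff : {ae mu, forall x, f n x @[n --> \oo] --> 0}.
    apply: filterS2 ww Wz => x h Wx; have [Ox|nO'] := pselect (O x).
      apply: cvg_near_cst; apply: nearW => n; rewrite /f indic_out ?mul0r//.
    rewrite (_ : (fun n => _) = fun n => u_ (phi n) x); last first.
      by apply/funext => n; rewrite /f indic_in// mul1r.
    by rewrite -(Wx nO').
  have fa n : (lint mu (fun x => f n x ^+ 2)%R <= (A ^+ 2)%:E)%E.
    have [+ _] := parts (phi n); apply: le_trans.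
    rewrite le_eqVlt; apply/orP; left; apply/eqP; congr lint; apply/funext => x.
    rewrite /mass /f exprMn; congr (_ * _).
    by rewrite indicE; case: (x \in _); rewrite ?expr1n ?expr0n.
  have r20 : 0 < r + 2 * mesh k by rewrite addr_gt0.
  have := weakly_vanishing mf f0 ff fa (measurable_cube 0 (r + 2 * mesh k)) (cube_lty 0 r20) d20.
  apply: filterS => n Hn; rewrite ltNge; apply/negP => yr.
  apply: (no_low _ (le_trans (low n) _) Hn).
  have mP : measurable (~` O `&` cube (y_ n) (2 * mesh k)).
    by apply: measurableI => //; exact: measurable_cube.
  have mC := measurable_cube (0 : X) (r + 2 * mesh k).
  have mvn := mv n; have mfn := mf n.
  have mi1 : measurable_fun setT (\1_(~` O `&` cube (y_ n) (2 * mesh k)) : X -> R) by mfun.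
  have mi2 : measurable_fun setT (\1_(cube 0 (r + 2 * mesh k)) : X -> R) by mfun.
  apply: lint_le; [by mfun|by mfun|by move=> x; rewrite mulr_ge0 ?indic_ge0|].
  move=> x; have [[Ox cx]|nP] := pselect ((~` O `&` cube (y_ n) (2 * mesh k)) x); last first.
    by rewrite (indic_out _ nP) mul0r mulr_ge0 ?indic_ge0.
  rewrite /f (indic_in _ Ox) (@indic_in _ _ (cube 0 _)) ?mul1r; last first.
    rewrite cubeE//= subr0; move: cx; rewrite cubeE//= => cx.
    rewrite -(subrK (y_ n) x) addrC; apply: le_lt_trans (ler_normD _ _) _.
    exact: ler_ltD.
  by rewrite indic_in ?mul1r.
have awayO x (M : R) : \forall n \near \oo, ~ O (x + y_ n) /\ M < `|x + y_ n|.
  have r1 : 0 < `|r0| + `|M| + `|x| + 1 by rewrite ltr_wpDl// !addr_ge0.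
  apply: filterS (esc _ r1) => n Hn.
  have far : `|r0| + `|M| < `|x + y_ n|.
    have := ler_normB (x + y_ n) x; rewrite addrAC subrr add0r => h.
    have := lt_le_trans Hn h; rewrite -ltrBlDr; apply: le_lt_trans.
    by rewrite addrAC addrK lerDl.
  split=> [/bO h|]; last first.
    by apply: le_lt_trans far; rewrite (le_trans (ler_norm M))// lerDr.
  have := lt_le_trans far h; apply/negP; rewrite -leNgt (le_trans (ler_norm r0))// lerDl//.
have Sv n : (S (v_ n) <= (m + 1)%:E)%E by exact: Sa.
have [|psi [w [inc2 mw w00' zw]]] := @windowed_limit (m + 1) y_ setT v_ measurableT _ mv v0 a0 Sv.
  by move=> x _; apply: filterS (awayO x 0) => n [].
pose Y n := y_ (psi n); pose z_ n x := v_ (psi n) (x + Y n).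
have mz n : measurable_fun setT (z_ n) by exact: measurable_fun_translate.
have awayY x (M : R) : \forall n \near \oo, ~ O (x + Y n) /\ M < `|x + Y n|.
  exact: (near_subsequence (P := fun n => ~ O (x + y_ n) /\ M < `|x + y_ n|)).
have zw' : {ae mu, forall x, z_ n x @[n --> \oo] --> w x} by apply: filterS zw => x; apply.
pose Qn n x := Q (x + Y n).
have mQn n : measurable_fun setT (Qn n) by exact: measurable_fun_translate.
have mshift n : measurable (shift (Y n) O) by exact: measurable_shift.
have mQt : measurable_fun setT (fun _ : X => Qt) by mfun.
have inc12 n : (phi (psi n) < phi (psi n.+1))%N.
  have mono i j : (i < j)%N -> (phi i < phi j)%N.
    elim: j => [//|j IH]; rewrite ltnS leq_eqVlt => /orP[/eqP ->//|/IH h].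
    exact: ltn_trans (inc j).
  exact: mono.
have M0 : 0 <= Qm / Qt by rewrite divr_ge0// ltW.
have QnM n x : Qn n x <= Qm / Qt * Qt by rewrite divfK ?gt_eqF //; exact: QQm.
have Qncvg x : Qn n x @[n --> \oo] --> Qt.
  apply/cvgrPdist_lt => e e0; have [M HM] := Qlim e0.
  by apply: filterS (awayY x M) => n [h1 h2]; rewrite distrC; exact: HM.
have ev x : \forall n \near \oo, shift (Y n) O x -> set0 x.
  by apply: filterS (awayY x 0) => n [].
have zS n : (Hs_norm2 s (shift (Y n) O) (z_ n) <= (m + (phi (psi n)).+1%:R^-1)%:E)%E.
  by rewrite /z_ (Hs_norm2_translate s (Y n) mO (mv _)); exact: Se.
have zB n : potential (Qn n) q (z_ n) = 1%:E.
  by rewrite /z_ /Qn (potential_translate (Y n) q mQ Q0 (mv _)); exact: B1.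
have opt n v : measurable_fun setT v -> (Hs_norm2 s (shift (Y n) O) v < +oo)%E ->
    (potential (Qn n) q v < +oo)%E /\
    ((m * fine (potential (Qn n) q v) `^ th)%:E <= Hs_norm2 s (shift (Y n) O) v)%E.
  move=> mv'; pose v' x := v (x - Y n).
  have mv2 : measurable_fun setT v' by exact: measurable_fun_translate.
  have vE : v = (fun x => v' (x + Y n)) by apply/funext => x; rewrite /v' addrK.
  rewrite vE (Hs_norm2_translate s (Y n) mO mv2) (potential_translate (Y n) q mQ Q0 mv2).
  exact: optimal.
have [b /andP[b0 b1] [Bw Sw]] := minimizing_limit q1 (th01 q2) (ltW m0) M0 mshift measurable0
  mz mw mQn mQt (fun n x => Q0 _) (fun=> ltW Qt0) QnM Qncvg (fun n => @sub0set _ _) ev zw'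
  (harm (phi \o psi) inc12) zS zB opt.
have [bz|bn] := eqVneq b 0; last first.
  have bp : 0 < b by rewrite lt0r bn.
  apply: (no_escaping_profile s01 sN q2 rho1 oO ext0 c0 nO tO tE bO mQ Q0 QO QQm Qt0 QQt testfun
    mw w00' bp Bw).
  apply: (le_trans Sw); rewrite lee_fin ler_pM2l//; apply: le1_powR_ge => //.
  by rewrite b0.
have wz : {ae mu, forall x, w x = 0}.
  have m1 : measurable_fun setT (fun x : X => Qt * `|w x| `^ q) by mfun.
  have n1 (x : X) : 0 <= Qt * `|w x| `^ q by rewrite mulr_ge0 ?powR_ge0 ?ltW.
  rewrite bz in Bw; apply: filterS ((lint_eq0 mu m1 n1).1 Bw) => x /eqP.
  by rewrite mulf_eq0 gt_eqF//= powR_eq0 normr_eq0 => /andP[/eqP].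
pose D n := shift (Y n) (~` O); pose f n x := \1_(D n) x * z_ n x.
have mD n : measurable (D n) by exact: measurable_shift.
have mf n : measurable_fun setT (f n).
  by have := mz n; have := mD n; rewrite /f => ? ?; mfun.
have z0 n x : 0 <= z_ n x by exact: v0.
have f0 n x : 0 <= f n x by rewrite mulr_ge0 ?indic_ge0.
have ff : {ae mu, forall x, f n x @[n --> \oo] --> 0}.
  apply: filterS2 zw' wz => x h wx; rewrite -wx; apply: cvg_trans h.
  apply: near_eq_cvg; apply: filterS (awayY x 0) => n [h _].
  by rewrite /f indic_in ?mul1r.
have fa n : (lint mu (fun x => f n x ^+ 2)%R <= (A ^+ 2)%:E)%E.
  have [+ _] := parts (phi (psi n)); apply: le_trans.
  rewrite -(mass_translate (Y n) mO (mv (psi n))).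
  rewrite le_eqVlt; apply/orP; left; apply/eqP; congr lint; apply/funext => x.
  rewrite /mass /f exprMn; congr (_ * _).
  by rewrite indicE; case: (x \in _); rewrite ?expr1n ?expr0n.
have vanish := weakly_vanishing mf f0 ff fa (measurable_cube 0 (2 * mesh k)) (cube_lty 0 h0) d20.
have [n Hn] := filter_ex vanish.
apply: (no_low _ (low (psi n)) (le_trans _ Hn)).
rewrite le_eqVlt; apply/orP; left; apply/eqP.
have mP : measurable (~` O `&` cube (y_ (psi n)) (2 * mesh k)).
  by apply: measurableI => //; exact: measurable_cube.
have mvn := mv (psi n).
have mi1 : measurable_fun setT (\1_(~` O `&` cube (y_ (psi n)) (2 * mesh k)) : X -> R) by mfun.
have m1 : measurable_fun setT
  (fun x : X => \1_(~` O `&` cube (y_ (psi n)) (2 * mesh k)) x * v_ (psi n) x) by mfun.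
rewrite -(lint_translate (Y n) m1); last by move=> x; rewrite mulr_ge0 ?indic_ge0.
congr lint; apply/funext => x; rewrite /f /z_ mulrA; congr (_ * _).
rewrite -indic_shift /D !indicE -natrM mulnb andbC -in_setI; congr ((_ \in _)%:R).
apply/seteqP; split=> t [h1 h2]; split=> // i; have := h2 i; rewrite !mxE subr0.
  by rewrite addrK.
by rewrite addrK.
Qed.

End existence.

Section lipschitz.
Context {R : realType} (n : nat).
Local Notation X := 'rV[R]_n.
Implicit Types (g : X -> R) (x v : X).

Lemma is_derive_line g z v (t : R) : derivable g (z + t *: v) v ->
  is_derive t 1 (fun t : R => g (z + t *: v)) ('D_v g (z + t *: v)).
Proof.
have E : (fun h : R => h^-1 *: (g (z + (h *: (1 : R) + t) *: v) - g (z + t *: v))) =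
    (fun h => h^-1 *: (g (h *: v + (z + t *: v)) - g (z + t *: v))).
  apply/funext => h /=; congr (_ *: (g _ - _)).
  by rewrite -[h *: 1]/(h * 1) mulr1 scalerDl addrCA.
move=> dg; have dg' : cvg ((fun h : R => h^-1 *: (g (z + (h *: (1 : R) + t) *: v) - g (z + t *: v)))
    @ 0^') by rewrite E.
apply: DeriveDef; first exact: dg'.
by move: (congr1 (fun F => lim (F @ 0^')) E).
Qed.

Lemma increment_le g z v (t M : R) : (forall x, derivable g x v) ->
  (forall t', `|t'| <= `|t| -> `|'D_v g (z + t' *: v)| <= M) ->
  `|g (z + t *: v) - g z| <= M * `|t|.
Proof.
move=> dg HM; pose h (t : R) := g (z + t *: v).
have dh (t' : R) : is_derive t' 1 h ('D_v g (z + t' *: v)) by exact: is_derive_line.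
have ch a b : {within `[a, b], continuous h}.
  by apply: derivable_within_continuous => x _; case: (dh x).
have -> : g z = h 0 by rewrite /h scale0r addr0.
have [t0|/ltW t0] := leP 0 t.
  have [c /[!in_itv]/= /andP[c0 ct] ->] := MVT_segment t0 (fun w _ => dh w) (ch 0 t).
  by rewrite subr0 normrM ler_wpM2r// HM// !ger0_norm.
have [c /[!in_itv]/= /andP[c0 ct] E] := MVT_segment t0 (fun w _ => dh w) (ch t 0).
rewrite distrC E sub0r normrM normrN ler_wpM2r// HM// !ler0_norm// lerN2//.
Qed.

Lemma locally_lipschitz g a : Ck 1 g -> exists2 L, 0 <= L & exists2 e, 0 < e &
  forall x y d, `|x - a| < e -> `|y - a| < e -> `|x - y| <= d -> `|g x - g y| <= L * d.
Proof.
move=> [_ Hg]; pose ev i : X := delta_mx ord0 i.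
have dg i x : derivable g x (ev i) by case: (Hg (ev i)) => + _; apply.
have cD i : continuous ('D_(ev i) g) by case: (Hg (ev i)).
pose M := \sum_i (`|'D_(ev i) g a| + 1).
have HM : \forall x \near a, forall i, `|'D_(ev i) g x| <= M.
  apply: (@filter_forall _ _ (fun i => [set x | `|'D_(ev i) g x| <= M]) (nbhs a)) => i.
  have /cvgrPdist_lt/(_ _ ltr01) := cD i a; apply: filterS => x h.
  have h2 := ler_distD ('D_(ev i) g a) ('D_(ev i) g x) 0; rewrite !subr0 in h2.
  apply: (le_trans h2); rewrite distrC addrC; apply: (le_trans (lerD (lexx _) (ltW h))).
  rewrite /M (bigD1 i)//= lerDl; apply: sumr_ge0 => j _; exact: addr_ge0.
have M0 : 0 <= M by apply: sumr_ge0 => i _; exact: addr_ge0.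
have /nbhs_normP[e /= e0 He] := HM.
exists (n%:R * M); first by rewrite mulr_ge0.
exists (e / 4); first by rewrite divr_gt0.
move=> x y d xa ya xy.
pose z k : X := \row_i (if (i < k)%N then x ord0 i else y ord0 i).
have z0 : z 0%N = y by apply/rowP => i; rewrite mxE.
have zn : z n = x by apply/rowP => i; rewrite mxE ltn_ord.
have e40 : 0 < e / 4 by rewrite divr_gt0.
have za k : `|z k - a| < e / 4.
  apply: rV_norm_lt => // i; rewrite !mxE; case: ifP => _.
    by have := coord_le_norm (x - a) i; rewrite !mxE => /le_lt_trans; apply.
  by have := coord_le_norm (y - a) i; rewrite !mxE => /le_lt_trans; apply.
have d0 : 0 <= d by exact: le_trans xy.
have main k : (k <= n)%N -> `|g (z k) - g y| <= k%:R * M * d.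
  elim: k => [_|k IH kn]; first by rewrite z0 subrr normr0 !mul0r.
  pose i := Ordinal kn; pose t := x ord0 i - y ord0 i.
  have zS : z k.+1 = z k + t *: ev i.
    apply/rowP => j; rewrite !mxE eqxx/=; have [->|ji] := eqVneq j i.
      by rewrite ltnS leqnn ltnn mulr1 addrC subrK.
    rewrite mulr0 addr0 ltnS leq_eqVlt; case: eqP => // jk.
    by move: ji; rewrite -(inj_eq val_inj) /= jk eqxx.
  have td : `|t| <= d by have := coord_le_norm (x - y) i; rewrite !mxE => /le_trans; apply.
  have te : `|t| < e / 2.
    have := coord_le_norm (x - y) i; rewrite !mxE => /le_lt_trans; apply.
    rewrite -(subrKA a); apply: le_lt_trans (ler_normD _ _) _.
    rewrite [`|a - y|]distrC (_ : e / 2 = e / 4 + e / 4); last by field.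
    exact: ltrD.
  have := @increment_le g (z k) (ev i) t M (dg i).
  rewrite -zS => H.
  have {}H : `|g (z k.+1) - g (z k)| <= M * `|t|.
    apply: H => t' t't; apply: He => /=.
    rewrite opprD addrA; apply: le_lt_trans (ler_normB _ _) _; rewrite [X in X < _]addrC.
    have ev1 : `|t' *: ev i| <= `|t'|.
      apply: rV_norm_le => // j; rewrite !mxE eqxx/=; case: (_ == _); rewrite ?mulr1 ?mulr0 ?normr0//.
    have := za k; rewrite distrC => h.
    have h5 := ler_ltD (le_trans ev1 (le_trans t't (ltW te))) h; have := h5 => /lt_le_trans h6; apply: h6.
    have -> : e / 2 + e / 4 = e * (3 / 4) by field.
    by rewrite ler_piMr ?(ltW e0)// ler_pdivrMr// mul1r ler_nat.
  have := ler_distD (g (z k)) (g (z k.+1)) (g y); move=> /le_trans; apply.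
  have -> : k.+1%:R * M * d = M * d + k%:R * M * d by rewrite -natr1; ring.
  apply: lerD (IH (ltnW kn)); apply: (le_trans H); exact: ler_wpM2l.
by rewrite -zn; exact: main.
Qed.

End lipschitz.

Lemma compact_norm_le {R : realType} (N : nat) (M : R) : compact [set x : 'rV[R]_N | `|x| <= M].
Proof.
apply: bounded_closed_compact; first exists M.
  by split=> [|t tM x /= /le_trans]; [exact: num_real|apply; exact: ltW].
rewrite (_ : [set _ | _] = (fun x : 'rV[R]_N => `|x|) @^-1` [set t | t <= M])//.
by apply: ((continuous_closedP (fun x : 'rV[R]_N => `|x|)).1 (@norm_continuous _ _)); exact: closed_le.
Qed.

Section thick_domain.
Context {R : realType} (N : nat).
Local Notation X := 'rV[R]_N.
Local Notation mu := (lebesgue_rV N).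
Implicit Types (D : set X) (x y z : X).

Lemma thick_room D x z (k r rho : R) : measurable D -> 0 < rho -> 0 <= k * r <= 2 * rho ->
  cube z rho `<=` D `&` cube x r -> (((k * r) ^+ N)%:E <= mu (D `&` cube x r))%E.
Proof.
move=> mD rho0 /andP[k0 kr] sub; apply: (@le_trans _ _ (mu (cube z rho))).
  by rewrite cube_measure// lee_fin lerXn2r// nnegrE// mulr_ge0// ltW.
apply: le_measure; rewrite ?inE//; first exact: measurable_cube.
by apply: measurableI => //; exact: measurable_cube.
Qed.

Variable Om : set X.
Hypothesis dom : smooth_bounded_domain Om.

Let oO : open Om. Proof. by case: dom. Qed.
Let mO : measurable Om. Proof. exact: measurable_open_rV. Qed.

Definition thick_at (e : R) x := forall D, D = Om \/ D = ~` Om -> D x ->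
  forall r, 0 < r <= e -> (((e * r) ^+ N)%:E <= mu (D `&` cube x r))%E.

Let mD D : D = Om \/ D = ~` Om -> measurable D.
Proof. by move=> [->|->] //; exact: measurableC. Qed.

Lemma thick_at_le (e e' : R) x : 0 < e' <= e -> thick_at e x -> thick_at e' x.
Proof.
move=> /andP[e0 ee] H D DO Dx r /andP[r0 re].
have re' : 0 < r <= e by rewrite r0 (le_trans re).
have e1 : 0 < e by exact: lt_le_trans ee.
apply: le_trans (H D DO Dx r re'); rewrite lee_fin lerXn2r ?nnegrE//.
- by rewrite mulr_ge0 ?ltW.
- by rewrite mulr_ge0 ?ltW.
- by rewrite ler_pM2r.
Qed.

Lemma interior_thick D0 x0 : D0 = Om \/ D0 = ~` Om -> nbhs x0 D0 ->
  exists2 e, 0 < e & forall x, `|x - x0| < e -> thick_at e x.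
Proof.
move=> D0O /nbhs_normP[d /= d0 Hd].
have e0 : 0 < Num.min 1 (d / 2) by rewrite lt_min ltr01 divr_gt0.
set e := Num.min _ _ in e0; have e1 : e <= 1 by rewrite ge_min lexx.
have ed : e <= d / 2 by rewrite ge_min lexx orbT.
exists e => // x xx0 D DO Dx r /andP[r0 re].
have sub : cube x r `<=` D0.
  move=> y; rewrite cubeE//= => yx; apply: Hd => /=; rewrite distrC -(subrKA x).
  apply: (le_lt_trans (ler_normD _ _)); have := ltr_leD yx (le_trans (ltW xx0) ed).
  move/lt_le_trans; apply; lra.
have DD : D = D0.
  have D0x : D0 x by apply: sub => i; rewrite subrr normr0.
  by move: DO D0O D0x Dx => [->|->] [->|->].
apply: (thick_room (z := x) (mD DO) r0); last by move=> y yx; split=> //; rewrite DD; exact: sub.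
apply/andP; split; first by rewrite mulr_ge0 ?ltW.
by rewrite ler_pM2r// (le_trans e1)// ler1n.
Qed.

(** Near a boundary point the domain lies on one side of a Lipschitz graph, so
that a cube of comparable size can be pushed along the vertical direction, away
from the boundary, on either side. *)
Lemma boundary_thick x0 : (closure Om `\` interior Om) x0 ->
  exists2 e, 0 < e & forall x, `|x - x0| < e -> thick_at e x.
Proof.
case: dom => _ _ _ _ sb /sb[i [b [g [sg /nbhs_normP[e2 /= e20 H2]]]]].
have [L L0 [e1 e10 lip]] := locally_lipschitz (col' i x0) (sg 1%N).
pose k := (2 * (L + 1))^-1.
have L1 : 0 < L + 1 by rewrite ltr_wpDl.
have k0 : 0 < k by rewrite invr_gt0 mulr_gt0.
have kL : k * (2 * (L + 1)) = 1 by rewrite mulVf// gt_eqF// mulr_gt0.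
have e0 : 0 < Num.min k (Num.min (e1 / 2) (e2 / 2)) by rewrite !lt_min k0 !divr_gt0.
set e := Num.min _ _ in e0.
have ek : e <= k by rewrite ge_min lexx.
have ee1 : e <= e1 / 2 by rewrite !ge_min lexx !orbT.
have ee2 : e <= e2 / 2 by rewrite !ge_min lexx !orbT.
have col (y z : X) : `|col' i y - col' i z| <= `|y - z|.
  apply: rV_norm_le => // j; rewrite !mxE.
  by have := coord_le_norm (y - z) (lift i j); rewrite !mxE.
exists e => // x xx0 D DO Dx r /andP[r0 re].
pose sg' : R := (-1) ^+ b; pose f (y : X) := y ord0 i - g (col' i y).
have [tau [tau1 taux tauD]] : exists tau : R, [/\ tau ^+ 2 = 1, 0 <= tau * f x &
    forall y, `|y - x0| < e2 -> 0 < tau * f y -> D y].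
  have sq : sg' ^+ 2 = 1 by rewrite /sg' -exprM mulnC exprM sqrrN expr1n expr1n.
  have HO y : `|y - x0| < e2 -> (Om y <-> 0 < sg' * f y) by rewrite distrC => /H2.
  have xe2 : `|x - x0| < e2.
    by apply: (lt_le_trans xx0); apply: (le_trans ee2); rewrite ler_pdivrMr// ler_peMr ?(ltW e20)// ler1n.
  case: DO Dx => -> Dx.
    exists sg'; split=> //; first by apply: ltW; apply/HO.
    by move=> y /HO h /h.
  exists (- sg'); split; first by rewrite sqrrN.
    by rewrite mulNr oppr_ge0 leNgt; apply/negP => /HO -/(_ xe2).
  by move=> y /HO h; rewrite mulNr oppr_gt0 => fy /h /(lt_trans fy); rewrite ltxx.
pose rho := r * k / 2.
have rho0 : 0 < rho by rewrite divr_gt0// mulr_gt0.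
have rhoL : rho * (4 * (L + 1)) = r.
  have -> : rho * (4 * (L + 1)) = r * (k * (2 * (L + 1))) by rewrite /rho; field.
  by rewrite kL mulr1.
have rho4 : rho <= r / 4.
  have := mulr_ge0 (ltW rho0) L0; move: rhoL; lra.
pose z := x + (tau * (3 * r / 4)) *: delta_mx ord0 i : X.
have tn : `|tau| = 1 by apply/eqP; rewrite -sqrp_eq1// real_normK ?num_real// tau1.
have zE j : z ord0 j = x ord0 j + tau * (3 * r / 4) * (j == i)%:R by rewrite !mxE eqxx.
apply: (thick_room (z := z) (mD DO) rho0).
  rewrite (_ : 2 * rho = k * r); last by rewrite /rho; field.
  apply/andP; split; first by rewrite mulr_ge0 ?ltW.
  by rewrite ler_pM2r.
move=> y yz.
have yxi : `|y ord0 i - x ord0 i - tau * (3 * r / 4)| < rho.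
  by have := yz i; rewrite zE eqxx mulr1 opprD addrA.
have yxj j : j != i -> `|y ord0 j - x ord0 j| < rho.
  by move=> ji; have := yz j; rewrite zE (negbTE ji) mulr0 addr0.
have t34 : `|tau * (3 * r / 4)| = 3 * r / 4.
  by rewrite normrM tn mul1r ger0_norm// divr_ge0// mulr_ge0// ltW.
have yx : cube x r y.
  move=> j; have [->|ji] := eqVneq j i; last first.
    by apply: lt_le_trans (yxj j ji) _; move: rho4 r0 => *; lra.
  have := ler_normD (y ord0 i - x ord0 i - tau * (3 * r / 4)) (tau * (3 * r / 4)).
  rewrite subrK t34 => h; apply: (le_lt_trans h); move: yxi rho4; lra.
split=> //; apply: tauD.
  rewrite -(subrKA x); apply: le_lt_trans (ler_normD _ _) _.
  have yx' : `|y - x| < r by move: yx; rewrite cubeE.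
  have := ltrD yx' xx0; move/lt_le_trans; apply; move: re ee2; lra.
have lipy : `|g (col' i y) - g (col' i x)| <= L * rho.
  have xe1 : `|col' i x - col' i x0| < e1.
    by apply: (le_lt_trans (col _ _)); apply: (lt_le_trans xx0); move: ee1 e10; lra.
  have yx' : `|y - x| < r by move: yx; rewrite cubeE.
  apply: lip => //.
    apply: (le_lt_trans (col _ _)); rewrite -(subrKA x); apply: le_lt_trans (ler_normD _ _) _.
    have := ltrD yx' xx0; move/lt_le_trans; apply; move: re ee1; lra.
  by apply: rV_norm_le => [|j]; [exact: ltW|rewrite !mxE; apply: ltW; apply: yxj; rewrite eq_sym neq_lift].
have t1 : 0 <= tau * f x by [].
have t2 : `|tau * (y ord0 i - x ord0 i) - 3 * r / 4| < rho.
  have -> : tau * (y ord0 i - x ord0 i) - 3 * r / 4 =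
      tau * (y ord0 i - x ord0 i - tau * (3 * r / 4)).
    by rewrite [RHS]mulrBr [tau * (tau * _)]mulrA -[tau * tau]expr2 tau1 mul1r.
  by rewrite normrM tn mul1r.
have t3 : `|tau * (g (col' i y) - g (col' i x))| <= L * rho by rewrite normrM tn mul1r.
have -> : tau * f y = tau * f x + tau * (y ord0 i - x ord0 i) - tau * (g (col' i y) - g (col' i x)).
  by rewrite /f; ring.
move: t2 t3; rewrite ltr_norml ler_norml => /andP[t2 _] /andP[_ t3].
have t4 : L * rho <= r / 4 by move: rhoL (ltW rho0); lra.
move: t1 t2 t3 t4 rho4 r0; lra.
Qed.

Lemma locally_thick x0 : exists2 e, 0 < e & forall x, `|x - x0| < e -> thick_at e x.
Proof.
have [Ox|nO] := pselect (Om x0).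
  apply: (interior_thick (D0 := Om)); first by left.
  exact: open_nbhs_nbhs.
have [cx|ncx] := pselect (closure Om x0).
  by apply: boundary_thick; split=> // /interior_subset.
apply: (interior_thick (D0 := ~` Om)); first by right.
have : nbhs x0 (~` closure Om).
  by apply: open_nbhs_nbhs; split => //; apply: closed_openC; exact: closed_closure.
by apply: filterS => y h /subset_closure.
Qed.

Theorem smooth_domain_thick : exists2 c, 0 < c & thick c Om /\ thick c (~` Om).
Proof.
have [M0 HM0] : exists M0, forall x, Om x -> `|x| <= M0.
  case: dom => _ _ _ [M [_ HM]] _; by exists (M + 1); apply: HM; rewrite ltrDl.
pose A := [set x : X | `|x| <= M0 + 1].
have cA : compact A by exact: compact_norm_le.
have [n0 _ Hn0] : \forall n \near \oo, A `<=` thick_at n.+1%:R^-1.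
  apply: ((compact_near_coveringP A).1 cA) => x _.
  have [e e0 He] := locally_thick x.
  have [m _ Hm] : \forall n \near \oo, n.+1%:R^-1 < e.
    have /cvgrPdist_lt/(_ _ e0) := @cvg_harmonic R; apply: filterS => n.
    by rewrite sub0r normrN ger0_norm// invr_ge0.
  exists (ball x e, [set n | (m <= n)%N]); first by split; [exact: nbhsx_ballx|exists m].
  move=> [y n] [/= xy mn]; apply: (@thick_at_le e); first by rewrite invr_gt0 ltr0n/= ltW// Hm.
  by apply: He; rewrite distrC; move: xy; rewrite -ball_normE.
have {}Hn0 := Hn0 n0 (leqnn n0).
set e := n0.+1%:R^-1 in Hn0.
have e0 : 0 < e by rewrite invr_gt0.
have e1 : e <= 1 by rewrite invf_le1// ler1n.
have Ht D : D = Om \/ D = ~` Om -> thick ((e * e) ^+ N) D.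
  move=> DO x r Dx /andP[r0 r1]; rewrite -exprMn.
  have er0 : 0 <= e * e * r by rewrite !mulr_ge0 ?ltW.
  have [xA|xA] := leP `|x| (M0 + 1).
    have [re|/ltW re] := leP r e.
      apply: le_trans (Hn0 x xA D DO Dx r _); last by rewrite r0.
      rewrite lee_fin lerXn2r ?nnegrE//; first by rewrite mulr_ge0 ?ltW.
      by rewrite ler_pM2r// ler_piMr// ltW.
    apply: (@le_trans _ _ (mu (D `&` cube x e))).
      apply: le_trans (Hn0 x xA D DO Dx e _); last by rewrite e0 lexx.
      rewrite lee_fin lerXn2r ?nnegrE//; first by rewrite mulr_ge0 ?ltW.
      by rewrite ler_piMr// mulr_ge0 ?ltW.
    apply: le_measure; rewrite ?inE; try (apply: measurableI; [exact: mD|exact: measurable_cube]).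
    by apply: setIS => y yx i; apply: lt_le_trans re.
  have nO : cube x r `<=` ~` Om.
    move=> y + /HM0; rewrite cubeE//= => yx yM.
    have := ler_normB y (y - x); rewrite opprB addrC subrK => h.
    by have := lt_le_trans xA h; rewrite ltNge => /negP[]; apply: lerD => //; exact: ltW (lt_le_trans yx r1).
  have DE : D = ~` Om.
    by case: DO Dx => -> // Ox; case: (nO x) => // i; rewrite subrr normr0.
  apply: (thick_room (z := x) (k := e * e) (mD DO) r0); last by move=> y yx; split=> //; rewrite DE; exact: nO.
  rewrite er0/= ler_pM2r//; apply: (le_trans (mulr_ile1 (ltW e0) (ltW e0) e1 e1)).
  by rewrite ler1n.
by exists ((e * e) ^+ N); [rewrite exprn_gt0// mulr_gt0|split; apply: Ht; [left|right]].
Qed.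

End thick_domain.

Section weight.
Context {R : realType} (N : nat).
Local Notation X := 'rV[R]_N.
Implicit Types (x : X).
Variables (Om : set X) (Q : X -> R) (Qt : R).
Hypotheses (oO : open Om) (hQ : {within ~` Om, continuous Q}) (Qt0 : 0 < Qt).
Hypothesis Qlim : forall e : R, 0 < e -> exists M : R,
  forall x, ~ Om x -> M < enorm x -> `|Q x - Qt| < e.

Definition ext_weight x : R := \1_(~` Om) x * Q x.

Lemma measurable_ext_weight : measurable_fun setT ext_weight.
Proof.
have mE : measurable (~` Om) by apply: measurableC; exact: measurable_open_rV.
rewrite (_ : ext_weight = Q \_ (~` Om)); last first.
  by apply/funext => x; rewrite /ext_weight patchE indicE; case: ifP => _; rewrite ?mul1r ?mul0r.
apply/(measurable_restrictT _ mE).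
apply: (measurability _ (RGenInftyO.measurableE R)) => //.
move=> /= _ [_ [a ->] <-].
have /open_subspaceP[V oV VE] := (continuousP (Q : subspace (~` Om) -> R)).1 hQ _ (@open_lt R a).
rewrite setIC (_ : Q @^-1` _ = Q @^-1` [set t | t < a]); last first.
  by apply/seteqP; split=> x /=; rewrite in_itv.
by rewrite -VE; apply: measurableI => //; exact: measurable_open_rV.
Qed.

Lemma ext_weight_bounded : exists Qm, forall x, ext_weight x <= Qm.
Proof.
have [M HM] := Qlim ltr01.
have cE : closed (~` Om) by exact: open_closedC.
have cK := compact_closedI (@compact_norm_le R N M) cE.
have wK : {within [set x : X | `|x| <= M] `&` ~` Om, continuous Q}.
  by apply: continuous_subspaceW hQ => x [].
have /compact_bounded[B [_ HB]] := continuous_compact wK cK.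
exists (Num.max (Qt + 1) (B + 1)) => x; have [Ox|nO] := pselect (Om x).
  have q1 : 0 <= Qt + 1 by rewrite addr_ge0 ?ltW.
  have nE : ~ (~` Om) x by move=> /(_ Ox).
  by rewrite /ext_weight (indic_out _ nE) mul0r le_max q1.
have Ex : (~` Om) x by [].
rewrite /ext_weight (indic_in _ Ex) mul1r le_max; apply/orP.
have [xM|xM] := leP `|x| M.
  right; apply: (le_trans (ler_norm _)); apply: (HB (B + 1)); first by rewrite ltrDl.
  by exists x.
left; have := HM x nO (lt_le_trans xM (norm_le_enorm x)).
by rewrite ltr_norml => /andP[_]; rewrite ltrBlDr addrC => /ltW.
Qed.

End weight.

Lemma lint_symmetrized d (T : measurableType d) (R : realType)
    (m : {sigma_finite_measure set T -> \bar R}) (F : T * T -> R) :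
  measurable_fun setT F -> (forall z, 0 <= F z) ->
  lint (m \x m)%E (fun z => F z + F (z.2, z.1))%R = (lint (m \x m)%E F + lint (m \x m)%E F)%E.
Proof.
move=> mF F0; rewrite -[in X in _ = (_ + X)%E](lint_swap m mF F0); apply: lintD => //.
apply: (measurableT_comp mF).
by apply/measurable_fun_pairP; split; [exact: measurable_snd|exact: measurable_fst].
Qed.

Section bump.
Context {R : realType} (N : nat) (s : R).
Local Notation X := 'rV[R]_N.
Local Notation mu := (lebesgue_rV N).
Local Notation mu2 := (lebesgue_rV N \x lebesgue_rV N)%E.
Implicit Types (x y : X).
Hypotheses (s01 : 0 < s < 1).

Let s0 : 0 < s. Proof. by case/andP: s01. Qed.

Definition tent x0 x : R := Num.max 0 (1 - `|x - x0|).

Lemma measurable_tent x0 : measurable_fun setT (tent x0).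
Proof.
have mn : measurable_fun setT (fun x : X => `|x - x0|).
  exact: (measurable_fun_translate (- x0) (@measurable_rV_norm R N)).
by apply: measurable_maxr; mfun.
Qed.

Lemma tent_ge0 x0 x : 0 <= tent x0 x.
Proof. by rewrite le_max lexx. Qed.

Lemma tent_le1 x0 x : tent x0 x <= 1.
Proof. by rewrite ge_max ler01 gerBl normr_ge0. Qed.

Lemma tent_out x0 x : ~ cube x0 1 x -> tent x0 x = 0.
Proof.
rewrite cubeE//= => /negP; rewrite -leNgt => h.
by apply/eqP; rewrite eq_le tent_ge0 andbT ge_max lexx subr_le0.
Qed.

Lemma tent_lip x0 x y : `|tent x0 x - tent x0 y| <= `|x - y|.
Proof.
have H a b : tent x0 a - tent x0 b <= `|a - b|.
  rewrite lerBlDr ge_max addr_ge0 ?tent_ge0//=.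
  apply: (@le_trans _ _ (`|a - b| + (1 - `|b - x0|))).
    have := ler_normD (b - a) (a - x0); rewrite addrA subrK [`|b - a|]distrC; lra.
  by rewrite lerD2l le_max lexx orbT.
by rewrite ler_norml H andbT lerNl opprB [`|x - y|]distrC H.
Qed.

Lemma tent_energy x0 (O : set X) : measurable O -> (Hs_norm2 s O (tent x0) < +oo)%E.
Proof.
move=> mO; have mt := measurable_tent x0.
have mC := measurable_cube x0 1.
have Coo := cube_lty x0 (@ltr01 R).
have mi : measurable_fun setT (\1_(cube x0 1) : X -> R) by mfun.
apply/Hs_norm2_ltyP; split; last first.
  apply: (@le_lt_trans _ _ (lint mu (\1_(cube x0 1) : X -> R))); last by rewrite lint_indic.
  apply: lint_le => //; [exact: measurable_mass|exact: mass_ge0|move=> x].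
  have [Cx|nC] := pselect (cube x0 1 x); last by rewrite /mass tent_out// expr0n mulr0 indic_ge0.
  rewrite (indic_in _ Cx) mulr_ile1 ?indic_ge0 ?indic_le1 ?sqr_ge0//.
  by rewrite exprn_ile1 ?tent_ge0 ?tent_le1.
pose G (z : X * X) := \1_(cube x0 1) z.1 * levy s (z.2 - z.1).
have ml : measurable_fun setT (fun z : X * X => levy s (z.2 - z.1)).
  apply: (measurableT_comp (@measurable_levy R N s)); apply: measurable_fun_rV => i.
  under eq_fun do rewrite !mxE; have mc := @measurable_rV_coord _ R N i.
  by apply: measurable_funB; [exact: (measurableT_comp mc measurable_snd)|
    exact: (measurableT_comp mc measurable_fst)].
have mG : measurable_fun setT G.
  by apply: measurable_funM => //; exact: (measurableT_comp mi measurable_fst).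
have G0 z : 0 <= G z by rewrite mulr_ge0 ?indic_ge0 ?levy_ge0.
have Goo : (lint mu2 G < +oo)%E.
  rewrite (lint_tonelli1 mu mu mG G0).
  have l0 := levy_ge0 s; have L0 : (0 <= lint mu (levy s : X -> R))%E by exact: lint_ge0.
  have Loo := @levy_lty R N s s01.
  have LE : lint mu (levy s : X -> R) = (fine (lint mu (levy s : X -> R)))%:E.
    by rewrite fineK// ge0_fin_numE.
  rewrite (_ : (\int[mu]_x _)%E = lint mu (fun x => fine (lint mu (levy s : X -> R)) * \1_(cube x0 1) x)%R).
    rewrite lintZ; [|exact: mi|by move=> y; exact: indic_ge0|exact: fine_ge0].
    by rewrite lint_indic//; apply: lte_mul_pinfty; rewrite ?lee_fin ?fine_ge0.
  apply: eq_integral => x _; rewrite EFinM -LE muleC /G/=.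
  have mlx : measurable_fun setT (fun y : X => levy s (y - x)).
    exact: (measurable_fun_translate (- x) (@measurable_levy R N s)).
  rewrite lintZ; [|exact: mlx|by move=> y; exact: levy_ge0|exact: indic_ge0].
  by rewrite (lint_translate (- x) (@measurable_levy R N s) (@l0 N)).
have mGs : measurable_fun setT (fun z : X * X => G (z.2, z.1)).
  apply: (measurableT_comp mG).
  by apply/measurable_fun_pairP; split; [exact: measurable_snd|exact: measurable_fst].
apply: (@le_lt_trans _ _ (lint mu2 (fun z => G z + G (z.2, z.1))%R)); last first.
  have GE := lint_symmetrized mu mG G0.
  by rewrite GE; apply: lte_add_pinfty.
have mS : measurable_fun setT (fun z : X * X => G z + G (z.2, z.1)) := measurable_funD mG mGs.
apply: (lint_le mu2 (measurable_cross s mO mt) mS (cross_ge0 s O (tent x0))).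
move=> -[x y]; rewrite /cross /interaction /G/=.
have K0 := kernel_ge0 s (x, y).
have KE a b : Defs.kernel s (b - a, 0) = Defs.kernel s (a, b).
  by rewrite kernelC -{1}(subrr a) kernelD.
rewrite /levy !KE [Defs.kernel s (y, x)]kernelC -/(tent x0 x) [`|x - y|]distrC.
set k := Defs.kernel s (x, y) in K0 *; set mn := Num.min _ _.
have bnd : (tent x0 x - tent x0 y) ^+ 2 <= mn.
  rewrite le_min -[_ ^+ 2]ger0_norm ?sqr_ge0// normrX distrC; apply/andP; split.
    rewrite exprn_ile1// ler_norml; have := tent_ge0 x0 x; have := tent_ge0 x0 y.
    have := tent_le1 x0 x; have := tent_le1 x0 y; lra.
  by rewrite lerXn2r ?nnegrE// [leRHS]distrC distrC tent_lip.
have mn0 : 0 <= mn by exact: le_trans (sqr_ge0 _) bnd.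
rewrite -mulrDl.
have [[nx ny]|Cxy] := pselect (~ cube x0 1 x /\ ~ cube x0 1 y).
  by rewrite !tent_out// subrr expr0n mulr0 mulr_ge0 ?mulr_ge0 ?addr_ge0 ?indic_ge0.
have one : 1 <= \1_(cube x0 1) x + \1_(cube x0 1) y :> R.
  have [Cx|nx] := pselect (cube x0 1 x); first by rewrite (indic_in _ Cx) lerDl indic_ge0.
  have [Cy|ny] := pselect (cube x0 1 y); first by rewrite (indic_in _ Cy) lerDr indic_ge0.
  by case: Cxy.
apply: (@le_trans _ _ (mn * k)); last by rewrite ler_peMl// mulr_ge0.
rewrite -mulrA mulrCA [X in _ <= X]mulrC ler_wpM2l//; apply: le_trans bnd.
by rewrite ler_piMl ?sqr_ge0 ?indic_le1.
Qed.

End bump.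

Section integrable_squares.
Context d (T : measurableType d) (R : realType) (mu : {measure set T -> \bar R}).
Implicit Types (f a b k : T -> R).
Local Notation Rint := (Rintegral mu setT).

Lemma RintE f : Rint f = fine (lint mu f).
Proof. by []. Qed.

Lemma Rint_mkcond (A : set T) f : Rintegral mu A f = Rint (fun x => \1_A x * f x).
Proof. by rewrite /Rintegral lint_mkcond. Qed.

Lemma lint_integrable f : measurable_fun setT f -> (forall x, 0 <= f x) ->
  (lint mu f < +oo)%E -> mu.-integrable setT (EFin \o f).
Proof.
move=> mf f0 foo; apply/integrableP; split; first by mfun.
apply: le_lt_trans foo; rewrite le_eqVlt; apply/orP; left; apply/eqP.
by apply: eq_integral => x _ /=; rewrite ger0_norm.
Qed.

Lemma integrable_bounded f g : measurable_fun setT f -> mu.-integrable setT (EFin \o g) ->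
  (forall x, `|f x| <= g x) -> mu.-integrable setT (EFin \o f).
Proof.
move=> mf ig fg; apply: (le_integrable _ _ _ ig) => //; first by mfun.
by move=> x _ /=; rewrite lee_fin; exact: le_trans (fg x) (ler_norm _).
Qed.

Lemma integrable_addr f g : mu.-integrable setT (EFin \o f) ->
  mu.-integrable setT (EFin \o g) -> mu.-integrable setT (EFin \o (fun x => f x + g x)).
Proof. by move=> fi gi; exact: (integrableD measurableT fi gi). Qed.

Lemma integrable_scaler f (r : R) : mu.-integrable setT (EFin \o f) ->
  mu.-integrable setT (EFin \o (fun x => r * f x)).
Proof. by move=> fi; exact: (integrableZl measurableT r fi). Qed.

Lemma Rint_quad k a b : measurable_fun setT k -> measurable_fun setT a -> measurable_fun setT b ->
  (forall x, 0 <= k x) ->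
  (lint mu (fun x => k x * a x ^+ 2)%R < +oo)%E ->
  (lint mu (fun x => k x * b x ^+ 2)%R < +oo)%E ->
  forall t, Rint (fun x => k x * (a x + t * b x) ^+ 2) =
    Rint (fun x => k x * a x ^+ 2) + 2 * t * Rint (fun x => k x * (a x * b x)) +
    t ^+ 2 * Rint (fun x => k x * b x ^+ 2).
Proof.
move=> mk ma mb k0 aoo boo t.
have ia : mu.-integrable setT (EFin \o (fun x => k x * a x ^+ 2)).
  by apply: lint_integrable => //; [mfun|move=> x; rewrite mulr_ge0 ?sqr_ge0].
have ib : mu.-integrable setT (EFin \o (fun x => k x * b x ^+ 2)).
  by apply: lint_integrable => //; [mfun|move=> x; rewrite mulr_ge0 ?sqr_ge0].
have iab : mu.-integrable setT (EFin \o (fun x => k x * (a x * b x))).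
  apply: (integrable_bounded _ (integrable_addr ia ib)); first by mfun.
  move=> x; rewrite -mulrDr normrM (ger0_norm (k0 x)); apply: ler_wpM2l => //.
  have h1 := sqr_ge0 (a x - b x); have h2 := sqr_ge0 (a x + b x).
  have h3 := sqr_ge0 (a x); have h4 := sqr_ge0 (b x).
  rewrite ler_norml; nra.
have i1 := integrable_scaler (2 * t) iab; have i2 := integrable_scaler (t ^+ 2) ib.
have i3 := integrable_addr ia i1.
rewrite -(RintegralZl _ measurableT iab) -(RintegralZl _ measurableT ib).
rewrite -(RintegralD measurableT ia i1) -(RintegralD measurableT i3 i2).
by congr Rintegral; apply/funext => x; ring.
Qed.

End integrable_squares.

Lemma first_order (R : realType) (A0 A1 A2 e0 : R) : 0 < e0 ->
  (forall e, 0 < e < e0 -> 0 <= A0 + e * A1 + e ^+ 2 * A2) -> 0 <= A0.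
Proof.
move=> e00 H; rewrite leNgt; apply/negP => A00.
pose D := `|A1| + `|A2| + 1.
have D0 : 0 < D by rewrite ltr_wpDl// addr_ge0.
pose e := Num.min (e0 / 2) (Num.min 1 (- A0 / (2 * D))).
have n0 : 0 < - A0 / (2 * D) by rewrite divr_gt0 ?oppr_gt0// mulr_gt0.
have ep : 0 < e by rewrite !lt_min ltr01 n0 divr_gt0.
have e1 : e <= 1 by rewrite !ge_min lexx !orbT.
have e2 : e * (2 * D) <= - A0 by rewrite -ler_pdivlMr ?mulr_gt0// !ge_min lexx !orbT.
have e3 : e < e0.
  by apply: (@le_lt_trans _ _ (e0 / 2)); [rewrite ge_min lexx|rewrite ltr_pdivrMr//; lra].
have := H e (introT andP (conj ep e3)); apply/negP; rewrite -ltNge.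
have h1 : e * A1 <= e * `|A1| by rewrite ler_pM2l// ler_norm.
have h2 : e ^+ 2 * A2 <= e * `|A2|.
  rewrite expr2 -mulrA ler_pM2l//; apply: (le_trans (ler_norm _)).
  by rewrite normrM (gtr0_norm ep) ler_piMl.
move: e2; rewrite /D; nra.
Qed.

Section scaled_constant.
Context {R : realType} (m La th : R).
Hypotheses (m0 : 0 < m) (L0 : 0 < La) (th01 : 0 < th < 1) (mL : m * La `^ th = La).

Let th0 : 0 < th. Proof. by case/andP: th01. Qed.
Let th1 : th < 1. Proof. by case/andP: th01. Qed.

Lemma level_scale y : 0 <= y -> m * (La * y) `^ th = La * y `^ th.
Proof. by move=> y0; rewrite powRM ?(ltW L0)// mulrA mL. Qed.

Lemma level_le x : 0 < x -> m * x `^ th <= x -> La <= x.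
Proof.
move=> x0 H; rewrite leNgt; apply/negP => xL; move: H.
have y0 : 0 < x / La by rewrite divr_gt0.
have y1 : x / La < 1 by rewrite ltr_pdivrMr// mul1r.
have -> : x = La * (x / La) by field; rewrite gt_eqF.
rewrite level_scale ?(ltW y0)// ler_pM2l//; apply/negP; rewrite -ltNge.
set y := x / La in y0 y1 *.
apply: lt_le_trans (powR_ge_harmonic th01 y0).
have d0 : 0 < y + th * (1 - y) by rewrite addr_gt0// mulr_gt0// subr_gt0.
rewrite ltr_pdivlMr// -[ltRHS]mulr1 ltr_pM2l//.
have : th * (1 - y) < 1 * (1 - y) by rewrite ltr_pM2r// subr_gt0.
lra.
Qed.

(** The slope of the optimal inequality at a minimizer. *)
Lemma level_slope (a l c : R) (b_ : R -> R) :
  (forall e, 0 < e -> La + e * l <= b_ e) ->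
  (forall e, 0 < e -> m * b_ e `^ th <= La + 2 * e * a + e ^+ 2 * c) ->
  th * l <= 2 * a.
Proof.
move=> Hb Hm; pose h := l / La.
have hE : l = La * h by rewrite /h; field; rewrite gt_eqF.
pose e0 := (2 * (`|h| + 1))^-1.
have h10 : 0 < `|h| + 1 by rewrite ltr_wpDl.
have e00 : 0 < e0 by rewrite invr_gt0 mulr_gt0.
have ehE : e0 * (2 * (`|h| + 1)) = 1 by rewrite mulVf// gt_eqF// mulr_gt0.
rewrite -subr_ge0.
apply: (@first_order R _ (2 * a * ((1 - th) * h) + c) (c * ((1 - th) * h)) e0) => // e /andP[ep ee].
have eh : `|e * h| < 1 / 2.
  rewrite normrM (gtr0_norm ep); apply: (@le_lt_trans _ _ (e0 * `|h|)).
    by rewrite ler_wpM2r// ltW.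
  have := normr_ge0 h; nra.
move: eh; rewrite ltr_norml => /andP[eh1 eh2].
set y := 1 + e * h.
have y0 : 0 < y by rewrite /y; lra.
have k0 : 0 < y + th * (1 - y) by rewrite /y; move: (th0) (th1) => ? ?; nra.
have Ly : La * y <= b_ e by apply: le_trans (Hb e ep); rewrite /y hE; lra.
have Ly0 : 0 <= La * y by rewrite mulr_ge0 ?ltW.
have P0 : La * y `^ th <= m * b_ e `^ th.
  by rewrite -level_scale ?(ltW y0)// ler_pM2l//; exact: powR_mono (ltW th0) Ly0 Ly.
have P1 : La * (y / (y + th * (1 - y))) <= La * y `^ th.
  by rewrite ler_pM2l//; exact: powR_ge_harmonic.
have := le_trans P1 (le_trans P0 (Hm e ep)).
rewrite mulrA ler_pdivrMr// => H.
have : 0 <= e * (2 * a - th * l + e * (2 * a * ((1 - th) * h) + c) + e ^+ 2 * (c * ((1 - th) * h))).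
  move: H; rewrite hE /y -subr_ge0; congr (0 <= _); ring.
by rewrite pmulr_rge0.
Qed.

End scaled_constant.

Lemma powR_signed_tangent (R : realType) (p a b e : R) : 1 < p ->
  `|a| `^ (p + 1) + e * ((p + 1) * (`|a| `^ (p - 1) * a * b)) <= `|a + e * b| `^ (p + 1).
Proof.
move=> p1; have q1 : 1 < p + 1 by lra.
have := powR_tangent q1 (normr_ge0 (a + e * b)) (normr_ge0 a).
rewrite addrK; apply: le_trans; rewrite lerD2l.
rewrite (powR_subM1 p1)//; set w := `|a| `^ (p - 1).
have w0 : 0 <= w by exact: powR_ge0.
have -> : e * ((p + 1) * (w * a * b)) = (p + 1) * (w * (a * (e * b))) by ring.
rewrite -!mulrA ler_pM2l; last by lra.
apply: ler_wpM2l => //.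
have E : `|a| * `|a| = a * a by rewrite -normrM ger0_norm// -expr2 sqr_ge0.
rewrite mulrBr E -normrM; apply: le_trans (lerB (ler_norm _) (lexx _)).
by rewrite mulrDr addrAC subrr add0r.
Qed.

Section ground.
Context {R : realType} (N : nat) (s p : R).
Local Notation X := 'rV[R]_N.
Local Notation mu := (lebesgue_rV N).
Local Notation mu2 := (lebesgue_rV N \x lebesgue_rV N)%E.
Implicit Types (u v w : X -> R).
Hypotheses (s01 : 0 < s < 1) (p1 : 1 < p).
Variables (O : set X) (Q : X -> R) (m : R).
Hypotheses (oO : open O) (ext0 : (0 < mu (~` O))%E).
Local Notation Qe := (ext_weight O Q).
Local Notation S := (Hs_norm2 s O).
Local Notation B := (potential Qe (p + 1)).
Local Notation th := (2 / (p + 1)).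
Local Notation Rint nu := (Rintegral nu setT).
Hypotheses (mQ : measurable_fun setT Qe) (Q0 : forall x, 0 <= Qe x) (m0 : 0 < m).
Hypothesis opt : forall u, measurable_fun setT u -> (S u < +oo)%E ->
  (B u < +oo)%E /\ ((m * fine (B u) `^ th)%:E <= S u)%E.

Let mO : measurable O. Proof. exact: measurable_open_rV. Qed.
Let mi : measurable_fun setT (\1_(~` O) : X -> R).
Proof. by have mOc : measurable (~` O) := measurableC mO; mfun. Qed.
Let q0 : 0 < p + 1. Proof. exact: addr_gt0 (lt_trans ltr01 p1) ltr01. Qed.
Let q2 : 2 < p + 1. Proof. by rewrite -[2]/(1 + 1) ltrD2r. Qed.
Let q1 : 1 < p + 1. Proof. by apply: lt_trans q2; rewrite ltr1n. Qed.
Let th0 : 0 < th < 1.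
Proof. by rewrite divr_gt0//= ltr_pdivrMr// mul1r. Qed.
Let thq : th * (p + 1) = 2. Proof. by rewrite divfK// gt_eqF. Qed.

Definition pairing u v : R :=
  2^-1 * Rint mu2 (fun z => interaction s O z * ((u z.1 - u z.2) * (v z.1 - v z.2))) +
  Rint mu (fun x => \1_(~` O) x * (u x * v x)).

Definition source u v : R := Rint mu (fun x => Qe x * (`|u x| `^ (p - 1) * u x * v x)).

Lemma energyE u : energy s p O Q u = 2^-1 * fine (S u) - (p + 1)^-1 * fine (B u).
Proof.
rewrite /energy Rint_mkcond RintE; congr (_ - _ * fine (lint mu _)).
by apply/funext => x; rewrite mulrA.
Qed.

Lemma denergyE u v : denergy s p O Q u v = pairing u v - source u v.
Proof.
rewrite /denergy /pairing /source (Rint_mkcond _ (~` (O `*` O))) !(Rint_mkcond _ (~` O)).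
have E1 : (fun z : X * X => \1_(~` (O `*` O)) z *
      ((u z.1 - u z.2) * (v z.1 - v z.2) * Defs.kernel s z)) =
    (fun z => interaction s O z * ((u z.1 - u z.2) * (v z.1 - v z.2))).
  by apply/funext => z; rewrite /interaction -[RHS]mulrA [X in _ = _ * X]mulrC.
have E2 : (fun x : X => \1_(~` O) x * (Q x * `|u x| `^ (p - 1) * u x * v x)) =
    (fun x => Qe x * (`|u x| `^ (p - 1) * u x * v x)).
  by apply/funext => x; rewrite /ext_weight -!mulrA.
by rewrite E1 E2.
Qed.

Lemma measurable_gap u : measurable_fun setT u ->
  measurable_fun setT (fun z : X * X => u z.1 - u z.2).
Proof.
move=> mu_; apply: measurable_funB.
  exact: (measurableT_comp mu_ measurable_fst).
exact: (measurableT_comp mu_ measurable_snd).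
Qed.

Lemma Hs_norm2_fine u : (S u < +oo)%E -> fine (S u) =
  2^-1 * Rint mu2 (fun z => interaction s O z * (u z.1 - u z.2) ^+ 2) +
  Rint mu (fun x => \1_(~` O) x * u x ^+ 2).
Proof.
move=> /Hs_norm2_ltyP[h1 h2]; rewrite Hs_norm2E.
have c1 : lint mu2 (cross s O u) \is a fin_num.
  by rewrite ge0_fin_numE// lint_ge0// => z; exact: cross_ge0.
have c2 : lint mu (mass O u) \is a fin_num.
  by rewrite ge0_fin_numE// lint_ge0// => z; exact: mass_ge0.
by rewrite fineD// ?fineM// fin_numM.
Qed.

Lemma Hs_norm2_expand u v t : Hs s O u -> Hs s O v ->
  fine (S (fun x => u x + t * v x)%R) =
  fine (S u) + 2 * t * pairing u v + t ^+ 2 * fine (S v).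
Proof.
move=> [mu_ Su] [mv Sv].
have mI := measurable_interaction s mO.
have Sw := Hs_norm2_lin t mO mu_ mv Su Sv.
have /Hs_norm2_ltyP[u1 u2] := Su; have /Hs_norm2_ltyP[v1 v2] := Sv.
have E1 := Rint_quad mI (measurable_gap mu_) (measurable_gap mv) (interaction_ge0 s O) u1 v1 t.
have E2 := Rint_quad mi mu_ mv (indic_ge0 _ _) u2 v2 t.
rewrite !Hs_norm2_fine// E2 /pairing.
have -> : (fun z : X * X => interaction s O z * (u z.1 + t * v z.1 - (u z.2 + t * v z.2)) ^+ 2) =
    (fun z => interaction s O z * ((u z.1 - u z.2) + t * (v z.1 - v z.2)) ^+ 2).
  by apply/funext => z; congr (_ * _ ^+ 2); ring.
by rewrite E1; field.
Qed.

Lemma potential_tangent u v e : Hs s O u -> Hs s O v ->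
  fine (B u) + e * ((p + 1) * source u v) <= fine (B (fun x => u x + e * v x)%R).
Proof.
move=> [mu_ Su] [mv Sv].
have mw : measurable_fun setT (fun x : X => u x + e * v x) by mfun.
have Sw := Hs_norm2_lin e mO mu_ mv Su Sv.
have int (w : X -> R) : measurable_fun setT w -> (S w < +oo)%E ->
    mu.-integrable setT (EFin \o (fun x => Qe x * `|w x| `^ (p + 1))).
  move=> mw' Sw'; apply: lint_integrable; [by mfun| |by case: (opt mw' Sw')].
  by move=> x; rewrite mulr_ge0 ?powR_ge0.
have iu := int u mu_ Su; have iv := int v mv Sv; have iw := int _ mw Sw.
have isrc : mu.-integrable setT (EFin \o (fun x => Qe x * (`|u x| `^ (p - 1) * u x * v x))).
  apply: (integrable_bounded _ (integrable_addr iu iv)); first by mfun.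
  move=> x; rewrite -mulrDr normrM (ger0_norm (Q0 x)); apply: ler_wpM2l => //.
  rewrite !normrM (ger0_norm (powR_ge0 _ _)) -(powR_subM1 p1)// mulrC.
  have := mul_powR_split q1 ltr01 (normr_ge0 (v x)) (normr_ge0 (u x)).
  by rewrite addrK powR1 !mul1r.
have is1 := integrable_scaler (e * (p + 1)) isrc.
rewrite /source mulrA -(RintegralZl _ measurableT isrc) -[fine (B u)]RintE.
rewrite -(RintegralD measurableT iu is1) -[fine (B _)]RintE.
apply: (le_Rintegral measurableT (integrable_addr iu is1) iw) => x _.
have -> : Qe x * `|u x| `^ (p + 1) + e * (p + 1) * (Qe x * (`|u x| `^ (p - 1) * u x * v x)) =
    Qe x * (`|u x| `^ (p + 1) + e * ((p + 1) * (`|u x| `^ (p - 1) * u x * v x))) by ring.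
by apply: ler_wpM2l => //; exact: powR_signed_tangent.
Qed.

Lemma optimal_fine u : Hs s O u -> m * fine (B u) `^ th <= fine (S u).
Proof.
move=> [mu_ Su]; have [_] := opt mu_ Su.
have SE : S u = (fine (S u))%:E by rewrite fineK// ge0_fin_numE// Hs_norm2_ge0.
by rewrite SE lee_fin.
Qed.

Lemma minimizer_stationary u v La : 0 < La -> m * La `^ th = La -> Hs s O u -> Hs s O v ->
  fine (S u) = La -> fine (B u) = La -> denergy s p O Q u v = 0.
Proof.
move=> La0 mL Hu Hv SL BL; rewrite denergyE; apply/eqP; rewrite subr_eq0 eq_le.
have Hlin t : Hs s O (fun x => u x + t * v x).
  move: Hu Hv => [mu_ Su] [mv Sv]; split; first by mfun.
  exact: Hs_norm2_lin.
have key t : th * (t * ((p + 1) * source u v)) <= 2 * (t * pairing u v).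
  apply: (level_slope m0 La0 th0 mL (c := t ^+ 2 * fine (S v))
    (b_ := fun e => fine (B (fun x => u x + (e * t) * v x)%R))) => e e0.
    by have := potential_tangent (e * t) Hu Hv; rewrite BL -[e * t * _]mulrA.
  apply: (le_trans (optimal_fine (Hlin _))).
  rewrite Hs_norm2_expand// SL le_eqVlt; apply/orP; left; apply/eqP; ring.
have E : th * ((p + 1) * source u v) = 2 * source u v by rewrite mulrA thq.
have k1 := key 1; have k2 := key (-1).
rewrite !mulN1r !mul1r ?mulrN in k1 k2; rewrite E in k1 k2.
by apply/andP; split; move: k1 k2 => *; lra.
Qed.

Lemma denergy_diag u : Hs s O u -> denergy s p O Q u u = fine (S u) - fine (B u).
Proof.
move=> [mu_ Su]; rewrite denergyE (Hs_norm2_fine Su) /pairing.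
have E1 : (fun z : X * X => interaction s O z * ((u z.1 - u z.2) * (u z.1 - u z.2))) =
    (fun z => interaction s O z * (u z.1 - u z.2) ^+ 2).
  by apply/funext => z; rewrite expr2.
have E2 : (fun x : X => \1_(~` O) x * (u x * u x)) = (fun x => \1_(~` O) x * u x ^+ 2).
  by apply/funext => x; rewrite expr2.
have E3 : source u u = fine (B u).
  rewrite /source RintE; congr (fine (lint mu _)); apply/funext => x; congr (_ * _).
  rewrite (powR_subM1 q1)// addrK (powR_subM1 p1)// -!mulrA; congr (_ * _).
  by rewrite -normrM ger0_norm// -expr2 sqr_ge0.
by rewrite E1 E2 E3.
Qed.

Lemma neq0_energy_gt0 v : Hs_neq0 s O v -> 0 < fine (S v).
Proof.
move=> [[mv Sv] vn]; have S0 := Hs_norm2_ge0 s O v.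
rewrite fine_gt0// Sv andbT lt_neqAle S0 andbT eq_sym; apply/eqP => SZ; apply: vn.
pose u x := `|v x|.
have mu_ : measurable_fun setT u by rewrite /u; mfun.
have u0 x : 0 <= u x by exact: normr_ge0.
have Su : S u = 0%E.
  by apply/eqP; rewrite eq_le Hs_norm2_ge0 andbT -SZ Hs_norm2_abs.
have moo : (lint mu (mass O u) < +oo)%E.
  have Soo : (S u < +oo)%E by rewrite Su.
  by have [] := (Hs_norm2_ltyP _ _ _).1 Soo.
have mb := measurable_balayage s oO mu_ u0.
have mk := measurable_kappa s oO.
have mI : measurable_fun setT (\1_O : X -> R) by mfun.
have k0 x : 0 <= kappa s O x.
  by rewrite fine_ge0// lint_ge0// => y; exact: ext_kernel_ge0.
have := balayage_gain s01 oO ext0 mu_ u0 moo; rewrite Su.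
set G := lint mu _ => GE.
have G0 : (0 <= G)%E.
  by apply: lint_ge0 => x; rewrite mulr_ge0 ?indic_ge0// mulr_ge0 ?sqr_ge0.
have GZ : G = 0%E.
  by apply/eqP; rewrite eq_le G0 andbT GE leeDr// Hs_norm2_ge0.
have inO : {ae mu, forall x, \1_O x * ((u x - balayage s O u x) ^+ 2 * kappa s O x) = 0}.
  apply/lint_eq0; [by mfun| |exact: GZ].
  by move=> x; rewrite mulr_ge0 ?indic_ge0// mulr_ge0 ?sqr_ge0.
have outO : {ae mu, forall x, mass O u x = 0}.
  apply/lint_eq0; [exact: measurable_mass|exact: mass_ge0|].
  move: Su; rewrite Hs_norm2E => H; apply/eqP; rewrite eq_le lint_ge0 ?andbT//; last exact: mass_ge0.
  rewrite -H leeDr// mule_ge0 ?lee_fin// lint_ge0// => z; exact: cross_ge0.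
have ext_z : {ae mu, forall x, ~ O x -> u x = 0}.
  apply: filterS outO => x + nO; rewrite /mass indic_in// mul1r => /eqP.
  by rewrite sqrf_eq0 => /eqP.
have bal_z x : O x -> balayage s O u x = 0.
  move=> Ox; rewrite /balayage mem_set// (_ : lint _ _ = 0%E) ?mul0r//.
  have mkx := measurable_ext_kernel s oO x; have kx0 := @ext_kernel_ge0 R N s O x.
  apply/lint_eq0; [by mfun|by move=> y; rewrite mulr_ge0|].
  apply: filterS ext_z => y H; have [Oy|nO] := pselect (O y); last by rewrite H ?mulr0.
  have nE : ~ (~` O) y by move=> /(_ Oy).
  by rewrite /ext_kernel (indic_out _ nE) !mul0r.
apply: filterS2 inO ext_z => x H1 H2.
have [Ox|nO] := pselect (O x); last by apply/eqP; rewrite -normr_eq0; apply/eqP; exact: H2.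
move: H1; rewrite (indic_in _ Ox) mul1r bal_z// subr0 => /eqP.
rewrite mulf_eq0 (gt_eqF (kappa_gt0 s01 oO ext0 Ox)) orbF sqrf_eq0 => /eqP h.
by apply/eqP; rewrite -normr_eq0; apply/eqP.
Qed.

Lemma HsZ t v : Hs s O v -> Hs s O (fun x => t * v x).
Proof.
move=> [mv Sv]; split; first by mfun.
by rewrite Hs_norm2Z//; apply: lte_mul_pinfty => //; rewrite lee_fin sqr_ge0.
Qed.

Lemma fine_potentialZ t v : 0 <= t -> Hs s O v ->
  fine (B (fun x => t * v x)%R) = t `^ (p + 1) * fine (B v).
Proof.
move=> t0 [mv Sv]; have [Boo _] := opt mv Sv.
have BE : B v = (fine (B v))%:E.
  by rewrite fineK// ge0_fin_numE//; exact: potential_ge0.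
have -> : B (fun x => t * v x)%R = ((t `^ (p + 1))%:E * B v)%E.
  rewrite /potential -lintZ; try side.
  by congr lint; apply/funext => x; rewrite normrM powRM// (ger0_norm t0) mulrCA.
by rewrite BE.
Qed.

Lemma fine_Hs_norm2Z t v : Hs s O v ->
  fine (S (fun x => t * v x)%R) = t ^+ 2 * fine (S v).
Proof.
move=> [mv Sv]; have SE : S v = (fine (S v))%:E.
  by rewrite fineK// ge0_fin_numE// Hs_norm2_ge0.
by rewrite Hs_norm2Z// SE.
Qed.

Lemma energyZ t v : 0 <= t -> Hs s O v -> energy s p O Q (fun x => t * v x) =
  2^-1 * t ^+ 2 * fine (S v) - (p + 1)^-1 * (t `^ (p + 1) * fine (B v)).
Proof. by move=> t0 Hv; rewrite energyE fine_potentialZ// fine_Hs_norm2Z// mulrA. Qed.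

Definition ray_sup v : \bar R :=
  ereal_sup [set (energy s p O Q (fun x => t * v x))%:E | t in [set t | 0 <= t]].

Section level.
Variable La : R.
Hypotheses (La0 : 0 < La) (mL : m * La `^ th = La).
Local Notation E0 := (2^-1 * La - (p + 1)^-1 * La).

Let gap0 : 0 < 2^-1 - (p + 1)^-1.
Proof. by rewrite subr_gt0 ltf_pV2// posrE. Qed.

Lemma balanced_energy_ge v : Hs s O v -> 0 < fine (S v) -> fine (S v) = fine (B v) ->
  E0 <= energy s p O Q v.
Proof.
move=> Hv S0 SB; rewrite energyE -SB -!mulrBl ler_pM2l//.
by apply: (level_le La0 th0 mL S0); rewrite {1}SB; exact: optimal_fine.
Qed.

Lemma ray_sup_ge v : Hs_neq0 s O v -> (E0%:E <= ray_sup v)%E.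
Proof.
move=> Hn; have S0 := neq0_energy_gt0 Hn; case: Hn => Hv _.
have B0 : 0 <= fine (B v) by rewrite fine_ge0//; exact: potential_ge0.
have [Bz|Bn] := eqVneq (fine (B v)) 0.
  have t0 : 0 <= Num.sqrt (2 * La / fine (S v)).
    exact: sqrtr_ge0.
  apply: le_trans (ereal_sup_ubound _); last by exists (Num.sqrt (2 * La / fine (S v))).
  rewrite lee_fin energyZ// Bz !mulr0 subr0 sqr_sqrtr; last first.
    by rewrite divr_ge0 ?mulr_ge0// ltW.
  have -> : 2^-1 * (2 * La / fine (S v)) * fine (S v) = La by field; rewrite gt_eqF.
  have h1 : 2^-1 * La <= La by rewrite ler_piMl ?(ltW La0)// invf_le1// ler1n.
  apply: le_trans h1; rewrite gerBl; apply: mulr_ge0; last exact: ltW.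
  by rewrite invr_ge0 ltW.
have Bp : 0 < fine (B v) by rewrite lt0r Bn.
pose t := (fine (S v) / fine (B v)) `^ (p + 1 - 2)^-1.
have r0 : 0 < fine (S v) / fine (B v) by rewrite divr_gt0.
have t0 : 0 < t by exact: powR_gt0.
have tt : t `^ (p + 1) * fine (B v) = t ^+ 2 * fine (S v).
  rewrite (powR_sub2 q2 (ltW t0)) -powRrM mulVf ?gt_eqF ?subr_gt0//.
  by rewrite powRr1 ?(ltW r0)//; field; rewrite gt_eqF.
apply: le_trans (ereal_sup_ubound _); last by exists t => //=; exact: ltW.
rewrite lee_fin; apply: balanced_energy_ge; first exact: HsZ.
  by rewrite fine_Hs_norm2Z// mulr_gt0// exprn_gt0.
by rewrite fine_Hs_norm2Z// fine_potentialZ ?(ltW t0)// tt.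
Qed.

Lemma minimizer_ray_sup u : Hs s O u -> fine (S u) = La -> fine (B u) = La ->
  (ray_sup u <= E0%:E)%E.
Proof.
move=> Hu SL BL; apply: ge_ereal_sup => _ [t /= t0 <-].
rewrite lee_fin energyZ// SL BL.
have q21 : 1 < (p + 1) / 2 by rewrite ltr_pdivlMr// mul1r.
have := powR_tangent q21 (sqr_ge0 t) ler01.
rewrite !powR1 mulr1 -[t ^+ 2](powR_mulrn 2 t0) -powRrM (mulrC 2%:R) divfK ?pnatr_eq0//.
rewrite powR_mulrn// => H.
have q00 : 0 < (p + 1)^-1 by rewrite invr_gt0.
have := ler_wpM2l (ltW q00) H.
have -> : (p + 1)^-1 * (1 + (p + 1) / 2 * (t ^+ 2 - 1)) = (p + 1)^-1 + 2^-1 * (t ^+ 2 - 1).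
  by field; rewrite gt_eqF.
move=> H2.
have -> : 2^-1 * t ^+ 2 * La - (p + 1)^-1 * (t `^ (p + 1) * La) =
  (2^-1 * t ^+ 2 - (p + 1)^-1 * t `^ (p + 1)) * La by ring.
rewrite -mulrBl ler_pM2r//.
rewrite lerBlDr -lerBlDl; apply: le_trans H2.
rewrite le_eqVlt; apply/orP; left; apply/eqP; field.
by rewrite gt_eqF.
Qed.

Lemma minimizer_is_ground_state u : Hs s O u -> fine (S u) = La -> fine (B u) = La ->
  ground_state s p O Q u.
Proof.
move=> Hu SL BL.
have eu : energy s p O Q u = E0 by rewrite energyE SL BL.
have nu : Hs_neq0 s O u.
  split=> // uz; move: La0; rewrite -BL (_ : B u = 0%E) ?ltxx//.
  case: Hu => mu_ _; apply/lint_eq0; [by mfun|by move=> x; rewrite mulr_ge0 ?powR_ge0|].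
  by apply: filterS uz => x ->; rewrite normr0 powR0 ?mulr0// gt_eqF.
split.
- by split=> // v Hv; exact: (minimizer_stationary La0 mL).
- apply/eqP; rewrite eq_le eu; apply/andP; split.
    by apply: le_ereal_inf_tmp => _ [v Hv <-]; exact: ray_sup_ge.
  apply: le_trans (minimizer_ray_sup Hu SL BL).
  by apply: ereal_inf_lbound; exists u.
- apply/eqP; rewrite eq_le eu; apply/andP; split.
    apply: le_ereal_inf_tmp => _ [v [Hn nv] <-]; rewrite lee_fin.
    have [Hv _] := Hn; apply: balanced_energy_ge => //; first exact: neq0_energy_gt0.
    by move: nv; rewrite denergy_diag// => /eqP; rewrite subr_eq0 => /eqP.
  rewrite -eu; apply: ereal_inf_lbound; exists u => //; split=> //.
  by rewrite denergy_diag// SL BL subrr.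
Qed.

End level.

Lemma ground_state_of_minimizer u : measurable_fun setT u -> (S u <= m%:E)%E -> B u = 1%:E ->
  exists v, ground_state s p O Q v.
Proof.
move=> mu_ Sm B1; have Soo : (S u < +oo)%E by apply: le_lt_trans Sm (ltry _).
have Hu : Hs s O u by split.
have SE : fine (S u) = m.
  apply/eqP; rewrite eq_le; apply/andP; split.
    by rewrite -lee_fin fineK// ge0_fin_numE// Hs_norm2_ge0.
  by have := optimal_fine Hu; rewrite B1 /= powR1 mulr1.
pose t := m `^ (p + 1 - 2)^-1.
have t0 : 0 < t by exact: powR_gt0.
have tm : t `^ (p + 1) = t ^+ 2 * m.
  rewrite (powR_sub2 q2 (ltW t0)) mulrC; congr (_ * _).
  by rewrite -powRrM mulVf ?gt_eqF ?subr_gt0// powRr1// ltW.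
have La0 : 0 < t `^ (p + 1) by exact: powR_gt0.
have mL : m * (t `^ (p + 1)) `^ th = t `^ (p + 1).
  rewrite -powRrM [_ * th]mulrC thq.
  by rewrite -[2]/(2%:R) powR_mulrn ?(ltW t0)// tm mulrC.
exists (fun x => t * u x); apply: (minimizer_is_ground_state La0 mL).
- exact: HsZ.
- by rewrite fine_Hs_norm2Z// SE tm.
- by rewrite fine_potentialZ ?(ltW t0)// B1 mulr1.
Qed.

End ground.

Lemma far_unit_cube (R : realType) (N : nat) (Om : set 'rV[R]_N) (M : R) :
  (0 < N)%N -> (forall x, Om x -> `|x| <= M) -> exists x0, cube x0 1 `<=` ~` Om.
Proof.
move=> N0 OM; pose x0 : 'rV[R]_N := const_mx (`|M| + 2); exists x0 => x.
have x0M : `|M| + 2 <= `|x0|.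
  have := coord_le_norm x0 (Ordinal N0); rewrite mxE; apply: le_trans.
  exact: ler_norm.
rewrite cubeE//= => xx0 /OM xM.
have := ler_normB x (x - x0); rewrite opprB addrC subrK => h.
have := ler_norm M; lra.
Qed.

Theorem theorem1p1 (R : realType) (N : nat) (s p : R) (Om : set 'rV[R]_N)
    (Q : 'rV[R]_N -> R) (Qt : R)
    (hs : 0 < s < 1) (hN : 2 * s < N%:R)
    (hp : 1 < p < (N%:R + 2 * s) / (N%:R - 2 * s))
    (hOm : smooth_bounded_domain Om)
    (hQ : {within ~` Om, continuous Q})
    (hQt : 0 < Qt)
    (hQge : forall x, ~ Om x -> Qt <= Q x)
    (hQlim : forall e : R, 0 < e -> exists M : R,
      forall x, ~ Om x -> M < enorm x -> `|Q x - Qt| < e) :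
  exists u : 'rV[R]_N -> R, ground_state s p Om Q u.
Proof.
have s0 : 0 < s by case/andP: hs.
have p1 : 1 < p by case/andP: hp.
have q2 : 2 < p + 1 by rewrite -[2]/(1 + 1) ltrD2r.
have N0 : (0 < N)%N by rewrite -(ltr0n R) (N_gt0 s0 hN).
have rho1 : rho N s (p + 1) < 1 by exact: rho_lt1.
have [c c0 [tO tE]] := smooth_domain_thick hOm.
have [nO oO _ [M [_ HM]] _] := hOm.
have bO x : Om x -> `|x| <= M + 1 by apply: HM; rewrite ltrDl.
have [x0 x0out] := far_unit_cube N0 bO.
have x0in : cube x0 1 x0 by move=> i; rewrite subrr normr0.
have mC := measurable_cube x0 1.
have ext0 : (0 < lebesgue_rV N (~` Om))%E.
  apply: (@lt_le_trans _ _ (lebesgue_rV N (cube x0 1))).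
    by rewrite cube_measure// lte_fin exprn_gt0// mulr_gt0.
  apply: le_measure; rewrite ?inE//.
  by apply: measurableC; exact: measurable_open_rV.
have mQ := measurable_ext_weight oO hQ.
have [Qm QQm] := ext_weight_bounded oO hQ hQt hQlim.
have QE x : ~ Om x -> ext_weight Om Q x = Q x.
  by move=> nO'; rewrite /ext_weight indic_in ?mul1r.
have QO x : Om x -> ext_weight Om Q x = 0.
  move=> Ox; have nE : ~ (~` Om) x by move=> /(_ Ox).
  by rewrite /ext_weight (indic_out _ nE) mul0r.
have QQt x : ~ Om x -> Qt <= ext_weight Om Q x by move=> nO'; rewrite QE//; exact: hQge.
have Q0 x : 0 <= ext_weight Om Q x.
  have [Ox|nO'] := pselect (Om x); first by rewrite QO.
  exact: le_trans (ltW hQt) (QQt x nO').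
have Qlim e : 0 < e -> exists M : R, forall x, ~ Om x -> M < `|x| ->
    `|ext_weight Om Q x - Qt| < e.
  move=> /hQlim[M' HM']; exists M' => x nO' xM; rewrite QE//; apply: HM' => //.
  exact: lt_le_trans xM (norm_le_enorm x).
have mt := measurable_tent x0.
have testfun : exists u : 'rV[R]_N -> R, [/\ measurable_fun setT u, (Hs_norm2 s Om u < +oo)%E &
    (0 < potential (ext_weight Om Q) (p + 1) u)%E].
  exists (tent x0); split=> //; first by apply: tent_energy => //; exact: measurable_open_rV.
  rewrite lt_neqAle potential_ge0// andbT eq_sym; apply/eqP => Z.
  have m1 : measurable_fun setT (fun x : 'rV[R]_N => ext_weight Om Q x * `|tent x0 x| `^ (p + 1)).
    by mfun.
  have n1 (x : 'rV[R]_N) : 0 <= ext_weight Om Q x * `|tent x0 x| `^ (p + 1).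
    by rewrite mulr_ge0 ?powR_ge0.
  have ae0 := (lint_eq0 (lebesgue_rV N) m1 n1).1 Z.
  have : lebesgue_rV N (cube x0 1) = 0%E.
    rewrite -(lint_indic (lebesgue_rV N) mC); apply/lint_eq0; [by mfun|by move=> x; exact: indic_ge0|].
    apply: filterS ae0 => x /eqP; rewrite mulf_eq0 => /orP[|].
      move=> /eqP Qx; apply: indic_out => Cx.
      by have := QQt x (x0out x Cx); rewrite Qx leNgt hQt.
    rewrite powR_eq0 normr_eq0 => /andP[/eqP tx _]; apply: indic_out; rewrite cubeE//= => xx0.
    by move: tx; rewrite /tent => /eqP; rewrite eq_le ge_max lexx subr_le0 leNgt xx0.
  by apply/eqP; rewrite cube_measure// gt_eqF// lte_fin exprn_gt0// mulr_gt0.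
have [u [mu_ Su Bu]] := minimizer_exists hs hN q2 rho1 oO ext0 c0 nO tO tE bO mQ Q0 QO QQm
  hQt QQt Qlim testfun.
apply: (ground_state_of_minimizer hs p1 oO ext0 mQ Q0 _ _ mu_ Su Bu).
  exact: (best_gt0 hs hN q2 rho1 oO c0 tE mQ Q0 QO QQm testfun).
exact: (best_le hs hN q2 rho1 oO c0 tE mQ Q0 QO QQm testfun).
Qed.
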